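(* Let $q$ be a power of an odd prime, $K=\mathbb F_q$ the finite field with $q$ elements, $G=\mathrm{SL}_2(K)$, and $T=\mathrm{Sym}(\mathfrak{sl}_2^* )=K[a,b,c]$. For the conjugation action of $G$ on $T$, the element $$\widetilde f_4=-\prod_{A\in K,\,B\in K^\times}\Big(2Aa+Bb-\tfrac{A^2+\delta}{B}c\Big)$$ (where $x^2+\delta\in K[x]$ is a fixed irreducible polynomial) has a square root $\sqrt{\widetilde f_4}$ in $T$, and $$T^G=K\big[\det,\ \mathcal P^1(\det),\ \sqrt{\widetilde f_4},\ h\big],$$ where $\det=-a^2-bc$, $\mathcal P^1(\det)=-2a^{q+1}-b^qc-bc^q$, and $h$ is the Jacobian of the other three invariants listed. The invariant ring is a hypersurface with Hilbert series $$\mathrm{Hilb}(T^G,z)=\frac{1+z^{\binom{q+1}2}}{(1-z^2)(1-z^{q+1})(1-z^{\binom q2})}.$$ Additionally, $T^G$ is not $F$-regular, is a unique factorisation domain, and has $a$-invariant $-3$.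
   Context: $\mathfrak{sl}_2$ is the space of traceless $2\times2$ matrices over $K$, and $\{a,b,c\}$ is the basis dual to $\begin{pmatrix}1&0\\0&-1\end{pmatrix},\begin{pmatrix}0&1\\0&0\end{pmatrix},\begin{pmatrix}0&0\\1&0\end{pmatrix}$. The conjugation action: $\sigma\in G$ acts on $T$ by the $K$-algebra automorphism sending each variable to the corresponding entry of $\sigma^{-1}\begin{pmatrix}a&b\\c&-a\end{pmatrix}\sigma$. $T$ has the standard grading. $\mathrm{Hilb}(R,z)=\sum_n\dim_K(R_n)z^n$. The $a$-invariant of a graded Cohen–Macaulay ring equals the degree (numerator degree minus denominator degree) of its Hilbert series. A hypersurface is a graded $K$-algebra isomorphic to a (weighted) polynomial ring modulo one homogeneous element. The Jacobian is the determinant of the matrix of partial derivatives with respect to $a,b,c$. *)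

(* Defs.v *)
From HB Require Import structures.
From mathcomp Require Import all_boot all_order all_algebra.
From mathcomp Require Export mpoly.

Set Implicit Arguments.
Unset Strict Implicit.
Unset Printing Implicit Defensive.

Import Order.TTheory GRing.Theory Num.Theory.
Local Open Scope ring_scope.

(* Ideals and other subsets of a ring need not be decidable: they are         *)
(* Prop-valued predicates.                                                    *)

Section Ideals.
Variable R : comNzRingType.
Implicit Types (I P Q S : R -> Prop).

Definition is_ideal I : Prop :=
  [/\ I 0, forall x y, I x -> I y -> I (x + y) & forall r x, I x -> I (r * x)].

Definition ideal_gen S (x : R) : Prop :=
  exists (n : nat) (r s : 'I_n -> R),
    (forall i, S (s i)) /\ x = \sum_(i < n) r i * s i.

Definition is_prime_ideal P : Prop :=
  [/\ is_ideal P, ~ P 1 & forall x y, P (x * y) -> P x \/ P y].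

Definition is_minimal_prime P : Prop :=
  is_prime_ideal P /\
  forall Q, is_prime_ideal Q -> (forall x, Q x -> P x) -> forall x, P x -> Q x.

(* The complement of the union of the minimal primes (nonzero elements if R   *)
(* is a domain).                                                              *)
Definition off_minimal_primes (c : R) : Prop :=
  forall P, is_minimal_prime P -> ~ P c.

(* I^[m], the ideal generated by the m-th powers of the elements of I.        *)
Definition bracket_power (m : nat) I : R -> Prop :=
  ideal_gen (fun y => exists2 x, I x & y = x ^+ m).

Definition tight_closure (p : nat) I (x : R) : Prop :=
  exists2 c, off_minimal_primes c &
    exists e0 : nat, forall e : nat, (e0 <= e)%N ->
      bracket_power (p ^ e) I (c * x ^+ (p ^ e)).

Definition weakly_F_regular (p : nat) : Prop :=
  forall I, is_ideal I -> forall x, tight_closure p I x -> I x.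

End Ideals.

(* f exhibits S as the localization of R at the multiplicative set W.         *)
Definition is_localization (R S : comNzRingType) (W : R -> Prop)
    (f : {rmorphism R -> S}) : Prop :=
  [/\ W 1 /\ (forall v w, W v -> W w -> W (v * w)),
      forall w, W w -> exists u, f w * u = 1,
      forall s, exists r w, W w /\ s * f w = f r &
      forall r, f r = 0 <-> exists2 w, W w & w * r = 0].

(* Hochster-Huneke: all ideals of all localizations are tightly closed; p is  *)
(* the characteristic. The zero ring, not a comNzRingType, would add nothing. *)
Definition F_regular (p : nat) (R : comNzRingType) : Prop :=
  forall (S : comNzRingType) (W : R -> Prop) (f : {rmorphism R -> S}),
    is_localization W f -> weakly_F_regular S p.

Section UniqueFactorization.
Variable R : idomainType.

Definition irreducible_elt (x : R) : Prop :=
  [/\ x != 0, x \isn't a GRing.unit &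
      forall y z, x = y * z -> y \is a GRing.unit \/ z \is a GRing.unit].

Definition associated (x y : R) : Prop :=
  exists2 u, u \is a GRing.unit & y = u * x.

Definition is_UFD : Prop :=
  (forall x : R, x != 0 -> x \isn't a GRing.unit ->
     exists2 s : seq R, (forall y, y \in s -> irreducible_elt y) &
                        x = \prod_(y <- s) y)
  /\
  (forall s t : seq R,
     (forall y, y \in s -> irreducible_elt y) ->
     (forall y, y \in t -> irreducible_elt y) ->
     \prod_(y <- s) y = \prod_(y <- t) y ->
     exists t' : seq R, [/\ perm_eq t t', size s = size t' &
       forall i, (i < size s)%N -> associated s`_i t'`_i]).

End UniqueFactorization.

Definition weighted_mdeg (n : nat) (w : 'I_n -> nat) (m : 'X_{1..n}) : nat :=
  (\sum_(i < n) m i * w i)%N.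

Fact weighted_mdeg0 n (w : 'I_n -> nat) : weighted_mdeg w 0%MM = 0%N.
Proof. by apply: big1 => i _; rewrite mnm0E. Qed.

Fact weighted_mdegD n (w : 'I_n -> nat) :
  {morph weighted_mdeg w : m1 m2 / (m1 + m2)%MM >-> (m1 + m2)%N}.
Proof.
move=> m1 m2; rewrite /weighted_mdeg -big_split /=.
by apply: eq_bigr => i _; rewrite mnmDE mulnDl.
Qed.

HB.instance Definition _ n (w : 'I_n -> nat) :=
  isMeasure.Build n (weighted_mdeg w) (weighted_mdeg0 w) (weighted_mdegD w).

(* gr n is the homogeneous component of degree n.                             *)
Section GradedAlgebra.
Variables (K : fieldType) (R : comAlgType K) (gr : nat -> {pred R}).

Definition is_basis_of (V : {pred R}) (k : nat) (b : 'I_k -> R) : Prop :=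
  [/\ forall i, b i \in V,
      forall c : 'I_k -> K, \sum_(i < k) c i *: b i = 0 -> forall i, c i = 0 &
      forall x, x \in V -> exists c : 'I_k -> K, x = \sum_(i < k) c i *: b i].

(* Hilb(R, z) = N / D in Z[[z]], stated as Hilb(R, z) * D = N coefficientwise *)
(* and meant for D with D(0) = 1; H is the Hilbert function.                  *)
Definition has_hilbert_series (N D : {poly int}) : Prop :=
  exists H : nat -> nat,
    (forall n, exists b : 'I_(H n) -> R, is_basis_of (gr n) b) /\
    (forall n, \sum_(i < n.+1) (H (n - i)%N)%:Z * D`_i = N`_n).

(* R is isomorphic, as a graded algebra, to K[x_1, ..., x_n] / (F) for some   *)
(* positive weights of the variables and F homogeneous: phi is the quotient   *)
(* map.                                                                       *)
Definition is_hypersurface : Prop :=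
  exists (n : nat) (w : 'I_n -> nat) (F : {mpoly K[n]})
         (phi : {lrmorphism {mpoly K[n]} -> R}),
    [/\ forall i, (0 < w i)%N,
        exists d, F \is d.-homog for (weighted_mdeg w),
        forall d P, P \is d.-homog for (weighted_mdeg w) -> phi P \in gr d,
        forall r, exists P, phi P = r &
        forall P, phi P = 0 <-> exists Q, P = Q * F].

Definition alg_eval (d : nat) (x : 'I_d -> R) (P : {mpoly K[d]}) : R :=
  mmap (in_alg R) x P.

(* x is a homogeneous system of parameters, with x_i of degree deg i:         *)
(* K[x] is a polynomial ring over which R is module-finite (so d = dim R).    *)
Definition is_hsop (d : nat) (deg : 'I_d -> nat) (x : 'I_d -> R) : Prop :=
  [/\ forall i, (0 < deg i)%N /\ x i \in gr (deg i),
      forall P, alg_eval x P = 0 -> P = 0 &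
      exists (m : nat) (g : 'I_m -> R), forall r,
        exists P : 'I_m -> {mpoly K[d]}, r = \sum_(j < m) alg_eval x (P j) * g j].

(* For x a system of parameters, the top local cohomology H^d_m(R) is the     *)
(* cokernel of                                                                *)
(*   (+)_i R[1 / prod_(j != i) x_j] -> R[1 / prod_j x_j].                     *)
(* The class of r / (prod_j x_j)^t vanishes iff, for some k,                  *)
(*   (prod_j x_j)^k r \in (x_1^(t + k), ..., x_d^(t + k)),                    *)
(* and it is homogeneous of degree deg r - t * sum_j deg x_j.                 *)
Definition cech_class_eq0 (d : nat) (x : 'I_d -> R) (r : R) (t : nat) : Prop :=
  exists k : nat,
    ideal_gen (fun y => exists i, y = x i ^+ (t + k))
              ((\prod_(i < d) x i) ^+ k * r).

Definition top_local_cohomology_neq0 (d : nat) (deg : 'I_d -> nat)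
    (x : 'I_d -> R) (n : int) : Prop :=
  exists (t m : nat) (r : R),
    [/\ r \in gr m, m%:Z - (t * \sum_(i < d) deg i)%N%:Z = n &
        ~ cech_class_eq0 x r t].

(* Goto-Watanabe: the largest degree in which H^(dim R)_m(R) is nonzero. The  *)
(* latter does not depend on the system of parameters used to compute it.     *)
Definition has_a_invariant (a : int) : Prop :=
  exists (d : nat) (deg : 'I_d -> nat) (x : 'I_d -> R),
    [/\ is_hsop deg x, top_local_cohomology_neq0 deg x a &
        forall n, top_local_cohomology_neq0 deg x n -> n <= a].

End GradedAlgebra.

Section Conjugation.
Variable K : finFieldType.
Implicit Types (f : {mpoly K[3]}) (sigma : 'M[K]_2).

Definition va : {mpoly K[3]} := 'X_(0 : 'I_3).
Definition vb : {mpoly K[3]} := 'X_(1 : 'I_3).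
Definition vc : {mpoly K[3]} := 'X_(2 : 'I_3).

Definition generic_mx : 'M[{mpoly K[3]}]_2 :=
  \matrix_(i, j) if i == 0 then (if j == 0 then va else vb)
                 else (if j == 0 then vc else - va).

Definition conj_mx sigma : 'M[{mpoly K[3]}]_2 :=
  map_mx (@mpolyC 3 K) (invmx sigma) *m generic_mx *m map_mx (@mpolyC 3 K) sigma.

Definition conj_act sigma f : {mpoly K[3]} :=
  f \mPo [tuple conj_mx sigma 0 0; conj_mx sigma 0 1; conj_mx sigma 1 0].

Definition SL2 : {set 'M[K]_2} := [set sigma | \det sigma == 1].

Definition invariant_pred : {pred {mpoly K[3]}} :=
  fun f => [forall sigma in SL2, conj_act sigma f == f].

Lemma invariantP f :
  reflect (forall sigma, \det sigma = 1 -> conj_act sigma f = f)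
          (f \in invariant_pred).
Proof.
apply: (iffP forall_inP) => [h s ds|h s]; first by apply/eqP/h; rewrite inE ds.
by rewrite inE => /eqP ds; apply/eqP/h.
Qed.

Fact invariant_divring : divring_closed invariant_pred.
Proof.
split=> [|f g /invariantP If /invariantP Ig|f g /invariantP If /invariantP Ig].
- by apply/invariantP => s _; rewrite /conj_act rmorph1.
- apply/invariantP => s ds; rewrite /conj_act rmorphB /=.
  by congr (_ - _); [apply: If|apply: Ig].
apply/invariantP => s ds.
have [Ug|nUg] := boolP (g \is a GRing.unit).
  by rewrite /conj_act rmorphM rmorphV //=; congr (_ / _); [apply: If|apply: Ig].
rewrite invr_out // /conj_act rmorphM /=.
by congr (_ * _); [apply: If|apply: Ig].
Qed.

HB.instance Definition _ :=
  GRing.isDivringClosed.Build {mpoly K[3]} invariant_pred invariant_divring.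

Fact invariant_scale : GRing.scaler_closed invariant_pred.
Proof.
move=> k f /invariantP If; apply/invariantP => s ds.
by rewrite /conj_act linearZ /=; congr (_ *: _); apply: If.
Qed.

HB.instance Definition _ :=
  GRing.isScaleClosed.Build K {mpoly K[3]} invariant_pred invariant_scale.

Record inv_ring : predArgType :=
  InvRing {inv_val : {mpoly K[3]}; _ : inv_val \in invariant_pred}.

HB.instance Definition _ := [isSub for inv_val].
HB.instance Definition _ := [Choice of inv_ring by <:].
HB.instance Definition _ := [SubChoice_isSubIntegralDomain of inv_ring by <:].
HB.instance Definition _ := [SubZmodule_isSubLmodule of inv_ring by <:].
HB.instance Definition _ := [SubNzRing_SubLmodule_isSubLalgebra of inv_ring by <:].
HB.instance Definition _ := [SubLalgebra_isSubAlgebra of inv_ring by <:].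

Definition inv_grading (n : nat) : {pred inv_ring} :=
  [pred f | val f \is n.-homog].

Definition det_form : {mpoly K[3]} := - va ^+ 2 - vb * vc.

(* The Steenrod operation P^1 applied to det_form, for K with q elements.     *)
Definition steenrod1_det (q : nat) : {mpoly K[3]} :=
  - (va ^+ q.+1 *+ 2) - vb ^+ q * vc - vb * vc ^+ q.

Definition f4_tilde (delta : K) : {mpoly K[3]} :=
  - \prod_(A : K) \prod_(B : K | B != 0)
      ((2%:R * A) *: va + B *: vb - ((A ^+ 2 + delta) / B) *: vc).

Definition jacobian (f1 f2 f3 : {mpoly K[3]}) : {mpoly K[3]} :=
  \det (\matrix_(i < 3, j < 3) (tnth [tuple f1; f2; f3] i)^`M(j)).

Definition in_subalgebra (n : nat) (s : n.-tuple {mpoly K[3]}) f : Prop :=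
  exists P : {mpoly K[n]}, f = P \mPo s.

End Conjugation.

(* Main.v *)
(* Let u = det, v = P^1(det), w = v + 2 u^((q+1)/2), and let s be the product of the
   linear forms tr (N M), N traceless of determinant delta, taken up to sign, so that s^2
   is f4_tilde up to a constant. Everything reduces to the group H generated by G and the
   transformation tau : a |-> -a, which is minus a conjugation.
   - The H-invariants are K[u, w, s]. Restrict f to the plane tr (N0 M) = 0 with
     det N0 = delta; the determinant is anisotropic there. Subtract a constant multiple of
     u^d so that f vanishes at a point of determinant -delta. By invariance it vanishes at
     all q + 1 such points, and the reflections stabilising the plane make it vanish doubly
     there, so that w, which has exactly these zeros, divides f on the plane. By induction
     f agrees on the plane with a polynomial in u and w; the difference is divisible by
     tr (N0 M), hence by s.
   - The Jacobian h of u, v, s is a tau-anti-invariant; comparing degrees, it is the product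
     of the forms tr (N M), det N = -1, up to sign. All of these divide every
     anti-invariant, so T^G = K[u, w, s] + K[u, w, s] h with h^2 in K[u, w, s]. Restricting
     to smaller and smaller subspaces shows that u, w, s are algebraically independent.
     The hypersurface equation, the Hilbert series and the a-invariant follow.
   - The product of the G-orbit of a prime of T is semi-invariant, and a character of G is
     trivial because G is generated by elements of order p. These orbit products are prime in
     T^G, which is therefore factorial.
   - Euler's formula x . grad s = deg s * s = 0 and the Koszul complex give h in (u, v) T.
     Applying the transfer to h^Q in (u^Q, v^Q) T, multiplied by an element of nonzero
     transfer, puts h in the tight closure of (u, v) T^G, to which it does not belong. *)

From HB Require Import structures.
Require Import Defs.
From mathcomp Require Import all_boot all_order all_algebra.
From mathcomp Require Import finfield zify ring.
From Stdlib Require Import Classical_Prop.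

Set Implicit Arguments.
Unset Strict Implicit.
Unset Printing Implicit Defensive.

Import Order.TTheory GRing.Theory Num.Theory.
Local Open Scope ring_scope.

(** * Factorial domains and Gauss's lemma *)

(** The obstacle is that p divides the order of G: no averaging over G is available, so generators
    are found by restriction and division instead. The degrees to expect come from group order: -1
    acts trivially, so G acts through a group of order q(q^2 - 1)/2, adjoining tau doubles it, and 2
    (q + 1) q(q - 1)/2 = q(q^2 - 1). The correction term in w has this origin: at points with
    coordinates in K, v equals 2 det, and by Euler's criterion det^((q+1)/2) = -det where det is not
    a square, so adding 2 u^((q+1)/2) creates zeros there. Division by w works by a degree count:
    the points of determinant -delta on the plane lie in pairs P, -P on at least (q + 1)/2 lines,
    and double vanishing along each line gives degree at least q + 1 = deg w. Division by w must
    stay inside the induction although the quotient is known only on the plane; hence the induction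
    concerns forms that are invariant modulo the equation of the plane, under its stabiliser. Signs
    are a second difficulty: tau is minus a conjugation, so even and odd degrees behave differently.
    Forms of odd degree are shown to vanish on the plane. *)

Section Divisibility.
Variable D : idomainType.
Implicit Types (x y z : D) (s t : seq D).

Definition divides x y := exists k, y = k * x.

Definition prime_elt x :=
  [/\ x != 0, x \isn't a GRing.unit &
      forall y z, divides x (y * z) -> divides x y \/ divides x z].

(** Factors are required to be prime rather than irreducible: existence alone then forces
    uniqueness, and only one property has to be carried through Gauss's lemma and to the invariant
    ring. *)
Definition factorial_domain :=
  forall x, x != 0 -> x \isn't a GRing.unit ->
  exists2 s, (forall y, y \in s -> prime_elt y) & x = \prod_(y <- s) y.

Lemma divides_refl x : divides x x.
Proof. by exists 1; rewrite mul1r. Qed.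

Lemma divides0 x : divides x 0.
Proof. by exists 0; rewrite mul0r. Qed.

Lemma divides_mull x y z : divides x y -> divides x (z * y).
Proof. by case=> k ->; exists (z * k); rewrite mulrA. Qed.

Lemma divides_mulr x y z : divides x y -> divides x (y * z).
Proof. by rewrite mulrC; apply: divides_mull. Qed.

Lemma divides_trans x y z : divides x y -> divides y z -> divides x z.
Proof. by move=> h [k ->]; apply: divides_mull. Qed.

Lemma dividesD x y z : divides x y -> divides x z -> divides x (y + z).
Proof. by case=> k -> [l ->]; exists (k + l); rewrite mulrDl. Qed.

Lemma dividesN x y : divides x y -> divides x (- y).
Proof. by case=> k ->; exists (- k); rewrite mulNr. Qed.

Lemma dividesB x y z : divides x y -> divides x z -> divides x (y - z).
Proof. by move=> h1 h2; apply/dividesD/dividesN. Qed.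

Lemma divides_unit x y : divides x y -> y \is a GRing.unit -> x \is a GRing.unit.
Proof. by case=> k ->; rewrite unitrM => /andP[]. Qed.

Lemma prime_irreducible x : prime_elt x -> irreducible_elt x.
Proof.
case=> x0 xu xp; split=> // y z e.
have [|[k ek]|[k ek]] := xp y z; first by rewrite -e; apply: divides_refl.
- right; have /eqP : y * (k * z - 1) = 0.
    by rewrite mulrBr mulr1 mulrCA -e -ek subrr.
  rewrite mulf_eq0 subr_eq0; case/orP=> /eqP e'.
    by move: x0; rewrite e e' mul0r eqxx.
  by apply/unitrP; exists k; split=> //; rewrite mulrC.
- left; have /eqP : z * (k * y - 1) = 0.
    by rewrite mulrBr mulr1 mulrCA (mulrC z) -e -ek subrr.
  rewrite mulf_eq0 subr_eq0; case/orP=> /eqP e'.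
    by move: x0; rewrite e e' mulr0 eqxx.
  by apply/unitrP; exists k; split=> //; rewrite mulrC.
Qed.

Lemma prime_divides_prod x s :
  prime_elt x -> divides x (\prod_(y <- s) y) -> exists2 y, y \in s & divides x y.
Proof.
case=> x0 xu xp; elim: s => [|y s IH].
  by rewrite big_nil => /divides_unit; rewrite unitr1 (negPf xu) => /(_ isT).
rewrite big_cons => /xp [h|/IH [z zs h]]; first by exists y; rewrite ?mem_head.
by exists z; rewrite // inE zs orbT.
Qed.

Lemma divides_prime_irreducible x y :
  prime_elt x -> irreducible_elt y -> divides x y -> associated x y.
Proof.
case=> x0 xu _ [y0 yu yi] [k e]; case: (yi _ _ e); first by exists k.
by rewrite (negPf xu).
Qed.

Lemma associated_sym x y : associated x y -> associated y x.
Proof.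
by case=> u uu ->; exists u^-1; rewrite ?unitrV // mulrA mulVr // mul1r.
Qed.

Lemma associated_divides x y : associated x y -> divides x y.
Proof. by case=> u _ ->; exists u. Qed.

Lemma associated_prime x y : associated x y -> prime_elt x -> prime_elt y.
Proof.
move=> h [x0 xu xp]; have /associated_divides hd := associated_sym h.
have hd' := associated_divides h.
split; [|by apply: contra xu => /(divides_unit hd')|].
  by apply: contraNneq x0 => y0; case: hd => k ->; rewrite y0 mulr0.
move=> a b /(divides_trans hd') /xp [/(divides_trans hd)|/(divides_trans hd)];
  by [left|right].
Qed.

Lemma factorial_irreducible_prime x :
  factorial_domain -> irreducible_elt x -> prime_elt x.
Proof.
move=> fD xi; have [x0 xu xirr] := xi.
have [[|y s] sp e] := fD x x0 xu; first by move: xu; rewrite e big_nil unitr1.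
have yp := sp y (mem_head _ _).
apply: (associated_prime _ yp); apply: divides_prime_irreducible => //.
by exists (\prod_(z <- s) z); rewrite e big_cons mulrC.
Qed.

Lemma factorial_UFD : factorial_domain -> is_UFD D.
Proof.
move=> fD; split=> [x x0 xu|].
  by have [s sp e] := fD x x0 xu; exists s => // y /sp /prime_irreducible.
(* The unit [u] is needed for the induction: cancelling two associated factors leaves a unit
   behind. *)
have gen s : forall t u, u \is a GRing.unit ->
     (forall y, y \in s -> irreducible_elt y) ->
     (forall y, y \in t -> irreducible_elt y) ->
     \prod_(y <- s) y = u * \prod_(y <- t) y ->
     exists t' : seq D, [/\ perm_eq t t', size s = size t' &
       forall i, (i < size s)%N -> associated s`_i t'`_i].
  elim: s => [|x s IH] t u uu si ti.
    rewrite big_nil; case: t ti => [_ _|y t ti e]; first by exists [::].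
    have [_ yu _] := ti y (mem_head _ _); move: (unitr1 D).
    by rewrite e big_cons !unitrM (negPf yu) andbF.
  rewrite big_cons => e.
  have xi := si x (mem_head _ _); have xp := factorial_irreducible_prime fD xi.
  have xdvd : divides x (\prod_(y <- t) y).
    exists (u^-1 * \prod_(y <- s) y).
    by rewrite -mulrA (mulrC _ x) e mulrA mulVr // mul1r.
  have [y yt xy] := prime_divides_prod xp xdvd.
  have [v vu ev] := divides_prime_irreducible xp (ti y yt) xy.
  have pt := perm_to_rem yt.
  have [|z zs|z zt||t' [h1 h2 h3]] := IH (rem y t) (u * v).
  - by rewrite unitrM uu.
  - by apply: si; rewrite inE zs orbT.
  - by apply: ti; apply: (mem_rem zt).
  - apply: (mulfI (_ : x != 0)); first by case: xi.
    rewrite e (perm_big _ pt) big_cons /= ev.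
    by rewrite !mulrA; congr (_ * _); rewrite -!mulrA (mulrCA x) (mulrC x).
  - exists (y :: t'); split=> [||[|i] /= hi].
    + by rewrite (permPl pt) perm_cons.
    + by rewrite /= h2.
    + by exists v.
    + exact: h3.
move=> s t si ti e; apply: (gen s t 1) => //; first exact: unitr1.
by rewrite mul1r.
Qed.

End Divisibility.

Section Gauss.
Variable D : idomainType.
Hypothesis fD : factorial_domain D.
Implicit Types (f g : {poly D}) (x y : D).

Lemma divides_polyC x y : divides x y -> divides x%:P y%:P.
Proof. by case=> k ->; exists k%:P; rewrite rmorphM. Qed.

Lemma divides_polyC_coef x f i : divides x%:P f -> divides x f`_i.
Proof. by case=> k ->; exists k`_i; rewrite coefMC. Qed.

(** If x divides f g, it divides the product of the leading coefficients, hence one of them. That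
    leading term is dropped, and the induction is on the sum of the sizes. *)
Lemma prime_polyC x : prime_elt x -> prime_elt x%:P.
Proof.
case=> x0 xu xp; split; first by rewrite polyC_eq0.
  by rewrite poly_unitE coefC /= (negPf xu) andbF.
have lead f : divides x (lead_coef f) ->
    (divides x%:P (f - lead_coef f *: 'X^((size f).-1)) -> divides x%:P f)
    /\ divides x%:P (lead_coef f *: 'X^((size f).-1)).
  move=> h; have h' : divides x%:P (lead_coef f *: 'X^((size f).-1)).
    by rewrite -mul_polyC; apply/divides_mulr/divides_polyC.
  by split=> // h2; rewrite -[f](subrK (lead_coef f *: 'X^((size f).-1))); apply: dividesD.
have small f : f != 0 ->
    (size (f - lead_coef f *: 'X^((size f).-1))%R < size f)%N.
  move=> f0; rewrite [X in (_ < X)%N](polySpred f0) ltnS; apply/leq_sizeP => j hj.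
  rewrite coefB coefZ coefXn; case: eqP => [->|/eqP ne].
    by rewrite mulr1 subrr.
  rewrite mulr0 subr0; apply: nth_default.
  by rewrite (polySpred f0) ltn_neqAle eq_sym ne.
move=> f g; have [n] := ubnP (size f + size g)%N; elim: n => // n IH in f g *.
rewrite ltnS => hn h.
have [->|f0] := eqVneq f 0; first by left; apply: divides0.
have [->|g0] := eqVneq g 0; first by right; apply: divides0.
have : divides x (lead_coef f * lead_coef g).
  by rewrite -lead_coefM; apply: divides_polyC_coef.
case/xp => /lead [h1 h2].
- have [||h'|h'] := IH (f - lead_coef f *: 'X^((size f).-1)) g.
  + by apply: leq_trans hn; rewrite ltn_add2r small.
  + by rewrite mulrBl; apply: dividesB => //; apply: divides_mulr.
  + by left; apply: h1 h'.
  + by right.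
- have [||h'|h'] := IH f (g - lead_coef g *: 'X^((size g).-1)).
  + by apply: leq_trans hn; rewrite ltn_add2l small.
  + by rewrite mulrBr; apply: dividesB => //; apply: divides_mull.
  + by left.
  + by right; apply: h1 h'.
Qed.

Definition primitive_poly f := forall x, prime_elt x -> ~ divides x%:P f.

(** A prime constant dividing f divides its leading coefficient, so only the finitely many prime
    factors of that coefficient have to be divided out. *)
Lemma primitive_decomp f : f != 0 ->
  exists c g, [/\ f = c *: g, c != 0 & primitive_poly g].
Proof.
move=> f0.
(* [s] lists the primes of the leading coefficient still to be tried; [x] is the part of it none of
   whose primes divides h. *)
have gen s : (forall y, y \in s -> prime_elt y) -> forall (h : {poly D}) x, h != 0 ->
    lead_coef h = x * \prod_(y <- s) y ->
    (forall y, prime_elt y -> divides y x -> ~ divides y%:P h) ->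
    exists c g, [/\ h = c *: g, c != 0 & primitive_poly g].
  elim: s => [|y s IH] sp h x h0.
    rewrite big_nil mulr1 => e hx; exists 1, h; rewrite scale1r oner_neq0.
    split=> // y yp yh; apply: (hx y yp) => //; rewrite -e.
    exact: divides_polyC_coef.
  rewrite big_cons => e hx; have yp := sp y (mem_head _ _).
  have [y0 yu yp'] := yp.
  have sp' z : z \in s -> prime_elt z by move=> zs; apply: sp; rewrite inE zs orbT.
  have [[h' eh]|nyh] := classic (divides y%:P h).
    have h'0 : h' != 0 by apply: contraNneq h0 => h'0; rewrite eh h'0 mul0r.
    have [||c [g [eg c0 gp]]] := IH sp' h' x h'0.
    - by apply: (mulIf y0); rewrite -mulrA (mulrC (\prod_(j <- s) j)) -e eh lead_coefM lead_coefC.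
    - by move=> z zp zx zh; apply: (hx z zp zx); rewrite eh; apply: divides_mulr.
    exists (c * y), g; split=> //; last by rewrite mulf_neq0.
    by rewrite eh eg -scalerAl mulrC mul_polyC scalerA.
  apply: (IH sp' h (x * y)) => //; first by rewrite -mulrA.
  move=> z zp zxy zh; have [z0 zu zp'] := zp; case: (zp' _ _ zxy) => [zx|].
    exact: (hx z zp zx).
  move=> zy; have := divides_prime_irreducible zp (prime_irreducible yp) zy.
  move=> /associated_sym /associated_divides /divides_polyC yz.
  by apply: nyh; apply: divides_trans zh.
have [lu|lu] := boolP (lead_coef f \is a GRing.unit).
  apply: (gen [::] _ f (lead_coef f)) => //; first by rewrite big_nil mulr1.
  by move=> y [_ yu _] /divides_unit /(_ lu); rewrite (negPf yu).
have l0 : lead_coef f != 0 by rewrite lead_coef_eq0.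
have [s sp e] := fD l0 lu; apply: (gen s sp f 1); rewrite ?mul1r //.
by move=> y [_ yu _] /divides_unit; rewrite unitr1 (negPf yu) => /(_ isT).
Qed.

(** Each prime factor of c divides h f but not f, so it divides h and cancels. *)
Lemma primitive_cancel c f g h : c != 0 -> primitive_poly f ->
  c *: g = h * f -> divides f g.
Proof.
move=> c0 fp; have [cu|cu] := boolP (c \is a GRing.unit).
  move=> e; exists (c^-1 *: h); rewrite -scalerAl -e scalerA mulVr //.
  by rewrite scale1r.
have [s sp ->] := fD c0 cu; elim: s sp h g => [|y s IH] sp h g.
  by rewrite big_nil scale1r => ->; exists h.
have yp := sp y (mem_head _ _); have [yP0 _ ypP] := prime_polyC yp.
rewrite big_cons -scalerA => e; case: (ypP h f).
- by rewrite -e -mul_polyC; apply/divides_mulr/divides_refl.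
- case=> h' eh; apply: (IH _ h') => [z zs|]; first by apply: sp; rewrite inE zs orbT.
  by apply: (mulfI yP0); rewrite mul_polyC e eh mulrCA mulrA.
- by move=> /(fp y yp).
Qed.

Lemma divides_dvdp f g : divides f g -> f %| g.
Proof. by case=> k ->; apply: dvdp_mulIr. Qed.

(** Over a domain [%|] tolerates a constant multiple, as over the fraction field; primitivity
    removes the constant. *)
Lemma primitive_dvdp f g : primitive_poly f -> f %| g -> divides f g.
Proof.
by move=> fp /Pdiv.WeakIdomain.dvdpP[[c h] /= c0 /(primitive_cancel c0 fp)].
Qed.

Lemma primitive_irreducible_prime f :
  primitive_poly f -> irreducible_poly f -> prime_elt f.
Proof.
move=> fp fi; have f0 := irredp_neq0 fi; case: (fi) => sf fi'; split=> //.
  by rewrite poly_unitE gtn_eqF.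
move=> g h /divides_dvdp fgh; have [fg|fg] := boolP (coprimep f g).
  by right; apply: primitive_dvdp => //; rewrite -(Gauss_dvdpr _ fg).
left; apply: primitive_dvdp => //; apply: (dvdp_trans _ (dvdp_gcdr f g)).
have : gcdp f g %= f by apply: fi'; [move: fg; rewrite coprimep_def|apply: dvdp_gcdl].
by rewrite /eqp => /andP[].
Qed.

(** Induction on the size. A proper divisor for [%|] is replaced by its primitive part, which
    divides in the ring itself; the cofactor is primitive because f is. *)
Lemma primitive_factor f : f != 0 -> primitive_poly f ->
  f \isn't a GRing.unit ->
  exists2 s : seq {poly D}, (forall h, h \in s -> prime_elt h) & f = \prod_(h <- s) h.
Proof.
have [n] := ubnP (size f); elim: n => // n IH in f *; rewrite ltnS => hn f0 fp fu.
have sf : (1 < size f)%N.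
  rewrite ltnNge; apply/negP => /size1_polyC ef; move: f0 fu fp; rewrite ef.
  rewrite polyC_eq0 poly_unitE size_polyC coefC eqxx => c0.
  rewrite c0 /= => cu; have [[|y s] sp e] := fD c0 cu.
    by move: cu; rewrite e big_nil unitr1.
  move=> /(_ y (sp y (mem_head _ _))); apply; apply: divides_polyC; rewrite e big_cons.
  by exists (\prod_(j <- s) j); rewrite mulrC.
have [[g [sg sgf gf]]|ni] :=
    classic (exists g, [/\ (1 < size g)%N, (size g < size f)%N & g %| f]); last first.
  exists [:: f]; last by rewrite big_seq1.
  move=> h; rewrite inE => /eqP ->; apply: primitive_irreducible_prime => //.
  split=> // g sg gf; have [le|lt] := leqP (size f) (size g).
    by rewrite -dvdp_size_eqp //; rewrite eqn_leq le andbT dvdp_leq.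
  have g0 : g != 0 by apply: contraTneq gf => ->; rewrite dvd0p.
  by case: ni; exists g; split=> //; rewrite ltn_neqAle eq_sym sg size_poly_gt0.
have g0 : g != 0 by rewrite -size_poly_gt0 ltnW.
have [c [g' [eg c0 g'p]]] := primitive_decomp g0.
have g'0 : g' != 0 by apply: contraNneq g0; rewrite eg => ->; rewrite scaler0.
have sg' : size g' = size g by rewrite eg size_scale.
have : g' %| f by apply: dvdp_trans gf; rewrite eg -mul_polyC; apply: dvdp_mulIr.
move=> /(primitive_dvdp g'p) [k ek].
have k0 : k != 0 by apply: contraNneq f0; rewrite ek => ->; rewrite mul0r.
have sk : (size f).+1 = (size k + size g')%N.
  rewrite ek size_mul //= prednK //.
  by rewrite addn_gt0 size_poly_gt0 k0.
have [|x xp xk||s1 s1p e1] := IH k _ k0.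
- by move: sg sg' sk hn; lia.
- by apply: (fp x xp); rewrite ek; apply: divides_mulr.
- by rewrite poly_unitE gtn_eqF //; move: sgf sg' sk; lia.
have [|x xp xg||s2 s2p e2] := IH g' _ g'0.
- by rewrite sg'; apply: leq_trans hn.
- by apply: (g'p x xp).
- by rewrite poly_unitE gtn_eqF // sg'.
exists (s1 ++ s2); last by rewrite big_cat /= -e1 -e2.
by move=> h; rewrite mem_cat => /orP[/s1p|/s2p].
Qed.

Lemma factorial_poly : factorial_domain {poly D}.
Proof.
move=> f f0 fu; have [c [g [ef c0 gp]]] := primitive_decomp f0.
have g0 : g != 0 by apply: contraNneq f0; rewrite ef => ->; rewrite scaler0.
have [cu|cu] := boolP (c \is a GRing.unit).
  apply: primitive_factor => // x xp; rewrite ef -mul_polyC.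
  have [_ xu xpp] := prime_polyC xp; case/xpp => [|/(gp x xp) //].
  move=> /divides_unit h; move: xu; rewrite h // poly_unitE size_polyC coefC c0.
  by rewrite eqxx.
have [s sp es] := fD c0 cu.
have sP h : h \in map polyC s -> prime_elt h.
  by case/mapP => z zs ->; apply: prime_polyC; apply: sp.
have ec : c%:P = \prod_(h <- map polyC s) h.
  by rewrite es rmorph_prod big_map.
have [gu|gu] := boolP (g \is a GRing.unit); last first.
  have [t tp et] := primitive_factor g0 gp gu.
  exists (map polyC s ++ t); last by rewrite big_cat /= -ec -et mul_polyC.
  by move=> h; rewrite mem_cat => /orP[/sP|/tp].
(* The unit g may not stand alone in a list of primes, so it is absorbed into the first prime. *)
case: s sp es sP ec => [|y s] sp es sP ec.
  by move: cu; rewrite es big_nil unitr1.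
exists (g * y%:P :: map polyC s); last first.
  by move: ec; rewrite /= !big_cons ef -mul_polyC => ->; rewrite mulrC mulrA.
move=> z; rewrite inE => /orP[/eqP->|zs]; last by apply: sP; rewrite inE zs orbT.
apply: (@associated_prime _ y%:P); first by exists g.
by apply: sP; rewrite mem_head.
Qed.

End Gauss.

Lemma factorial_transfer (D E : idomainType) (f : {rmorphism D -> E}) (g : {rmorphism E -> D}) :
  cancel f g -> cancel g f -> factorial_domain D -> factorial_domain E.
Proof.
move=> fK gK fD x x0 xu.
have [||s sp e] := fD (g x).
- by rewrite -(inj_eq (can_inj fK)) gK rmorph0.
- by apply: contra xu => /(rmorph_unit f); rewrite gK.
exists (map f s); last by rewrite big_map -rmorph_prod -e gK.
move=> _ /mapP[y ys ->]; have [y0 yu yp] := sp y ys; split.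
- by rewrite -(inj_eq (can_inj gK)) fK rmorph0.
- by apply: contra yu => /(rmorph_unit g); rewrite fK.
move=> a b [k e']; have [|[l h]|[l h]] := yp (g a) (g b).
- by exists (g k); rewrite -rmorphM e' rmorphM fK.
- by left; exists (f l); rewrite -rmorphM -h gK.
- by right; exists (f l); rewrite -rmorphM -h gK.
Qed.

(** * Factoriality of polynomial rings in several variables *)

Section MultivariatePolynomials.
Variable K : fieldType.

Lemma mpoly_lrmorph_eq (n : nat) (S : nzRingType) (f g : {rmorphism {mpoly K[n]} -> S}) :
  (forall c, f c%:MP = g c%:MP) -> (forall i, f 'X_i = g 'X_i) -> f =1 g.
Proof.
move=> hC hX; elim/mpolyind => [|c m p _ _ IH]; first by rewrite !rmorph0.
rewrite !rmorphD -!mul_mpolyC !rmorphM hC /= IH; congr (_ * _ + _).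
rewrite mpolyXE_id !rmorph_prod; apply: eq_bigr => i _.
by rewrite !rmorphXn /= hX.
Qed.

Section MuniInverse.
Variable n : nat.

(** Inverse of [muni]. It carries factoriality from polynomials in one variable to {mpoly K[n.+1]},
    and later the division by the hypersurface equation. *)
Definition multi (p : {poly {mpoly K[n]}}) : {mpoly K[n.+1]} :=
  (map_poly (@mwiden n K) p).['X_ord_max].

Lemma multi_zmod : zmod_morphism multi.
Proof. by move=> p q; rewrite /multi rmorphB /= hornerD hornerN. Qed.
Lemma multi_monoid : monoid_morphism multi.
Proof. by split=> [|p q]; rewrite /multi ?rmorph1 ?hornerC // rmorphM /= hornerM. Qed.

HB.instance Definition _ :=
  GRing.isZmodMorphism.Build {poly {mpoly K[n]}} {mpoly K[n.+1]} multi multi_zmod.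
HB.instance Definition _ :=
  GRing.isMonoidMorphism.Build {poly {mpoly K[n]}} {mpoly K[n.+1]} multi multi_monoid.

Lemma muniXmax : muni ('X_ord_max : {mpoly K[n.+1]}) = 'X.
Proof.
rewrite muniE msuppX big_seq1 mcoeffX eqxx scale1r mnm1E eqxx expr1.
rewrite (_ : [multinom _ | i < n] = 0%MM) ?mpolyX0 ?scale1r //.
apply/mnmP => i; rewrite mnmE mnm1E mnm0E.
by rewrite -val_eqE /= gtn_eqF.
Qed.

Lemma muniXwiden (i : 'I_n) :
  muni ('X_(widen_ord (leqnSn n) i) : {mpoly K[n.+1]}) = ('X_i)%:P.
Proof.
rewrite muniE msuppX big_seq1 mcoeffX eqxx scale1r mnm1E.
rewrite -val_eqE /= ltn_eqF // expr0.
rewrite (_ : [multinom _ | j < n] = U_(i)%MM) ?alg_polyC //.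
by apply/mnmP => j; rewrite mnmE !mnm1E -val_eqE.
Qed.

Lemma multiX : multi 'X = 'X_ord_max.
Proof. by rewrite /multi map_polyX hornerX. Qed.

Lemma multiC p : multi p%:P = mwiden p.
Proof. by rewrite /multi map_polyC hornerC. Qed.

Lemma mwidenXi (i : 'I_n) : mwiden ('X_i : {mpoly K[n]}) = 'X_(widen_ord (leqnSn n) i).
Proof.
by rewrite mwidenX; congr 'X_[_]; apply/mnmP => j; rewrite mnmwiden1.
Qed.

Lemma muniK : cancel (@muni n K) multi.
Proof.
apply: (@mpoly_lrmorph_eq _ _ (multi \o @muni n K) idfun) => [c|i] /=.
  by rewrite muniC multiC mwidenC.
case: (unliftP ord_max i) => [j ->|->]; last by rewrite muniXmax multiX.
have -> : lift ord_max j = widen_ord (leqnSn n) j.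
  by apply: val_inj => /=; rewrite /bump leqNgt ltn_ord.
by rewrite muniXwiden multiC mwidenXi.
Qed.

Lemma muni_mwiden (p : {mpoly K[n]}) : muni (mwiden p) = p%:P.
Proof.
apply: (@mpoly_lrmorph_eq _ _ (@muni n K \o @mwiden n K) polyC) => [c|i] /=.
  by rewrite mwidenC muniC.
by rewrite mwidenXi muniXwiden.
Qed.

Lemma multiK : cancel multi (@muni n K).
Proof.
elim/poly_ind => [|p c IH]; first by rewrite /multi rmorph0 horner0 muni0.
by rewrite rmorphD rmorphM /= multiX multiC rmorphD rmorphM /= IH muniXmax muni_mwiden.
Qed.

End MuniInverse.

Lemma factorial_mpoly n : factorial_domain {mpoly K[n]}.
Proof.
elim: n => [|n IH]; last first.
  exact: (factorial_transfer (@multiK n) (@muniK n) (factorial_poly IH)).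
move=> x x0 /negP[]; apply/unitrP.
move: x0; rewrite [x]nvar0_mpolyC mpolyC_eq0 => c0.
exists (x@_0)^-1%:MP; rewrite -!rmorphM /=.
by rewrite mulVf // divff.
Qed.

End MultivariatePolynomials.

Lemma prime_exp_cancel (D : idomainType) (x f g : D) m :
  prime_elt x -> ~ divides x g -> divides (x ^+ m) (g * f) -> divides (x ^+ m) f.
Proof.
move=> [x0 xu xp] xg; elim: m f => [|m IH] f; first by exists f; rewrite expr0 mulr1.
rewrite exprS => h; case: (xp g f) => [|//|[k e]].
  by apply: divides_trans h; apply/divides_mulr/divides_refl.
have [|l el] := IH k; last by exists l; rewrite e el mulrAC mulrA.
case: h => l el; exists l; apply: (mulfI x0).
by rewrite mulrCA -[RHS]mulrCA -el e; ring.
Qed.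

Lemma prime_divides_exp (D : idomainType) (x y : D) m :
  prime_elt x -> divides x (y ^+ m) -> divides x y.
Proof.
move=> [_ xu xp]; elim: m => [|m IH].
  by rewrite expr0 => /divides_unit; rewrite unitr1 (negPf xu) => /(_ isT).
by rewrite exprS => /xp[].
Qed.

Lemma prod_prime_divides (D : idomainType) (I : eqType) (s : seq I) (F : I -> D) m f :
  uniq s -> (forall i, i \in s -> prime_elt (F i)) ->
  (forall i j, i \in s -> j \in s -> divides (F i) (F j) -> i = j) ->
  (forall i, i \in s -> divides (F i ^+ m) f) ->
  divides (\prod_(i <- s) F i ^+ m) f.
Proof.
elim: s f => [|i s IH] f /=; first by exists f; rewrite big_nil mulr1.
move=> /andP[nis su] sp sd sf; have [k e] := sf i (mem_head _ _).
have [j js|j l js ls|j js|l el] := IH k su.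
- by apply: sp; rewrite inE js orbT.
- by apply: sd; rewrite inE ?js ?ls orbT.
- have jp : j \in i :: s by rewrite inE js orbT.
  apply: (prime_exp_cancel (g := F i ^+ m) (sp j jp)); last by rewrite mulrC -e; apply: sf.
  move=> h; have : divides (F j) (F i).
    by apply: prime_divides_exp h; apply: sp.
  by move=> /(sd _ _ jp (mem_head _ _)) eji; move: nis; rewrite -eji js.
- by exists l; rewrite big_cons e el mulrCA mulrC mulrA.
Qed.

(** With the identity tuple on one side: a substitution fixing the variables modulo an ideal fixes
    every polynomial modulo it. This compares projections, [tau] and setting a variable to 0 with
    the identity. *)
Lemma comp_mpoly_congr (K : fieldType) n k (I : {mpoly K[k]} -> Prop)
    (t1 t2 : n.-tuple {mpoly K[k]}) :
  is_ideal I -> (forall i, I (tnth t1 i - tnth t2 i)) ->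
  forall f, I ((f \mPo t1) - (f \mPo t2)).
Proof.
move=> [I0 ID IM] h.
have hM x x' y y' : I (x - x') -> I (y - y') -> I (x * y - x' * y').
  move=> hx hy; have -> : x * y - x' * y' = y * (x - x') + x' * (y - y') by ring.
  by apply: ID; apply: IM.
elim/mpolyind => [|c m p _ _ IH]; first by rewrite !rmorph0 subrr.
have -> : ((c *: 'X_[m] + p) \mPo t1) - ((c *: 'X_[m] + p) \mPo t2) =
   c%:MP * (('X_[m] \mPo t1) - ('X_[m] \mPo t2)) + ((p \mPo t1) - (p \mPo t2)).
  by rewrite 2!comp_mpolyD 2!comp_mpolyZ mul_mpolyC scalerBr opprD addrACA.
apply: (ID) IH; apply: (IM); rewrite !comp_mpolyX.
elim/big_ind2: _ => [|x x' y y'|i _]; first by rewrite subrr.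
  exact: hM.
elim: (m i) => [|j IHj]; first by rewrite !expr0 subrr.
by rewrite !exprS; apply: hM.
Qed.

Lemma divides_ideal (D : idomainType) (x : D) : is_ideal (divides x).
Proof.
split=> [|y z|r y]; [exact: divides0|exact: dividesD|exact: divides_mull].
Qed.

(** * Matrices and the conjugation action *)

Section Mx2.
Variable R : comNzRingType.
Implicit Types (x y z t : R).

Definition mx2 x y z t : 'M[R]_2 :=
  \matrix_(i, j) if i == 0 then (if j == 0 then x else y)
                 else (if j == 0 then z else t).

Lemma mx2E (A : 'M[R]_2) : A = mx2 (A 0 0) (A 0 1) (A 1 0) (A 1 1).
Proof.
apply/matrixP => i j; rewrite mxE.
by case: i => [[|[]]] // ?; case: j => [[|[]]] // ? /=; congr (A _ _); apply: val_inj.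
Qed.

Lemma mx2M x y z t x' y' z' t' :
  mx2 x y z t *m mx2 x' y' z' t' =
  mx2 (x * x' + y * z') (x * y' + y * t') (z * x' + t * z') (z * y' + t * t').
Proof.
by rewrite [LHS]mx2E !mxE !big_ord_recl !big_ord0 !mxE /= !addr0.
Qed.

Lemma mx2_det x y z t : \det (mx2 x y z t) = x * t - y * z.
Proof.
rewrite (expand_det_row _ 0) !big_ord_recl big_ord0 addr0 /cofactor !mxE /=.
rewrite !det_mx11 !mxE /= expr0 mul1r.
by rewrite (_ : (_ + _ = 1)%N) // expr1; ring.
Qed.

Lemma mx2_tr x y z t : \tr (mx2 x y z t) = x + t.
Proof. by rewrite /mxtrace !big_ord_recl big_ord0 !mxE addr0. Qed.

Lemma mx2D x y z t x' y' z' t' :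
  mx2 x y z t + mx2 x' y' z' t' = mx2 (x + x') (y + y') (z + z') (t + t').
Proof. by rewrite [LHS]mx2E !mxE. Qed.

Lemma mx2Z k x y z t : k *: mx2 x y z t = mx2 (k * x) (k * y) (k * z) (k * t).
Proof. by rewrite [LHS]mx2E !mxE. Qed.

Lemma mx2N x y z t : - mx2 x y z t = mx2 (- x) (- y) (- z) (- t).
Proof. by rewrite [LHS]mx2E !mxE. Qed.

Lemma mx2_scalar x : x%:M = mx2 x 0 0 x.
Proof. by rewrite [LHS]mx2E !mxE. Qed.

Lemma mx2_inj x y z t x' y' z' t' :
  mx2 x y z t = mx2 x' y' z' t' -> [/\ x = x', y = y', z = z' & t = t'].
Proof.
by move=> e; split; [move/matrixP/(_ 0 0): e|move/matrixP/(_ 0 1): e|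
  move/matrixP/(_ 1 0): e|move/matrixP/(_ 1 1): e]; rewrite !mxE.
Qed.

Lemma mx2_traceless (N : 'M[R]_2) :
  \tr N = 0 -> N = mx2 (N 0 0) (N 0 1) (N 1 0) (- N 0 0).
Proof.
move=> e; rewrite {1}[N]mx2E; congr mx2; apply/eqP; rewrite -addr_eq0 addrC.
by rewrite -(mx2_tr _ (N 0 1) (N 1 0)) -mx2E e.
Qed.

Lemma traceless_mx2 (N : 'M[R]_2) : \tr N = 0 -> exists x y z, N = mx2 x y z (- x).
Proof. by move=> /mx2_traceless eN; exists (N 0 0), (N 0 1), (N 1 0). Qed.

Lemma det3 (A : 'M[R]_3) : \det A =
  A 0 0 * (A 1 1 * A 2%:R 2%:R - A 1 2%:R * A 2%:R 1) -
  A 0 1 * (A 1 0 * A 2%:R 2%:R - A 1 2%:R * A 2%:R 0) +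
  A 0 2%:R * (A 1 0 * A 2%:R 1 - A 1 1 * A 2%:R 0).
Proof.
have D (B : 'M[R]_2) : \det B = B 0 0 * B 1 1 - B 0 1 * B 1 0.
  by rewrite {1}[B]mx2E mx2_det.
rewrite (expand_det_row _ 0) !big_ord_recl big_ord0 addr0 /cofactor !D !mxE.
pose i1 : 'I_3 := lift ord0 ord0; pose i2 : 'I_3 := lift ord0 (lift ord0 ord0).
have E0 : 0 = ord0 :> 'I_3 by apply: val_inj.
have E1 : 1 = i1 :> 'I_3 by apply: val_inj.
have E2 : 2%:R = i2 :> 'I_3 by apply: val_inj.
rewrite E2 E1 E0.
have L : [/\ lift ord0 (0 : 'I_2) = i1, lift ord0 (1 : 'I_2) = i2, lift i1 (0 : 'I_2) = ord0 &
   lift i1 (1 : 'I_2) = i2] /\ lift i2 (0 : 'I_2) = ord0 /\ lift i2 (1 : 'I_2) = i1.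
  by split; [split|split]; apply: val_inj.
case: L => -[-> -> -> ->] [-> ->].
rewrite /= !add0n expr0 expr1 sqrrN expr1n; ring.
Qed.

End Mx2.

Lemma map_mx2 (R S : comNzRingType) (f : R -> S) x y z t :
  map_mx f (mx2 x y z t) = mx2 (f x) (f y) (f z) (f t).
Proof. by rewrite [LHS]mx2E !mxE. Qed.

Lemma invmx2 (F : fieldType) (x y z t : F) : x * t - y * z != 0 ->
  invmx (mx2 x y z t) = (x * t - y * z)^-1 *: mx2 t (- y) (- z) x.
Proof.
move=> d0; have u : mx2 x y z t \in unitmx by rewrite unitmxE mx2_det unitfE.
apply: (can_inj (mulKmx u)); rewrite mulmxV // mx2Z mx2M mx2_scalar.
by congr mx2; field.
Qed.

Section Action.
Variable K : finFieldType.
Local Notation T := {mpoly K[3]}.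
Local Notation a := (va K).
Local Notation b := (vb K).
Local Notation c := (vc K).
Implicit Types (f g : T) (N P s : 'M[K]_2).

Lemma generic_mxE : generic_mx K = mx2 a b c (- a).
Proof. by []. Qed.

Lemma forall_ord3 (P : 'I_3 -> Prop) : P 0 -> P 1 -> P 2 -> forall i, P i.
Proof.
move=> h0 h1 h2 [[|[|[]]] // hi].
- by rewrite (_ : Ordinal hi = 0) //; apply: val_inj.
- by rewrite (_ : Ordinal hi = 1) //; apply: val_inj.
- by rewrite (_ : Ordinal hi = 2) //; apply: val_inj.
Qed.

Lemma mpoly3_morph_eq (S : nzRingType) (f g : {rmorphism T -> S}) :
  (forall k, f k%:MP = g k%:MP) -> f a = g a -> f b = g b -> f c = g c -> f =1 g.
Proof. by move=> hC ha hb hc; apply: mpoly_lrmorph_eq => //; apply: forall_ord3. Qed.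

Lemma comp_a (x y z : T) : a \mPo [tuple x; y; z] = x.
Proof. by rewrite comp_mpolyXU. Qed.
Lemma comp_b (x y z : T) : b \mPo [tuple x; y; z] = y.
Proof. by rewrite comp_mpolyXU. Qed.
Lemma comp_c (x y z : T) : c \mPo [tuple x; y; z] = z.
Proof. by rewrite comp_mpolyXU. Qed.
Definition compE := (comp_a, comp_b, comp_c).

(* The linear form M |-> tr (N M). *)
Definition trf N : T := (N 0 0 - N 1 1)%:MP * a + (N 1 0)%:MP * b + (N 0 1)%:MP * c.

Lemma trfE N : trf N = \tr (map_mx (@mpolyC 3 K) N *m generic_mx K).
Proof.
rewrite [N]mx2E /trf !mxE /= generic_mxE map_mx2 mx2M mx2_tr; ring.
Qed.

Lemma trfD N P : trf (N + P) = trf N + trf P.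
Proof. by rewrite /trf !mxE; ring. Qed.
Lemma trfZ k N : trf (k *: N) = k%:MP * trf N.
Proof. by rewrite /trf !mxE; ring. Qed.
Lemma trfN N : trf (- N) = - trf N.
Proof. by rewrite /trf !mxE; ring. Qed.

Lemma conj_mx_tr s : s \in unitmx -> \tr (conj_mx s) = 0.
Proof.
move=> su; rewrite /conj_mx mxtrace_mulC mulmxA -map_mxM mulmxV // map_mx1 mul1mx.
by rewrite generic_mxE mx2_tr subrr.
Qed.

Lemma map_generic_conj s : s \in unitmx ->
  map_mx (conj_act s) (generic_mx K) = conj_mx s.
Proof.
move=> su; rewrite (mx2_traceless (conj_mx_tr su)) generic_mxE map_mx2.
by rewrite /conj_act rmorphN /= !compE.
Qed.

Lemma conj_actC s k : conj_act s k%:MP = k%:MP.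
Proof. by rewrite /conj_act comp_mpolyC. Qed.

Lemma conj_act_zmod s : zmod_morphism (conj_act s).
Proof. by move=> f g; rewrite /conj_act rmorphB. Qed.
Lemma conj_act_monoid s : monoid_morphism (conj_act s).
Proof. by split=> [|f g]; rewrite /conj_act ?rmorph1 ?rmorphM. Qed.
HB.instance Definition _ s := GRing.isZmodMorphism.Build T T (conj_act s) (conj_act_zmod s).
HB.instance Definition _ s := GRing.isMonoidMorphism.Build T T (conj_act s) (conj_act_monoid s).

(** Labelling linear forms by matrices turns the action into conjugation. As a, b, c are of the form
    [trf N], identities between actions are checked on these forms only. *)
Lemma conj_act_trf s N : s \in unitmx -> conj_act s (trf N) = trf (s *m N *m invmx s).
Proof.
move=> su; rewrite 2!trfE.
transitivity (\tr (map_mx (conj_act s) (map_mx (@mpolyC 3 K) N *m generic_mx K))).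
  by rewrite trace_map_mx.
rewrite map_mxM.
rewrite map_generic_conj; last exact: su.
have -> : map_mx (conj_act s) (map_mx (@mpolyC 3 K) N) = map_mx (@mpolyC 3 K) N.
  by rewrite -map_mx_comp; apply: eq_map_mx; apply: conj_actC.
by rewrite /conj_mx !map_mxM !mulmxA mxtrace_mulC !mulmxA.
Qed.

Lemma trf_a : a = trf (mx2 1 0 0 0).
Proof. by rewrite /trf !mxE /= subr0 !rmorph0 !mul0r rmorph1 mul1r !addr0. Qed.
Lemma trf_b : b = trf (mx2 0 0 1 0).
Proof. by rewrite /trf !mxE /= subr0 !rmorph0 !mul0r rmorph1 mul1r addr0 add0r. Qed.
Lemma trf_c : c = trf (mx2 0 1 0 0).
Proof. by rewrite /trf !mxE /= subr0 !rmorph0 !mul0r rmorph1 mul1r !add0r. Qed.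

Lemma trf_morph_eq (f g : {rmorphism T -> T}) :
  (forall k, f k%:MP = g k%:MP) -> (forall N, f (trf N) = g (trf N)) -> f =1 g.
Proof.
by move=> hC h; apply: mpoly3_morph_eq => //; rewrite ?trf_a ?trf_b ?trf_c h.
Qed.

Lemma conj_actM s t f : s \in unitmx -> t \in unitmx ->
  conj_act s (conj_act t f) = conj_act (s *m t) f.
Proof.
move=> su tu; have stu : s *m t \in unitmx by rewrite unitmx_mul su.
have est : invmx (s *m t) = invmx t *m invmx s.
  apply: (can_inj (mulKmx stu)).
  by rewrite mulmxV // mulmxA -(mulmxA s) mulmxV // mulmx1 mulmxV.
apply: (@trf_morph_eq (conj_act s \o conj_act t) (conj_act (s *m t))) => [k|N] /=.
  by rewrite !conj_actC.
by rewrite !conj_act_trf // est !mulmxA.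
Qed.

(** Hence a matrix whose determinant is a nonzero square acts like an element of G. *)
Lemma conj_act_scale (r : K) s f : r != 0 -> s \in unitmx ->
  conj_act (r *: s) f = conj_act s f.
Proof.
move=> r0 su; have rsu : r *: s \in unitmx by rewrite unitmxZ // unitfE.
apply: (@trf_morph_eq (conj_act (r *: s)) (conj_act s)) => [k|N] /=.
  by rewrite !conj_actC.
rewrite !conj_act_trf //; congr trf.
have -> : invmx (r *: s) = r^-1 *: invmx s.
  apply: (can_inj (mulKmx rsu)).
  by rewrite mulmxV // -scalemxAl -scalemxAr mulmxV // scalerA mulfV // scale1r.
by rewrite -!scalemxAl -scalemxAr scalerA mulfV // scale1r.
Qed.

Lemma conj_act1 f : conj_act 1%:M f = f.
Proof.
apply: (@trf_morph_eq (conj_act 1%:M) idfun) => [k|N] /=; first by rewrite conj_actC.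
by rewrite conj_act_trf ?unitmx1 // invmx1 mul1mx mulmx1.
Qed.

Lemma conj_act_def s f : conj_act s f =
  f \mPo [tuple conj_mx s 0 0; conj_mx s 0 1; conj_mx s 1 0].
Proof. by []. Qed.

Opaque conj_act.

Definition pt P : 'I_3 -> K := tnth [tuple P 0 0; P 0 1; P 1 0].

Lemma meval_trf N P : \tr P = 0 -> (trf N).@[pt P] = \tr (N *m P).
Proof.
move=> /mx2_traceless eP; rewrite [N in RHS]mx2E [P in RHS]eP mx2M mx2_tr.
rewrite /trf !mevalD !mevalM !mevalC !mevalXU /pt !(tnth_nth 0) /=.
ring.
Qed.

Lemma meval_conj_act s P f : s \in unitmx -> \tr P = 0 ->
  (conj_act s f).@[pt P] = f.@[pt (invmx s *m P *m s)].
Proof.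
move=> su tP.
have tP' : \tr (invmx s *m P *m s) = 0 by rewrite mxtrace_mulC mulmxA mulmxV // mul1mx.
have h N : (meval (pt P) \o conj_act s) (trf N) = meval (pt (invmx s *m P *m s)) (trf N).
  rewrite /= conj_act_trf // !meval_trf //.
  by rewrite -!mulmxA mxtrace_mulC !mulmxA.
apply: (@mpoly3_morph_eq _ (meval (pt P) \o conj_act s)
   (meval (pt (invmx s *m P *m s)))) => [k|||]; last 3 first.
- by rewrite trf_a; apply: h.
- by rewrite trf_b; apply: h.
- by rewrite trf_c; apply: h.
by rewrite /= conj_actC !mevalC.
Qed.

End Action.

(** * Squares in a finite field of odd order *)

Section Squares.
Variable K : finFieldType.
Hypothesis two0 : 2%:R != 0 :> K.
Hypothesis oddK : odd #|K|.
Implicit Types (x y z k m : K).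

Definition is_square x := x \in [set r ^+ 2 | r : K].

Lemma is_squareP x : reflect (exists r, x = r ^+ 2) (is_square x).
Proof. by apply: (iffP imsetP) => -[r]; [exists r|exists r]. Qed.

Lemma opp_neq x : x != 0 -> x != - x.
Proof. by move=> x0; rewrite -subr_eq0 opprK -mulr2n -mulr_natl mulf_neq0. Qed.

(** The enumeration order of a finite type serves to choose one of x and -x, here and in
    [halfset]. *)
Lemma rank_opp (V : finZmodType) (x : V) : x != - x ->
  (enum_rank x < enum_rank (- x))%N = ~~ (enum_rank (- x) < enum_rank x)%N.
Proof.
move=> xx; rewrite -leqNgt ltn_neqAle andbC; case: leqP => //= _.
by rewrite (inj_eq val_inj) (inj_eq enum_rank_inj).
Qed.

(** An element is determined by its square and by which of r, -r it is; this gives the weak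
    inequality, and equality is excluded by parity. *)
Lemma card_squares : (#|K| < #|[set r ^+ 2 | r : K]| * 2)%N.
Proof.
have h : (#|K| <= #|[set r ^+ 2 | r : K]| * 2)%N.
  pose F (r : K) := (r ^+ 2, (enum_rank r < enum_rank (- r))%N).
  have injF : injective F.
    move=> r r' [/eqP]; rewrite eqf_sqr => /orP[/eqP//|/eqP ->].
    rewrite opprK; have [->|r0] := eqVneq r' 0; first by rewrite oppr0.
    by rewrite rank_opp ?opp_neq //; case: (_ < _)%N.
  have : [set F r | r : K] \subset setX [set r ^+ 2 | r : K] [set: bool].
    by apply/subsetP => _ /imsetP[r _ ->]; rewrite in_setX in_setT andbT; apply: imset_f.
  by move/subset_leq_card; rewrite card_imset // cardsX cardsT card_bool.
rewrite ltn_neqAle h andbT; apply/eqP => e; move: oddK.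
by rewrite e muln2 odd_double.
Qed.

(** Pigeonhole: the squares and the values k - m r, r a square, together number more than |K|, so
    the two sets meet. *)
Lemma conic_point m k : m != 0 -> exists x y, x ^+ 2 + m * y ^+ 2 = k.
Proof.
move=> m0; set S := [set r ^+ 2 | r : K].
pose S' := [set k - m * r | r in S].
have cS' : #|S'| = #|S|.
  by apply: card_imset => x y /addrI/oppr_inj/(mulfI m0).
have [h|] := boolP [disjoint S & S']; last first.
  case/pred0Pn => x /andP[/imsetP[r _ ->] /imsetP[_ /imsetP[t _ ->] e]].
  by exists r, t; rewrite e subrK.
have := leq_card_setU S S' => /leqifP; rewrite h => /eqP e.
have := max_card [in S :|: S'].
by rewrite e cS' addnn -muln2 leqNgt card_squares.
Qed.

(** The nonzero squares already provide h = (|K| - 1)/2 roots of X^h - 1; a nonsquare root would be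
    one too many. *)
Lemma square_euler y : y != 0 -> y ^+ #|K|./2 = 1 -> is_square y.
Proof.
move=> y0 hy; apply: contraT => ns; set h := #|K|./2 in hy.
have Kh : #|K| = h.*2.+1 by rewrite -[LHS]odd_double_half oddK.
pose S := [set r ^+ 2 | r : K] :\ 0.
have S0 : 0 \in [set r ^+ 2 | r : K] by apply/imsetP; exists 0; rewrite ?expr0n.
have cS : (h <= #|S|)%N.
  by move: card_squares; rewrite (cardsD1 0) S0 Kh -/S /=; move: #|S| => n; lia.
pose P : {poly K} := 'X^h - 1.
have h0 : (0 < h)%N by have := finNzRing_gt1 K; rewrite Kh; case: (h).
have sP : size P = h.+1 by rewrite size_XnsubC.
have P0 : P != 0 by rewrite -size_poly_eq0 sP.
suff : (size (y :: enum S) < size P)%N by rewrite sP /= -cardE ltnS ltnNge cS.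
apply: max_poly_roots => //.
- rewrite /= /root /P !hornerE hy subrr eqxx /=; apply/allP => x.
  rewrite mem_enum !inE => /andP[x0 /imsetP[r _ er]].
  rewrite /root !hornerE er -exprM mul2n.
  have r0 : r != 0 by apply: contraNneq x0 => r0; rewrite er r0 expr0n.
  have e : r ^+ h.*2 = 1 by apply: (mulfI r0); rewrite -exprS -Kh expf_card mulr1.
  by rewrite e subrr.
- by rewrite /= enum_uniq mem_enum in_setD; move: ns; rewrite /is_square => /negPf ->; rewrite andbF.
Qed.

Lemma nonsquare_euler y : ~~ is_square y -> y ^+ #|K|./2 = -1.
Proof.
move=> ns; have y0 : y != 0.
  by apply: contraNneq ns => ->; apply/is_squareP; exists 0; rewrite expr0n.
have : (y ^+ #|K|./2) ^+ 2 = 1.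
  apply: (mulfI y0); rewrite -exprM muln2 mulr1 -exprS -add1n -[1%N]/(nat_of_bool true).
  by rewrite -oddK odd_double_half expf_card.
move/eqP; rewrite -[1](expr1n _ 2) eqf_sqr expr1n => /orP[/eqP h|/eqP//].
by rewrite (square_euler y0 h) in ns.
Qed.

Lemma square_mul_nonsquares x y :
  ~~ is_square x -> ~~ is_square y -> is_square (x * y).
Proof.
move=> nx ny; have [->|xy0] := eqVneq (x * y) 0.
  by apply/is_squareP; exists 0; rewrite expr0n.
apply: square_euler => //.
by rewrite exprMn !nonsquare_euler // mulrNN mulr1.
Qed.

End Squares.

(** * Generators of SL2, its conjugacy classes, and the reflection tau *)

Section GroupFacts.
Variable K : finFieldType.
Hypothesis two0 : 2%:R != 0 :> K.
Hypothesis oddK : odd #|K|.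
Local Notation T := {mpoly K[3]}.
Local Notation a := (va K).
Local Notation b := (vb K).
Local Notation c := (vc K).
Implicit Types (f g : T) (N P s : 'M[K]_2) (t k : K).

Definition upper t : 'M[K]_2 := mx2 1 t 0 1.
Definition lower t : 'M[K]_2 := mx2 1 0 t 1.

Lemma det1_unit s : \det s = 1 -> s \in unitmx.
Proof. by move=> e; rewrite unitmxE e unitr1. Qed.

Lemma det_upper t : \det (upper t) = 1.
Proof. by rewrite mx2_det mul1r mulr0 subr0. Qed.
Lemma det_lower t : \det (lower t) = 1.
Proof. by rewrite mx2_det mul1r mul0r subr0. Qed.

Lemma upperD t t' : upper t *m upper t' = upper (t + t').
Proof. by rewrite mx2M; congr mx2; ring. Qed.
Lemma lowerD t t' : lower t *m lower t' = lower (t + t').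
Proof. by rewrite mx2M; congr mx2; ring. Qed.

Lemma SL2_gen (Q : 'M[K]_2 -> Prop) :
  (forall t, Q (upper t)) -> (forall t, Q (lower t)) ->
  (forall s s', \det s = 1 -> \det s' = 1 -> Q s -> Q s' -> Q (s *m s')) ->
  forall s, \det s = 1 -> Q s.
Proof.
move=> QU QL QM.
have gen x y z w : z != 0 -> x * w - y * z = 1 -> Q (mx2 x y z w).
  move=> z0 d; have -> : mx2 x y z w =
      upper ((x - 1) / z) *m (lower z *m upper ((w - 1) / z)).
    have ey : y = (x * w - 1) / z by apply: (mulIf z0); rewrite divfK // -d; ring.
    by rewrite !mx2M ey; congr mx2; field.
  by apply: (QM _ _ _ _ (QU _) (QM _ _ _ _ (QL _) (QU _)));
    rewrite ?det_mulmx ?det_upper ?det_lower ?mulr1.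
move=> s; rewrite [s]mx2E mx2_det.
move: (s 0 0) (s 0 1) (s 1 0) (s 1 1) => x y z w d.
have [z0|] := eqVneq z 0; last by move=> z0; apply: gen.
have x0 : x != 0.
  by apply: contra_eqN d => /eqP ->; rewrite z0 mul0r mulr0 subr0 eq_sym oner_eq0.
(* A row operation makes the lower left entry nonzero. *)
have -> : mx2 x y z w = lower (-1) *m mx2 x y (x + z) (y + w).
  by rewrite mx2M; congr mx2; ring.
apply: (QM _ _ (det_lower _) _ (QL _)); first by rewrite mx2_det -d; ring.
by apply: gen; [rewrite z0 addr0|rewrite -d; ring].
Qed.

Definition G_inv f := forall s, \det s = 1 -> conj_act s f = f.

Lemma G_inv_gen f : (forall t, conj_act (upper t) f = f) ->
  (forall t, conj_act (lower t) f = f) -> G_inv f.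
Proof.
move=> hU hL s ds; apply: (@SL2_gen (fun s => conj_act s f = f) hU hL _ s ds).
move=> {}s s' {}ds ds' hs hs'.
by rewrite -(conj_actM f (det1_unit ds) (det1_unit ds')) hs' hs.
Qed.

Lemma upper_a t : conj_act (upper t) a = a - t%:MP * c.
Proof.
rewrite trf_a conj_act_trf ?det1_unit ?det_upper // /upper invmx2; last first.
  by rewrite mul1r mulr0 subr0 oner_eq0.
rewrite mul1r mulr0 subr0 invr1 scale1r !mx2M /trf !mxE /=; ring.
Qed.
Lemma upper_b t : conj_act (upper t) b = (2%:R * t)%:MP * a + b - (t ^+ 2)%:MP * c.
Proof.
rewrite trf_b conj_act_trf ?det1_unit ?det_upper // /upper invmx2; last first.
  by rewrite mul1r mulr0 subr0 oner_eq0.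
rewrite mul1r mulr0 subr0 invr1 scale1r !mx2M /trf !mxE /=; ring.
Qed.
Lemma upper_c t : conj_act (upper t) c = c.
Proof.
rewrite {1}trf_c conj_act_trf ?det1_unit ?det_upper // /upper invmx2; last first.
  by rewrite mul1r mulr0 subr0 oner_eq0.
rewrite mul1r mulr0 subr0 invr1 scale1r !mx2M /trf !mxE /=; ring.
Qed.
Lemma lower_a t : conj_act (lower t) a = a + t%:MP * b.
Proof.
rewrite trf_a conj_act_trf ?det1_unit ?det_lower // /lower invmx2; last first.
  by rewrite mul1r mul0r subr0 oner_eq0.
rewrite mul1r mul0r subr0 invr1 scale1r !mx2M /trf !mxE /=; ring.
Qed.
Lemma lower_b t : conj_act (lower t) b = b.
Proof.
rewrite {1}trf_b conj_act_trf ?det1_unit ?det_lower // /lower invmx2; last first.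
  by rewrite mul1r mul0r subr0 oner_eq0.
rewrite mul1r mul0r subr0 invr1 scale1r !mx2M /trf !mxE /=; ring.
Qed.
Lemma lower_c t : conj_act (lower t) c = - (2%:R * t)%:MP * a - (t ^+ 2)%:MP * b + c.
Proof.
rewrite trf_c conj_act_trf ?det1_unit ?det_lower // /lower invmx2; last first.
  by rewrite mul1r mul0r subr0 oner_eq0.
rewrite mul1r mul0r subr0 invr1 scale1r !mx2M /trf !mxE /=; ring.
Qed.
Definition elemE := (upper_a, upper_b, upper_c, lower_a, lower_b, lower_c).

(* With w such that det (w | N w) = 1, the columns w and N w conjugate N to
   its companion matrix. *)
Lemma companion k N : k != 0 -> \tr N = 0 -> \det N = k ->
  exists2 s, \det s = 1 & N *m s = s *m mx2 0 (- k) 1 0.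
Proof.
move=> k0 /mx2_traceless eN; rewrite eN mx2_det.
move: (N 0 0) (N 0 1) (N 1 0) => x y z dN {N eN}.
suff [w1 [w2 h]] : exists w1 w2, z * w1 ^+ 2 - 2%:R * x * w1 * w2 - y * w2 ^+ 2 = 1.
  exists (mx2 w1 (x * w1 + y * w2) w2 (z * w1 - x * w2)).
    by rewrite mx2_det -h; ring.
  by rewrite !mx2M -dN; congr mx2; ring.
have [z0|z0] := eqVneq z 0.
  have x0 : x != 0.
    by apply: contraNneq k0 => x0; rewrite -dN x0 z0 mulr0 mul0r subr0.
  by exists (- (1 + y) / (2%:R * x)), 1; rewrite z0; field; rewrite ?x0 ?two0.
(* With W = w1 - x w2 / z, completing the square turns the form into z (W^2 + (k / z^2) w2^2), which
   must take the value 1. *)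
have m0 : k / z ^+ 2 != 0 by rewrite mulf_neq0 ?invr_eq0 ?expf_neq0.
have [W [w2 h]] := conic_point two0 oddK (z^-1) m0.
exists (W + x * w2 / z), w2.
transitivity (z * (W ^+ 2 + k / z ^+ 2 * w2 ^+ 2)); last by rewrite h divff.
by rewrite -dN; field.
Qed.

(** Both matrices are conjugate, inside G, to the companion matrix of X^2 + k. As a consequence,
    divisibility of an invariant by one form [trf N] spreads to the whole class. *)
Lemma SL2_transitive k N N' : k != 0 -> \tr N = 0 -> \det N = k ->
  \tr N' = 0 -> \det N' = k ->
  exists2 s, \det s = 1 & s *m N *m invmx s = N'.
Proof.
move=> k0 tN dN tN' dN'.
have [s ds es] := companion k0 tN dN; have [s' ds' es'] := companion k0 tN' dN'.
have su := det1_unit ds; have su' := det1_unit ds'.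
exists (s' *m invmx s); first by rewrite det_mulmx det_inv ds ds' invr1 mulr1.
have -> : invmx (s' *m invmx s) = s *m invmx s'.
  have u : s' *m invmx s \in unitmx by rewrite unitmx_mul su' unitmx_inv.
  apply: (can_inj (mulKmx u)); rewrite mulmxV // mulmxA mulmxKV //.
  by rewrite mulmxV.
have -> : s' *m invmx s *m N *m (s *m invmx s') = s' *m (invmx s *m (N *m s)) *m invmx s'.
  by rewrite !mulmxA.
by rewrite es mulKmx // -es' mulmxK.
Qed.

Definition tau f : T := f \mPo [tuple - a; b; c].
Definition iota_neg f : T := f \mPo [tuple - a; - b; - c].

Lemma tau_zmod : zmod_morphism tau.
Proof. by move=> f g; rewrite /tau rmorphB. Qed.
Lemma tau_monoid : monoid_morphism tau.
Proof. by split=> [|f g]; rewrite /tau ?rmorph1 ?rmorphM. Qed.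
HB.instance Definition _ := GRing.isZmodMorphism.Build T T tau tau_zmod.
HB.instance Definition _ := GRing.isMonoidMorphism.Build T T tau tau_monoid.
Lemma iota_zmod : zmod_morphism iota_neg.
Proof. by move=> f g; rewrite /iota_neg rmorphB. Qed.
Lemma iota_monoid : monoid_morphism iota_neg.
Proof. by split=> [|f g]; rewrite /iota_neg ?rmorph1 ?rmorphM. Qed.
HB.instance Definition _ := GRing.isZmodMorphism.Build T T iota_neg iota_zmod.
HB.instance Definition _ := GRing.isMonoidMorphism.Build T T iota_neg iota_monoid.

Lemma tauC k : tau k%:MP = k%:MP. Proof. exact: comp_mpolyC. Qed.
Lemma iotaC k : iota_neg k%:MP = k%:MP. Proof. exact: comp_mpolyC. Qed.
Lemma tauE : (tau a = - a) * (tau b = b) * (tau c = c).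
Proof. by rewrite /tau !compE. Qed.
Lemma iotaE : (iota_neg a = - a) * (iota_neg b = - b) * (iota_neg c = - c).
Proof. by rewrite /iota_neg !compE. Qed.

Lemma tau_def f : tau f = f \mPo [tuple - a; b; c].
Proof. by []. Qed.

Opaque tau iota_neg.

Lemma iota_trf N : iota_neg (trf N) = - trf N.
Proof.
by rewrite /trf !(rmorphD iota_neg) !(rmorphM iota_neg) /= !iotaC !iotaE; ring.
Qed.

Definition refl1 : 'M[K]_2 := mx2 1 0 0 (-1).

Lemma det_refl1 : \det refl1 = -1.
Proof. by rewrite mx2_det mulr0 subr0 mul1r. Qed.

Lemma refl1_unit : refl1 \in unitmx.
Proof. by rewrite unitmxE det_refl1 unitrN unitr1. Qed.

Lemma inv_refl1 : invmx refl1 = refl1.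
Proof.
apply: (can_inj (mulKmx refl1_unit)); rewrite mulmxV ?refl1_unit //.
by rewrite mx2M mx2_scalar; congr mx2; ring.
Qed.

Lemma tau_trf N : tau (trf N) = - trf (refl1 *m N *m refl1).
Proof.
rewrite [N]mx2E !mx2M /trf !mxE /= !(rmorphD tau) !(rmorphM tau) /= !tauC !tauE.
ring.
Qed.

Lemma tau_iota f : tau f = iota_neg (conj_act refl1 f).
Proof.
apply: (@trf_morph_eq _ tau (iota_neg \o conj_act refl1)) => [k|N] /=.
  by rewrite conj_actC iotaC tauC.
by rewrite tau_trf conj_act_trf ?refl1_unit // inv_refl1 iota_trf.
Qed.

Lemma tauK f : tau (tau f) = f.
Proof.
apply: (@mpoly3_morph_eq _ _ (tau \o tau) idfun) => [k|||] /=; rewrite ?tauC // !tauE //.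
by rewrite rmorphN /= tauE opprK.
Qed.

Lemma iota_conj s f : s \in unitmx -> iota_neg (conj_act s f) = conj_act s (iota_neg f).
Proof.
move=> su.
apply: (@trf_morph_eq _ (iota_neg \o conj_act s) (conj_act s \o iota_neg)) => [k|N] /=.
  by rewrite conj_actC !iotaC conj_actC.
by rewrite conj_act_trf // !iota_trf rmorphN /= conj_act_trf.
Qed.

Lemma conj_tau s f : s \in unitmx ->
  conj_act s (tau f) = tau (conj_act (refl1 *m s *m refl1) f).
Proof.
move=> su; have ru := refl1_unit.
have ur : refl1 *m s *m refl1 \in unitmx by rewrite !unitmx_mul ru su.
rewrite (tau_iota f) (tau_iota (conj_act _ f)) -(iota_conj (conj_act refl1 f) su).
rewrite (conj_actM f su ru) (conj_actM f ru ur).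
have rr : refl1 *m refl1 = 1%:M by rewrite -{1}inv_refl1 mulVmx.
by rewrite !mulmxA rr mul1mx.
Qed.

Lemma G_inv_tau f : G_inv f -> G_inv (tau f).
Proof.
move=> h s ds; rewrite (conj_tau f (det1_unit ds)) h // !det_mulmx ds det_refl1.
by rewrite mulr1 mulrNN mulr1.
Qed.

Lemma iotaX i : iota_neg 'X_i = - 'X_i.
Proof.
move: i; apply: forall_ord3; [exact: iotaE.1.1|exact: iotaE.1.2|exact: iotaE.2].
Qed.

Lemma dhomog_iota d f : f \is d.-homog -> iota_neg f = (-1) ^+ d * f.
Proof.
move=> /dhomogP h; rewrite {1 2}[f]mpolyE rmorph_sum mulr_sumr.
apply: eq_big_seq => m /h <-.
rewrite -mul_mpolyC rmorphM /= iotaC mulrCA; congr (_ * _).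
rewrite mpolyXE_id rmorph_prod mdegE -prodrXr -big_split /=; apply: eq_bigr => i _.
by rewrite rmorphXn /= iotaX [LHS]exprNn.
Qed.

End GroupFacts.

(** * Linear forms and their products over conjugacy classes *)

Section LinearForms.
Variable K : finFieldType.
Hypothesis two0 : 2%:R != 0 :> K.
Hypothesis oddK : odd #|K|.
Local Notation T := {mpoly K[3]}.
Local Notation a := (va K).
Local Notation b := (vb K).
Local Notation c := (vc K).
Implicit Types (f g : T) (N P s : 'M[K]_2) (t k : K).

(* The projection of the coordinates M onto the plane tr (N M) = 0 along P,
   when tr (N P) = 1. *)
Definition elim_form N P f : T :=
  f \mPo [tuple a - (P 0 0)%:MP * trf N; b - (P 0 1)%:MP * trf N;
                c - (P 1 0)%:MP * trf N].

Lemma elim_zmod N P : zmod_morphism (elim_form N P).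
Proof. by move=> f g; rewrite /elim_form rmorphB. Qed.
Lemma elim_monoid N P : monoid_morphism (elim_form N P).
Proof. by split=> [|f g]; rewrite /elim_form ?rmorph1 ?rmorphM. Qed.
HB.instance Definition _ N P := GRing.isZmodMorphism.Build T T (elim_form N P) (elim_zmod N P).
HB.instance Definition _ N P := GRing.isMonoidMorphism.Build T T (elim_form N P) (elim_monoid N P).

Lemma elimC N P k : elim_form N P k%:MP = k%:MP.
Proof. exact: comp_mpolyC. Qed.
Lemma elimE N P : (elim_form N P a = a - (P 0 0)%:MP * trf N) *
  (elim_form N P b = b - (P 0 1)%:MP * trf N) *
  (elim_form N P c = c - (P 1 0)%:MP * trf N).
Proof. by rewrite /elim_form !compE. Qed.

Lemma elim_trf N P N' : \tr P = 0 ->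
  elim_form N P (trf N') = trf N' - (\tr (N' *m P))%:MP * trf N.
Proof.
move=> /mx2_traceless eP; have -> : \tr (N' *m P) =
    (N' 0 0 - N' 1 1) * P 0 0 + N' 1 0 * P 0 1 + N' 0 1 * P 1 0.
  by rewrite [N' in LHS]mx2E [P in LHS]eP mx2M mx2_tr; ring.
rewrite {1}/trf !(rmorphD (elim_form N P)) !(rmorphM (elim_form N P)) /= !elimC !elimE.
by rewrite /trf; ring.
Qed.

Lemma elim_congr N P f : divides (trf N) (f - elim_form N P f).
Proof.
rewrite -{1}[f]comp_mpoly_id; apply: comp_mpoly_congr; first exact: divides_ideal.
have h (x y : T) : divides (trf N) (x - (x - y * trf N)).
  by rewrite opprB addrC subrK; apply/divides_mull/divides_refl.
by apply: forall_ord3; rewrite (tnth_mktuple _ _) (tnth_nth 0); apply: h.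
Qed.

(** Divisibility by a linear form is the kernel of a ring endomorphism of the domain T; primality of
    the form follows. *)
Lemma elim_divides N P f : \tr P = 0 -> \tr (N *m P) = 1 ->
  divides (trf N) f <-> elim_form N P f = 0.
Proof.
move=> tP NP; split=> [[k ->]|e].
  by rewrite rmorphM /= elim_trf // NP mul1r subrr mulr0.
by have := elim_congr N P f; rewrite e subr0.
Qed.

(** Nondegeneracy of the trace form on traceless matrices; a nonzero diagonal requires dividing by
    2. *)
Lemma dual_point N : \tr N = 0 -> N != 0 -> exists2 P, \tr P = 0 & \tr (N *m P) = 1.
Proof.
move=> /mx2_traceless eN N0.
have [x0|x0] := eqVneq (N 0 0) 0; last first.
  exists (mx2 (2%:R * N 0 0)^-1 0 0 (- (2%:R * N 0 0)^-1)); first by rewrite mx2_tr subrr.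
  rewrite eN mx2M mx2_tr !mxE /=; field; rewrite ?x0 ?two0 //.
have [y0|y0] := eqVneq (N 0 1) 0; last first.
  exists (mx2 0 0 (N 0 1)^-1 0); first by rewrite mx2_tr addr0.
  by rewrite eN mx2M mx2_tr !mxE /=; field.
have [z0|z0] := eqVneq (N 1 0) 0.
  by case/eqP: N0; rewrite eN x0 y0 z0 oppr0 [RHS]mx2E !mxE.
exists (mx2 0 (N 1 0)^-1 0 0); first by rewrite mx2_tr addr0.
by rewrite eN mx2M mx2_tr !mxE /=; field.
Qed.

Lemma trf_inj0 N : \tr N = 0 -> trf N = 0 -> N = 0.
Proof.
move=> tN e; apply/eqP; apply: contraT => /(dual_point tN) [P tP].
by rewrite -meval_trf // e meval0 => /eqP; rewrite eq_sym oner_eq0.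
Qed.

Lemma trf_prime N : \tr N = 0 -> N != 0 -> prime_elt (trf N).
Proof.
move=> tN N0; have [P tP NP] := dual_point tN N0.
have eP := elim_divides _ tP NP; split.
- by apply: contraNneq N0 => /(trf_inj0 tN) ->.
- apply/negP => /unitrP[k [h _]].
  have /eP : divides (trf N) 1 by exists k.
  by move/eqP; rewrite rmorph1 oner_eq0.
move=> f g /eP /eqP; rewrite rmorphM mulf_eq0.
by case/orP => /eqP /eP; [left|right].
Qed.

Lemma trf_divides_trf N N' : \tr N = 0 -> \tr N' = 0 -> N != 0 ->
  divides (trf N) (trf N') -> exists k, N' = k *: N.
Proof.
move=> tN tN' N0; have [P tP NP] := dual_point tN N0.
move=> /(elim_divides _ tP NP); rewrite elim_trf // => e.
exists (\tr (N' *m P)); apply/eqP; rewrite -subr_eq0; apply/eqP/trf_inj0.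
  by rewrite linearB linearZ /= tN tN' mulr0 subrr.
by rewrite trfD -scaleNr trfZ rmorphN mulNr.
Qed.

Lemma trf_dhomog N : trf N \is 1.-homog.
Proof.
have hX i : ('X_i : T) \is 1.-homog by rewrite dhomogX /= mdeg1.
by rewrite /trf !mul_mpolyC !rpredD // rpredZ // hX.
Qed.

Definition orb k : {set 'M[K]_2} := [set N | (\tr N == 0) && (\det N == k)].
(* Representatives of a symmetric set of nonzero matrices modulo sign. *)
Definition halfset (A : {set 'M[K]_2}) := [set N in A | (enum_rank N < enum_rank (- N))%N].
Definition halforb k := halfset (orb k).
Definition half_prod k : T := \prod_(N in halforb k) trf N.

Lemma orbP k N : reflect (\tr N = 0 /\ \det N = k) (N \in orb k).
Proof.
by rewrite inE; apply: (iffP andP) => -[/eqP-> /eqP->].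
Qed.

Lemma det_mx2N N : \det (- N) = \det N.
Proof. by rewrite [N]mx2E mx2N !mx2_det; ring. Qed.

Lemma det_mx2Z k N : \det (k *: N) = k ^+ 2 * \det N.
Proof. by rewrite [N]mx2E mx2Z !mx2_det; ring. Qed.

Lemma orb_neq0 k N : k != 0 -> N \in orb k -> N != 0.
Proof.
move=> k0 /orbP[_ dN]; apply: contraNneq k0 => N0; rewrite -dN N0.
by rewrite (_ : 0 = 0 *: (0 : 'M[K]_2)) ?det_mx2Z ?expr0n ?mul0r // scaler0.
Qed.

Lemma orb_opp k N : (- N \in orb k) = (N \in orb k).
Proof. by rewrite !inE linearN /= oppr_eq0 det_mx2N. Qed.

Lemma mx_opp_neq N : N != 0 -> N != - N.
Proof.
move=> N0; apply/eqP => e; case/eqP: N0.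
have : 2%:R *: N = 0 by rewrite scaler_nat mulr2n {1}e addNr.
by move/eqP; rewrite scaler_eq0 (negPf two0) => /eqP.
Qed.

Lemma halfE (A : {set 'M[K]_2}) N :
  (N \in halfset A) = (N \in A) && (enum_rank N < enum_rank (- N))%N.
Proof. by rewrite in_set. Qed.

Lemma half_sub (A : {set 'M[K]_2}) N : N \in halfset A -> N \in A.
Proof. by rewrite halfE => /andP[]. Qed.

Lemma half_opp (A : {set 'M[K]_2}) N : N != 0 -> N \in A -> - N \in A ->
  (- N \in halfset A) = (N \notin halfset A).
Proof.
move=> N0 NA nNA; rewrite !halfE NA nNA /= opprK.
by rewrite [in RHS]rank_opp ?negbK // mx_opp_neq.
Qed.

Lemma card_halfset (A : {set 'M[K]_2}) :
  (forall N, N \in A -> N != 0 /\ - N \in A) -> #|A| = #|halfset A|.*2.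
Proof.
move=> hA; rewrite -(cardsID (halfset A)) -addnn; congr (_ + _)%N.
  by apply: eq_card => N; rewrite in_setI !halfE andbA andbb.
have -> : A :\: halfset A = [set - N | N in halfset A].
  apply/setP => N; rewrite in_setD; apply/andP/imsetP => [[Nh NA]|[N' N'h ->]].
    by have [N0 nNA] := hA N NA; exists (- N); rewrite ?opprK // half_opp.
  have N'A := half_sub N'h; have [N0 nNA] := hA _ N'A.
  by rewrite nNA half_opp // negbK.
by rewrite card_imset //; apply: oppr_inj.
Qed.

Lemma halforb_opp k N : k != 0 -> N \in orb k ->
  (- N \in halforb k) = (N \notin halforb k).
Proof. by move=> k0 No; apply: half_opp; rewrite ?orb_opp ?(orb_neq0 k0 No). Qed.

(** The factors of N and -N pair up to minus a square. This is the origin of the square root of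
    [f4_tilde]. *)
Lemma orb_half_prod k : k != 0 ->
  \prod_(N in orb k) trf N = (-1) ^+ #|halforb k| * half_prod k ^+ 2.
Proof.
move=> k0; rewrite (bigID (mem (halforb k))) /=.
have -> : \prod_(N in orb k | N \in halforb k) trf N = half_prod k.
  by apply: eq_bigl => N; rewrite !halfE andbA andbb.
have -> : \prod_(N in orb k | N \notin halforb k) trf N =
          \prod_(N in halforb k) (- trf N).
  rewrite (reindex_inj (@oppr_inj _)) /=; apply: eq_big => N; last by rewrite trfN.
  rewrite orb_opp; apply/andP/idP => [[No]|Nh].
    by rewrite halforb_opp // negbK.
  have No := half_sub Nh; by rewrite halforb_opp // negbK.
by rewrite prodrN -/(half_prod k) mulrCA expr2.
Qed.

Lemma card_orb k : k != 0 -> #|orb k| = #|halforb k|.*2.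
Proof.
by move=> k0; apply: card_halfset => N No; rewrite orb_opp (orb_neq0 k0 No).
Qed.

(** If the forms of two representatives are proportional, the factor has square 1 because the
    determinants agree, and -1 is excluded by [halforb]: the forms are pairwise non-associated
    primes. *)
Lemma half_prod_divides k m f : k != 0 ->
  (forall N, N \in halforb k -> divides (trf N ^+ m) f) -> divides (half_prod k ^+ m) f.
Proof.
move=> k0 h; rewrite /half_prod -prodrXl -big_enum.
apply: prod_prime_divides => [|N|N N'|N]; rewrite ?enum_uniq ?mem_enum //.
- by move=> /half_sub No; have /orbP[tN _] := No; apply: (trf_prime tN (orb_neq0 k0 No)).
- move=> Nh N'h; have No := half_sub Nh; have N'o := half_sub N'h.
  have /orbP[tN dN] := No; have /orbP[tN' dN'] := N'o.
  case/(trf_divides_trf tN tN' (orb_neq0 k0 No)) => l el.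
  move: dN'; rewrite el det_mx2Z dN -[RHS]mul1r => /(mulIf k0) /eqP.
  rewrite -[1](expr1n _ 2) eqf_sqr => /orP[] /eqP el1; first by rewrite el1 scale1r.
  by move: N'h; rewrite el el1 scaleN1r halforb_opp // Nh.
- exact: h.
Qed.

Lemma half_prod_neq0 k : k != 0 -> half_prod k != 0.
Proof.
move=> k0; apply/prodf_neq0 => N /half_sub No; have /orbP[tN _] := No.
by have [] := trf_prime tN (orb_neq0 k0 No).
Qed.

Lemma dhomog_prod_set (I : finType) (A : {set I}) (F : I -> T) :
  (forall i, i \in A -> F i \is 1.-homog) -> \prod_(i in A) F i \is #|A|.-homog.
Proof.
move=> h; rewrite -sum1_card; elim/big_rec2: _ => [|i m f iA].
  exact: dhomog1.
by apply: dhomogM; apply: h.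
Qed.

Lemma half_prod_dhomog k : half_prod k \is #|halforb k|.-homog.
Proof. by apply: dhomog_prod_set => N _; apply: trf_dhomog. Qed.

End LinearForms.

(** * Monomials of given weighted degree *)

Section WeightedMonomials.
Variables (k : nat) (w : 'I_k -> nat).
Hypothesis w_gt0 : forall i, (0 < w i)%N.
Local Notation wd := (weighted_mdeg w).

Lemma mdeg_weighted (m : 'X_{1..k}) : (mdeg m <= wd m)%N.
Proof. by rewrite mdegE; apply: leq_sum => i _; rewrite leq_pmulr. Qed.

Lemma weighted_mdegU i : wd U_(i)%MM = w i.
Proof.
rewrite /weighted_mdeg (bigD1 i) //= mnm1E eqxx mul1n big1 ?addn0 // => j ne.
by rewrite mnm1E eq_sym (negPf ne).
Qed.

(** The index j admits only the first j variables, so that variables can be added one at a time.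
    Positive weights bound the degree by n, so the list can be filtered from a finite type. *)
Definition wmonomials (j n : nat) : seq 'X_{1..k} :=
  [seq m : 'X_{1..k} <- map (@bmnm k n.+1) (enum [set: 'X_{1..k < n.+1}]) |
     [forall i : 'I_k, (j <= i)%N ==> (m i == 0%N)] && (wd m == n)].

Lemma wmonomialsP j n (m : 'X_{1..k}) : reflect
  ((forall i : 'I_k, (j <= i)%N -> m i = 0%N) /\ wd m = n) (m \in wmonomials j n).
Proof.
rewrite mem_filter; apply: (iffP andP) => [[/andP[/forall_inP h /eqP e0] _]|[h e0]].
  by split=> // i ji; apply/eqP/h.
split; first by apply/andP; split; [apply/forall_inP => i ji; rewrite h|apply/eqP].
have hm : (mdeg m < n.+1)%N by rewrite ltnS -e0 mdeg_weighted.
by apply/mapP; exists (BMultinom hm); rewrite ?mem_enum ?inE.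
Qed.

Lemma wmonomials_uniq j n : uniq (wmonomials j n).
Proof. by rewrite filter_uniq // map_inj_uniq ?enum_uniq //; apply: val_inj. Qed.

Lemma size_wmonomials0 n : size (wmonomials 0 n) = (n == 0)%N :> nat.
Proof.
have h m : m \in wmonomials 0 n -> m = 0%MM.
  by case/wmonomialsP => hm _; apply/mnmP => i; rewrite mnm0E hm.
case: n h => [|n] h /=.
  suff /perm_size -> : perm_eq (wmonomials 0 0) [:: 0%MM] by [].
  apply: uniq_perm; rewrite ?wmonomials_uniq // => m; rewrite inE.
  apply/idP/eqP => [/h //|->]; apply/wmonomialsP; split=> [i _|]; first exact: mnm0E.
  exact: weighted_mdeg0.
case e0 : (wmonomials 0 n.+1) => [//|m s].
have := mem_head m s; rewrite -e0 => hm; have m0 := h m hm.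
by case/wmonomialsP: hm; rewrite m0 weighted_mdeg0.
Qed.

(** A monomial either omits the variable j or can be divided by it once: the recursion behind the
    factor 1 / (1 - z^(w j)) of the Hilbert series. *)
Lemma size_wmonomialsS (j : 'I_k) n :
  size (wmonomials j.+1 n) =
  (size (wmonomials j n) + (if w j <= n then size (wmonomials j.+1 (n - w j)) else 0))%N.
Proof.
pose s2 := if (w j <= n)%N then [seq (m + U_(j))%MM | m <- wmonomials j.+1 (n - w j)] else [::].
have -> : (if w j <= n then size (wmonomials j.+1 (n - w j)) else 0)%N = size s2.
  by rewrite /s2; case: ifP; rewrite ?size_map.
rewrite -size_cat; apply: perm_size.
have s2P m : m \in s2 -> (0 < m j)%N.
  by rewrite /s2; case: ifP => // _ /mapP[m' _ ->]; rewrite mnmDE mnm1E eqxx addn1.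
apply: uniq_perm; first exact: wmonomials_uniq.
  rewrite cat_uniq wmonomials_uniq /=; apply/andP; split.
    apply/hasPn => m /s2P; apply: contraTN => /wmonomialsP[h _].
    by rewrite (h j (leqnn j)).
  rewrite /s2; case: ifP => // _; rewrite map_inj_uniq ?wmonomials_uniq //.
  exact: addIm.
move=> m; rewrite mem_cat; apply/idP/orP.
  case/wmonomialsP => h e0; have [m0|] := posnP (m j); [left|move=> mj; right].
    apply/wmonomialsP; split=> // i; rewrite leq_eqVlt => /orP[/eqP ji|]; last exact: h.
    by rewrite -m0; congr (m _); apply: val_inj.
  have em : m = (m - U_(j) + U_(j))%MM.
    by rewrite submK //; apply/mnm_lepP => i; rewrite mnm1E; case: eqP => [<-|].
  have en : n = (wd (m - U_(j))%MM + w j)%N by rewrite -e0 {1}em weighted_mdegD weighted_mdegU.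
  rewrite /s2 {1}en leq_addl; apply/mapP; exists (m - U_(j))%MM => //.
  apply/wmonomialsP; split; last by rewrite en addnK.
  by move=> i ji; rewrite mnmBE h.
case=> [/wmonomialsP[h e0]|].
  by apply/wmonomialsP; split=> // i ji; apply: h; apply: ltnW.
rewrite /s2; case: ifP => // le /mapP[m' /wmonomialsP[h e0] ->].
apply/wmonomialsP; split.
  move=> i ji; rewrite mnmDE h // mnm1E; case: eqP => // ei; by rewrite ei ltnn in ji.
by rewrite weighted_mdegD weighted_mdegU e0 subnK.
Qed.

Lemma wmonomials_expand (F : fieldType) n (P : {mpoly F[k]}) : P \is n.-homog for wd ->
  P = \sum_(i < size (wmonomials k n))
        P@_(nth 0%MM (wmonomials k n) i) *: 'X_[nth 0%MM (wmonomials k n) i].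
Proof.
move=> /dhomogP h; rewrite -(big_mkord predT (fun i => P@_(nth 0%MM (wmonomials k n) i) *: 'X_[nth 0%MM (wmonomials k n) i])).
rewrite -(big_nth 0%MM predT (fun m => P@_m *: 'X_[m])).
apply/mpolyP => m; rewrite raddf_sum /=.
under eq_bigr => m' _ do rewrite mcoeffZ mcoeffX.
have [hm|hm] := boolP (m \in wmonomials k n).
  rewrite (bigD1_seq m) ?wmonomials_uniq //= eqxx mulr1 big1 ?addr0 // => m' ne.
  by rewrite (negPf ne) mulr0.
rewrite big_seq big1 => [|m' hm']; last first.
  by case: eqP hm => [<-|]; rewrite ?hm' ?mulr0.
apply/eqP; apply: contraR hm => nz; apply/wmonomialsP; split=> [i|].
  by rewrite leqNgt ltn_ord.
by apply: h; rewrite mcoeff_msupp.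
Qed.
End WeightedMonomials.

(** * The field with q elements and its Frobenius map *)

Section Main.
Variables (p expo q : nat) (K : finFieldType) (delta : K).
Hypotheses (pp : prime p) (po : odd p) (qE : q = (p ^ expo)%N) (Kq : #|K| = q).
Hypothesis hd : forall x : K, x ^+ 2 + delta != 0.
Local Notation T := {mpoly K[3]}.
Local Notation a := (va K).
Local Notation b := (vb K).
Local Notation c := (vc K).
Implicit Types (f g : T) (N P s : 'M[K]_2) (t k : K).

Lemma pcharK : p \in [pchar K].
Proof. by apply: card_finPcharP pp; rewrite Kq qE. Qed.

Lemma two0 : 2%:R != 0 :> K.
Proof.
rewrite -(dvdn_pcharf pcharK) dvdn_prime2 //.
by apply: contraTneq po => ->.
Qed.

Lemma oddK : odd #|K|.
Proof. by rewrite Kq qE oddX po orbT. Qed.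

Lemma oddq : odd q. Proof. by rewrite -Kq oddK. Qed.

Lemma q_half : q = (q./2.*2).+1.
Proof. by rewrite -[LHS]odd_double_half oddq. Qed.

Lemma q_gt1 : (1 < q)%N. Proof. by rewrite -Kq finNzRing_gt1. Qed.

Lemma pcharT : p \in [pchar T].
Proof.
rewrite inE pp /= -(rmorph_nat (@mpolyC 3 K)).
by have := pcharK; rewrite inE => /andP[_ /eqP ->]; rewrite rmorph0.
Qed.

Lemma pnat_q : [pchar T].-nat q.
Proof. by rewrite (eq_pnat _ (pcharf_eq pcharT)) qE pnatX pnat_id ?orbT. Qed.

Lemma frobD f g : (f + g) ^+ q = f ^+ q + g ^+ q.
Proof. exact: exprDn_pchar pnat_q. Qed.
Lemma frobN f : (- f) ^+ q = - f ^+ q.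
Proof. exact: exprNn_pchar pnat_q. Qed.
Lemma frobK k : k ^+ q = k. Proof. by rewrite -Kq expf_card. Qed.
Lemma frobC k : (k%:MP : T) ^+ q = k%:MP.
Proof. by rewrite -rmorphXn /= frobK. Qed.

Lemma nonsquare_opp_delta : ~~ is_square (- delta).
Proof.
by apply/is_squareP => -[r er]; case/eqP: (hd r); rewrite -er addNr.
Qed.

Lemma delta0 : delta != 0.
Proof. by have := hd 0; rewrite expr0n add0r. Qed.

(** * Quadratic orbits and the square root *)

(** The form of this matrix is the factor of [f4_tilde] for A = x.1, B = x.2. All of [orb delta] is
    reached, since a zero lower left entry would make some A^2 + delta vanish. *)
Definition orb_param (x : K * K) : 'M[K]_2 :=
  mx2 x.1 (- ((x.1 ^+ 2 + delta) / x.2)) x.2 (- x.1).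

Lemma orb_param_inj : injective orb_param.
Proof. by move=> [A B] [A' B'] /mx2_inj /= [-> _ -> _]. Qed.

Lemma orb_deltaE : orb delta = [set orb_param x | x in setX [set: K] [set~ 0]].
Proof.
apply/setP => N; apply/orbP/imsetP => [[tN dN]|[[A B]]].
  have [x [y [z eN]]] := traceless_mx2 tN; move: dN; rewrite eN mx2_det => dN.
  have z0 : z != 0.
    by apply: contra_neq (hd x) => z0; rewrite -dN z0; ring.
  exists (x, z); first by rewrite in_setX in_setT !inE.
  by rewrite /orb_param /=; congr mx2; rewrite -dN; field.
rewrite in_setX in_setT !inE /= => B0 ->; rewrite mx2_tr subrr mx2_det; split=> //=.
by field.
Qed.

Lemma f4_tildeE : f4_tilde delta = - \prod_(N in orb delta) trf N.
Proof.
rewrite orb_deltaE big_imset /=; last by move=> x y _ _; apply: orb_param_inj.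
rewrite /f4_tilde pair_big_dep /=; congr (- _); apply: eq_big => [[A B]|[A B] /= B0].
  by rewrite in_setX in_setT !inE.
rewrite /trf /orb_param !mxE /= -!mul_mpolyC; congr (_ * _ + _ + _).
  by congr mpolyC; ring.
by rewrite -mulNr rmorphN.
Qed.

Lemma card_orb_delta : #|orb delta| = (q * (q - 1))%N.
Proof.
rewrite orb_deltaE card_imset; last exact: orb_param_inj.
by rewrite cardsX cardsT cardsC1 Kq subn1.
Qed.

Definition orb1_param (x : K * K) : 'M[K]_2 :=
  mx2 x.1 x.2 ((1 - x.1 ^+ 2) / x.2) (- x.1).
Definition orb1_param' (x : bool * K) : 'M[K]_2 :=
  mx2 ((-1) ^+ x.1) 0 x.2 (- (-1) ^+ x.1).

(** Unlike for delta, the equation x^2 + yz = 1 has solutions with y = 0, namely x = 1 or -1 and z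
    arbitrary; the count is q(q - 1) + 2q. *)
Lemma card_orb_opp1 : #|orb (-1 : K)| = (q * (q + 1))%N.
Proof.
have -> : orb (-1) = [set orb1_param x | x in setX [set: K] [set~ 0]] :|:
    [set orb1_param' x | x in setX [set: bool] [set: K]].
  apply/setP => N; rewrite in_setU; apply/orbP/orP => [[tN]|].
    have [x [y [z ->]]] := traceless_mx2 tN; rewrite mx2_det => dN.
    have [y0|y0] := eqVneq y 0; [right|left]; apply/imsetP.
      have /eqP : x ^+ 2 = 1 by rewrite -[1]opprK -dN y0; ring.
      rewrite -[1](expr1n _ 2) eqf_sqr => /orP[] /eqP ->; [exists (false, z)|exists (true, z)];
        by rewrite ?in_setX ?in_setT // /orb1_param' /= y0 ?expr0 ?expr1.
    exists (x, y); first by rewrite in_setX in_setT !inE.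
    rewrite /orb1_param /=; congr mx2; apply: (mulIf y0); rewrite divfK //.
    by rewrite mulrC -[1]opprK -dN; ring.
  case=> /imsetP[[x y]].
    rewrite in_setX in_setT !inE /= => y0 ->; rewrite mx2_tr subrr mx2_det; split=> //=.
    by field.
  move=> _ ->; rewrite mx2_tr subrr mx2_det /= mul0r subr0 mulrN -expr2 sqrr_sign.
  by split.
rewrite cardsU disjoint_setI0 ?cards0 ?subn0; last first.
  rewrite disjoints_subset; apply/subsetP => N /imsetP[[x y]].
  rewrite in_setX in_setT !inE /= => y0 ->; apply/imsetP => -[[x' y'] _] /mx2_inj[_ /= e2 _ _].
  by case/eqP: y0.
rewrite card_in_imset; last first.
  by move=> [x y] [x' y'] _ _ /mx2_inj[/= e1 e2 _ _]; rewrite e1 e2.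
rewrite card_in_imset; last first.
  move=> [x y] [x' y'] _ _ /mx2_inj[/= ex _ e3 _]; rewrite e3; congr (_, _).
  case: x x' ex => [] [] //=; rewrite expr0 expr1 => /eqP; first by rewrite eq_sym (negPf (opp_neq two0 (oner_neq0 _))).
  by rewrite (negPf (opp_neq two0 (oner_neq0 _))).
rewrite !cardsX !cardsT card_bool cardsC1 Kq.
by have := q_gt1; nia.
Qed.

Lemma card_half_delta : #|halforb delta| = (q * q./2)%N.
Proof.
have := card_orb two0 delta0; rewrite card_orb_delta => /esym h.
apply: double_inj; rewrite h; have := q_half; move: (q./2) => m ->.
by nia.
Qed.

Lemma card_half_opp1 : #|halforb (-1 : K)| = (q * (q./2).+1)%N.
Proof.
have o0 : (-1 : K) != 0 by rewrite oppr_eq0 oner_eq0.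
have := card_orb two0 o0; rewrite card_orb_opp1 => /esym h.
apply: double_inj; rewrite h; have := q_half; move: (q./2) => m ->.
by nia.
Qed.

Definition S0 : T := half_prod delta.

(** If -1 is a square, every sign is. Otherwise (-1)^((q-1)/2) = -1 by Euler's criterion, and the
    number of factors q(q - 1)/2 has the parity of (q - 1)/2, so the right-hand side is 1. *)
Lemma sqrt_sign : exists2 r : K, r != 0 & r ^+ 2 = - (-1) ^+ #|halforb delta|.
Proof.
have [r h] : exists r : K, r ^+ 2 = - (-1) ^+ #|halforb delta|.
  rewrite card_half_delta -signr_odd oddM oddq /= signr_odd.
  have [/is_squareP[r er]|ns] := boolP (is_square (-1 : K)).
    rewrite -signr_odd; case: (odd _); rewrite ?expr0 ?expr1; last by exists r.
    by exists 1; rewrite expr1n opprK.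
  have := nonsquare_euler two0 oddK ns; rewrite Kq => ->.
  by exists 1; rewrite expr1n opprK.
exists r => //; apply/negP => /eqP r0; move/eqP: h.
by rewrite r0 expr0n /= eq_sym oppr_eq0 signr_eq0.
Qed.

Lemma f4_tilde_S0 : f4_tilde delta = - (-1) ^+ #|halforb delta| * S0 ^+ 2.
Proof. by rewrite f4_tildeE (orb_half_prod two0 delta0) mulNr. Qed.

Lemma sqrt_f4 : exists s : T, s ^+ 2 = f4_tilde delta.
Proof.
have [r _ h] := sqrt_sign; exists (r%:MP * S0).
by rewrite f4_tilde_S0 exprMn -rmorphXn /= h rmorphN rmorphXn rmorphN rmorph1.
Qed.

(** T is a domain, so a square root is determined up to sign; it suffices to work with [S0] and to
    rescale at the end. *)
Lemma sqrt_f4_unique (s : T) : s ^+ 2 = f4_tilde delta ->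
  exists2 r, r != 0 & s = r%:MP * S0.
Proof.
have [r r0 h] := sqrt_sign.
have -> : f4_tilde delta = (r%:MP * S0) ^+ 2.
  by rewrite f4_tilde_S0 exprMn -rmorphXn /= h rmorphN rmorphXn rmorphN rmorph1.
move=> /eqP; rewrite eqf_sqr => /orP[] /eqP ->; first by exists r.
by exists (- r); rewrite ?oppr_eq0 // rmorphN mulNr.
Qed.

#[local] Hint Resolve two0 oddK oddq q_gt1 delta0 : core.

(** * The invariants u, v, w and the orbit products *)

Definition u_ : T := det_form K.
Definition v_ : T := steenrod1_det K q.
(* Up to sign, w is a square modulo each form of S0: it vanishes at the K-points where
   det is not a square. *)
Definition w_ : T := v_ + 2%:R * u_ ^+ (q./2).+1.

Lemma v_E : v_ = - (2%:R * (a ^+ q * a)) - b ^+ q * c - b * c ^+ q.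
Proof. by rewrite /v_ /steenrod1_det exprSr mulr_natl. Qed.

Lemma G_inv_u : G_inv u_.
Proof.
apply: G_inv_gen => t; rewrite /u_ /det_form rmorphB rmorphN rmorphXn rmorphM /= !elemE;
  ring.
Qed.

Lemma G_inv_v : G_inv v_.
Proof.
apply: G_inv_gen => t; rewrite v_E !(rmorphB (conj_act _)) rmorphN /=
  !(rmorphM (conj_act _)) /= rmorph_nat !(rmorphXn (conj_act _)) /= !elemE;
  rewrite ?frobD ?frobN ?exprMn ?frobC ?frobD ?frobN ?exprMn ?frobC; ring.
Qed.

Lemma tau_u : tau u_ = u_.
Proof. by rewrite /u_ /det_form rmorphB rmorphN rmorphXn rmorphM /= !tauE sqrrN. Qed.

Lemma tau_v : tau v_ = v_.
Proof.
rewrite v_E !(rmorphB (@tau K)) rmorphN /= !(rmorphM (@tau K)) /= rmorph_nat !(rmorphXn (@tau K)) /= !tauE.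
by rewrite frobN mulrNN.
Qed.

Definition H_inv f := G_inv f /\ tau f = f.

Lemma H_invD f g : H_inv f -> H_inv g -> H_inv (f + g).
Proof.
by move=> [f1 f2] [g1 g2]; split=> [s ds|]; rewrite rmorphD /= ?f2 ?g2 // f1 ?g1.
Qed.
Lemma H_invM f g : H_inv f -> H_inv g -> H_inv (f * g).
Proof.
by move=> [f1 f2] [g1 g2]; split=> [s ds|]; rewrite rmorphM /= ?f2 ?g2 // f1 ?g1.
Qed.
Lemma H_invC k : H_inv k%:MP.
Proof. by split=> [s ds|]; rewrite ?conj_actC ?tauC. Qed.
Lemma H_invN f : H_inv f -> H_inv (- f).
Proof. by move=> [f1 f2]; split=> [s ds|]; rewrite rmorphN /= ?f2 // f1. Qed.
Lemma H_invB f g : H_inv f -> H_inv g -> H_inv (f - g).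
Proof. by move=> hf hg; apply/H_invD/H_invN. Qed.
Lemma H_invX f n : H_inv f -> H_inv (f ^+ n).
Proof.
move=> hf; elim: n => [|n IH]; first by rewrite expr0 -(rmorph1 (@mpolyC 3 K)); apply: H_invC.
by rewrite exprS; apply: H_invM.
Qed.
Lemma H_inv_div f g : f != 0 -> H_inv f -> H_inv (f * g) -> H_inv g.
Proof.
move=> f0 [f1 f2] [g1 g2]; split=> [s ds|]; apply: (mulfI f0).
  by rewrite -{1}(f1 s ds) -rmorphM /= g1.
by rewrite -{1}f2 -rmorphM /= g2.
Qed.

Lemma H_inv_u : H_inv u_. Proof. by split; [exact: G_inv_u|exact: tau_u]. Qed.
Lemma H_inv_v : H_inv v_. Proof. by split; [exact: G_inv_v|exact: tau_v]. Qed.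
Lemma H_inv_w : H_inv w_.
Proof.
apply: H_invD; first exact: H_inv_v.
by apply: H_invM; [rewrite -(rmorph_nat (@mpolyC 3 K)); apply: H_invC
                  |apply/H_invX/H_inv_u].
Qed.

Lemma var_dhomog i : ('X_i : T) \is 1.-homog.
Proof. by rewrite dhomogX /= mdeg1. Qed.

Lemma var_exp_dhomog i n : ('X_i ^+ n : T) \is n.-homog.
Proof. by have := dhomogMn n (var_dhomog i); rewrite mul1n. Qed.

Lemma u_dhomog : u_ \is 2.-homog.
Proof.
apply: rpredB; first by rewrite rpredN; apply: var_exp_dhomog.
by apply: (dhomogM (var_dhomog _) (var_dhomog _)).
Qed.

Lemma v_dhomog : v_ \is q.+1.-homog.
Proof.
rewrite /v_ /steenrod1_det; apply: rpredB; last first.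
  by have := dhomogM (var_dhomog 1) (var_exp_dhomog 2%:R q); rewrite add1n.
apply: rpredB; last first.
  by have := dhomogM (var_exp_dhomog 1 q) (var_dhomog 2%:R); rewrite addn1.
by rewrite rpredN; apply: rpredMn; apply: var_exp_dhomog.
Qed.

Lemma w_dhomog : w_ \is q.+1.-homog.
Proof.
apply: rpredD; first exact: v_dhomog.
have e2 : q.+1 = (2 * (q./2).+1)%N by rewrite {1}q_half mul2n.
by rewrite mulr_natl; apply: rpredMn; rewrite e2; apply: (dhomogMn _ u_dhomog).
Qed.

Lemma meval_var P : (a.@[pt P] = P 0 0) * (b.@[pt P] = P 0 1) * (c.@[pt P] = P 1 0).
Proof. by rewrite !mevalXU. Qed.

Lemma meval_u P : \tr P = 0 -> u_.@[pt P] = \det P.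
Proof.
move=> /traceless_mx2 [x [y [z ->]]]; rewrite mx2_det /u_ /det_form mevalB mevalN rmorphXn /=.
by rewrite mevalM !meval_var !mxE /=; ring.
Qed.

Lemma meval_v P : \tr P = 0 -> v_.@[pt P] = 2%:R * \det P.
Proof.
move=> /traceless_mx2 [x [y [z ->]]]; rewrite mx2_det v_E !mevalB mevalN !mevalM.
by rewrite rmorph_nat !rmorphXn /= !meval_var !mxE /= !frobK; ring.
Qed.

Lemma meval_w P : \tr P = 0 ->
  w_.@[pt P] = 2%:R * (\det P + \det P ^+ (q./2).+1).
Proof.
move=> tP; rewrite /w_ mevalD meval_v // mevalM rmorphXn /= meval_u //.
by rewrite -(rmorph_nat (@mpolyC 3 K)) mevalC mulrDr.
Qed.

Lemma trf_orb_prod_conj s k : s \in unitmx ->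
  conj_act s (\prod_(N in orb k) trf N) = \prod_(N in orb k) trf N.
Proof.
move=> su; rewrite rmorph_prod /=.
under eq_bigr => N _ do rewrite (conj_act_trf N su).
have h : injective (fun N : 'M[K]_2 => invmx s *m N *m s).
  move=> N N' /(congr1 (fun X => s *m X *m invmx s)).
  by rewrite !mulmxA mulmxV // !mul1mx !mulmxK.
rewrite (reindex_inj h) /=; apply: eq_big => [N|N _].
  rewrite !inE mxtrace_mulC mulmxA mulmxV // mul1mx !det_mulmx det_inv.
  by rewrite mulrAC mulVf ?mul1r // -unitfE -unitmxE.
by rewrite !mulmxA mulmxV // mul1mx mulmxK.
Qed.

Lemma conj_half_prod s k : k != 0 -> s \in unitmx ->
  conj_act s (half_prod k) = half_prod k \/ conj_act s (half_prod k) = - half_prod k.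
Proof.
move=> k0 su; have := trf_orb_prod_conj k su.
rewrite (orb_half_prod two0 k0) rmorphM rmorph_sign rmorphXn /=.
move/(mulfI _); rewrite signr_eq0 => /(_ isT) /eqP.
by rewrite eqf_sqr => /orP[] /eqP; [left|right].
Qed.

Lemma conj_half_prod_sq s k : k != 0 -> s \in unitmx ->
  conj_act (s *m s) (half_prod k) = half_prod k.
Proof.
move=> k0 su; rewrite -(conj_actM _ su su).
by case: (conj_half_prod k0 su) => h; rewrite !h // rmorphN /= h opprK.
Qed.

(** The product is fixed up to sign, and the sign disappears on squares. Elementary matrices are
    squares because t can be halved. *)
Lemma G_inv_half_prod k : k != 0 -> G_inv (half_prod k).
Proof.
move=> k0; apply: G_inv_gen => t.
  have -> : upper t = upper (t / 2%:R) *m upper (t / 2%:R).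
    by rewrite upperD; congr upper; field; rewrite two0.
  by apply: conj_half_prod_sq => //; apply: det1_unit (det_upper _).
have -> : lower t = lower (t / 2%:R) *m lower (t / 2%:R).
  by rewrite lowerD; congr lower; field; rewrite two0.
by apply: conj_half_prod_sq => //; apply: det1_unit (det_lower _).
Qed.

Lemma tau_congr f : divides a (f - tau f).
Proof.
rewrite -[X in X - _]comp_mpoly_id; apply: comp_mpoly_congr; first exact: divides_ideal.
apply: forall_ord3; rewrite (tnth_mktuple _ _) (tnth_nth 0) /= ?subrr;
  try exact: divides0.
by rewrite opprK; apply: dividesD; apply: divides_refl.
Qed.

Lemma trf_refl1 : trf (refl1 K) = 2%:R%:MP * a.
Proof. by rewrite /trf /refl1 !mxE /= rmorph0 !mul0r !addr0 opprK. Qed.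

Lemma tau_orb_prod k : k != 0 ->
  tau (\prod_(N in orb k) trf N) = \prod_(N in orb k) trf N.
Proof.
move=> k0; rewrite tau_iota (trf_orb_prod_conj k (refl1_unit K)).
rewrite (dhomog_iota (d := #|orb k|)); last first.
  by apply: dhomog_prod_set => N _; apply: trf_dhomog.
by rewrite (card_orb two0 k0) -signr_odd odd_double mul1r.
Qed.

(** With the sign -1, the form a would divide S0, because [tau] is the identity on a = 0. Some N of
    determinant delta would then be k times [refl1], so that delta = -k^2. *)
Lemma tau_S0 : tau S0 = S0.
Proof.
have := tau_orb_prod delta0.
rewrite (orb_half_prod two0 delta0) rmorphM rmorph_sign rmorphXn /=.
move/(mulfI _); rewrite signr_eq0 => /(_ isT) /eqP.
rewrite eqf_sqr => /orP[] /eqP //; rewrite -/S0 => h.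
have /associated_sym/associated_divides ha : associated a (trf (refl1 K)).
  exists 2%:R%:MP; last exact: trf_refl1.
  by rewrite rmorph_unit // unitfE two0.
have r0 : (refl1 K) != 0.
  by apply/eqP => /matrixP/(_ 0 0); rewrite !mxE /= => /eqP; rewrite oner_eq0.
have tr : \tr (refl1 K) = 0 by rewrite mx2_tr subrr.
have aP : prime_elt (trf (refl1 K)) by apply: trf_prime.
have : divides (trf (refl1 K)) S0.
  have := tau_congr S0; rewrite h opprK => /(divides_trans ha).
  rewrite -mulr2n -mulr_natl => h2; have -> : S0 = (2%:R^-1)%:MP * (2%:R * S0).
    by rewrite mulrA -(rmorph_nat (@mpolyC 3 K)) -rmorphM mulVf ?two0 // rmorph1 mul1r.
  exact: divides_mull.
rewrite /S0 /half_prod -big_enum -(big_map _ xpredT id) => /(prime_divides_prod aP).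
case=> x /mapP[N]; rewrite mem_enum => /half_sub /orbP[tN dN] ->.
case/(trf_divides_trf two0 tr tN r0) => k ek; case/eqP: (hd k).
by rewrite -dN ek det_mx2Z det_refl1 mulrN1 subrr.
Qed.

(** The product of g with the component of k of degree j has degree i + j, so only j = d - i
    contributes to f. *)
Lemma dhomog_quotient n (mf : measure n) d i (f g k : {mpoly K[n]}) :
  f \is d.-homog for mf -> g \is i.-homog for mf -> f = g * k -> f != 0 ->
  (i <= d)%N /\ k \is (d - i).-homog for mf.
Proof.
move=> hf hg e f0; have g0 : g != 0 by apply: contraNneq f0 => g0; rewrite e g0 mul0r.
pose l := mmeasure mf k.
have ek := pihomog_partitionE (leqnn l).
have hgk j : pihomog mf d (g * pihomog mf j k) = if (i + j == d)%N then g * pihomog mf j k else 0.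
  have h := dhomogM hg (pihomogP mf j k).
  case: eqP => [<-|/eqP ne]; first exact: pihomog_dE.
  exact: pihomog_ne0 ne h.
have ef : f = \sum_(j < l) if (i + j == d)%N then g * pihomog mf j k else 0.
  rewrite -{1}(pihomog_dE hf) {1}e [in X in pihomog _ _ (_ * X)]ek mulr_sumr linear_sum /=.
  by apply: eq_bigr => j _; apply: hgk.
have id : (i <= d)%N.
  rewrite leqNgt; apply: contraNN f0 => lt; rewrite ef big1 // => j _.
  by rewrite gtn_eqF // ltn_addr.
split=> //; suff -> : k = pihomog mf (d - i) k by apply: pihomogP.
apply: (mulfI g0); rewrite -e ef.
have [lt|ge] := ltnP (d - i) l.
  rewrite (bigD1 (Ordinal lt)) //= subnKC // eqxx big1 ?addr0 // => j ne.
  by case: eqP => // h; case/eqP: ne; apply: val_inj => /=; rewrite -h addKn.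
have -> : pihomog mf (d - i) k = 0.
  rewrite pihomogE big_seq_cond big1 // => m /andP[mk /eqP hm].
  by have := mmeasure_mnm_lt mf mk; rewrite hm ltnNge ge.
rewrite mulr0 big1 // => j _; case: eqP => // h.
by have := ltn_ord j; rewrite ltnNge => /negP[]; apply: leq_trans ge _; rewrite -h addKn.
Qed.

Lemma dhomog0_const n (f : {mpoly K[n]}) : f \is 0.-homog -> f = (f@_0)%:MP.
Proof.
move=> /dhomogP h; apply: msize1_polyC; rewrite msizeE.
apply/bigmax_leqP_seq => m mf _; by rewrite h.
Qed.

Lemma dhomog_divides_const d i (f g : T) :
  f \is d.-homog -> g \is i.-homog -> (d <= i)%N -> f != 0 -> divides g f ->
  exists2 r, r != 0 & f = r%:MP * g.
Proof.
move=> hf hg di f0 [k e]; have e' := e; rewrite mulrC in e'.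
have [id hk] := dhomog_quotient hf hg e' f0.
move: hk; have -> : (d - i = 0)%N by apply/eqP; rewrite subn_eq0.
move/dhomog0_const => ek; exists k@_0; last by rewrite -ek.
by apply: contraNneq f0 => k0; rewrite e ek k0 rmorph0 mul0r.
Qed.

Lemma dhomog_line d f (x y z : K) (mu : T) : f \is d.-homog ->
  f \mPo [tuple x%:MP * mu; y%:MP * mu; z%:MP * mu] =
  (f.@[tnth [tuple x; y; z]])%:MP * mu ^+ d.
Proof.
move=> /dhomogP h; rewrite comp_mpolyE mevalE rmorph_sum mulr_suml.
apply: eq_big_seq => m /h <-; rewrite rmorphM -mul_mpolyC -mulrA; congr (_ * _).
have -> : mu ^+ mdeg m = \prod_i mu ^+ m i by rewrite prodrXr -mdegE.
rewrite rmorph_prod -big_split /=; apply: eq_bigr => i _.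
rewrite rmorphXn -exprMn; congr (_ ^+ _); move: i.
by apply: forall_ord3; rewrite !(tnth_nth 0).
Qed.

Lemma meval_iota f P : \tr P = 0 -> (iota_neg f).@[pt P] = f.@[pt (- P)].
Proof.
move=> tP; have tP' : \tr (- P) = 0 by rewrite linearN /= tP oppr0.
have h N : (meval (pt P) \o @iota_neg K) (trf N) = meval (pt (- P)) (trf N).
  by rewrite /= iota_trf mevalN !meval_trf // mulmxN linearN.
apply: (@mpoly3_morph_eq _ _ (meval (pt P) \o @iota_neg K) (meval (pt (- P)))) => [k|||].
- by rewrite /= iotaC !mevalC.
- by rewrite trf_a; apply: h.
- by rewrite trf_b; apply: h.
- by rewrite trf_c; apply: h.
Qed.

Lemma even_iota d f : ~~ odd d -> f \is d.-homog -> iota_neg f = f.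
Proof. by move=> /negPf od /dhomog_iota ->; rewrite -signr_odd od mul1r. Qed.

Lemma H_inv_refl1 d f : ~~ odd d -> f \is d.-homog -> H_inv f ->
  conj_act (refl1 K) f = f.
Proof.
move=> od hd' [_ h]; rewrite -{1}(even_iota od hd') -(iota_conj f (refl1_unit K)).
by rewrite -tau_iota h.
Qed.

(** Scalars act trivially, and in even degree the sign that separates [tau] from conjugation by
    [refl1], of determinant -1, is invisible. *)
Lemma H_inv_conj d f s r : ~~ odd d -> f \is d.-homog -> H_inv f -> r != 0 ->
  \det s = r ^+ 2 \/ \det s = - r ^+ 2 -> conj_act s f = f.
Proof.
move=> od hf Hf r0.
have pos s' : \det s' = r ^+ 2 -> conj_act s' f = f.
  move=> ds'; have su : s' \in unitmx by rewrite unitmxE ds' unitfE expf_neq0.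
  have r1 : r^-1 != 0 by rewrite invr_eq0.
  rewrite -(conj_act_scale f r1 su); apply: Hf.1.
  by rewrite det_mx2Z ds' exprVn mulVf // expf_neq0.
case=> [|ds]; first exact: pos.
have su : s \in unitmx by rewrite unitmxE ds unitrN unitfE expf_neq0.
rewrite -{1}(H_inv_refl1 od hf Hf) (conj_actM f su (refl1_unit K)); apply: pos.
by rewrite det_mulmx ds det_refl1 mulrN1 opprK.
Qed.

(** * Restriction to a plane on which the determinant is anisotropic *)

(** The plane is b = delta c. There det is -(a^2 + delta c^2), anisotropic because -delta is not a
    square. *)
Definition N0 : 'M[K]_2 := mx2 0 (- delta) 1 0.
Definition P0 : 'M[K]_2 := mx2 0 delta 1 0.
Definition restr f : T := elim_form N0 (mx2 0 1 0 0) f.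

Lemma restr_zmod : zmod_morphism restr.
Proof. by move=> f g; rewrite /restr rmorphB. Qed.
Lemma restr_monoid : monoid_morphism restr.
Proof. by split=> [|f g]; rewrite /restr ?rmorph1 ?rmorphM. Qed.
HB.instance Definition _ := GRing.isZmodMorphism.Build T T restr restr_zmod.
HB.instance Definition _ := GRing.isMonoidMorphism.Build T T restr restr_monoid.

Lemma tr_N0 : \tr N0 = 0. Proof. by rewrite mx2_tr addr0. Qed.
Lemma N0_neq0 : N0 != 0.
Proof. by apply/eqP => /matrixP/(_ 1 0); rewrite !mxE /= => /eqP; rewrite oner_eq0. Qed.
Lemma N0_orb : N0 \in orb delta.
Proof. by apply/orbP; rewrite tr_N0 mx2_det; split=> //; ring. Qed.
Lemma restr_divides f : divides (trf N0) f <-> restr f = 0.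
Proof.
by apply: elim_divides; rewrite ?mx2_tr ?addr0 // mx2M mx2_tr; ring.
Qed.

Lemma restr_congr f : divides (trf N0) (f - restr f).
Proof. exact: elim_congr. Qed.

Lemma restr_eq f g : divides (trf N0) (f - g) -> restr f = restr g.
Proof. by move=> /restr_divides; rewrite /restr rmorphB => /eqP; rewrite subr_eq0 => /eqP. Qed.

Lemma restr_trf N : restr (trf N) = trf (N - N 1 0 *: N0).
Proof.
rewrite /restr elim_trf ?mx2_tr ?addr0 // trfD -scaleNr trfZ rmorphN mulNr.
congr (_ - _%:MP * _); rewrite [N in LHS]mx2E mx2M mx2_tr; ring.
Qed.

Lemma restrE : (restr a = a) * (restr b = delta%:MP * c) * (restr c = c).
Proof.
by rewrite /restr !elimE !mxE /= /trf !mxE /= !rmorph0 !rmorphN !rmorph1; do !split; ring.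
Qed.

Lemma restr_idem f : restr (restr f) = restr f.
Proof. exact/esym/restr_eq/restr_congr. Qed.

Lemma restr_comp f : restr f = f \mPo [tuple a; delta%:MP * c; c].
Proof.
apply: (@mpoly3_morph_eq _ _ (elim_form N0 (mx2 0 1 0 0)) (comp_mpoly [tuple a; delta%:MP * c; c])).
- by move=> k /=; rewrite elimC comp_mpolyC.
- by rewrite /= -/(restr a) restrE comp_a.
- by rewrite /= -/(restr b) restrE comp_b.
- by rewrite /= -/(restr c) restrE comp_c.
Qed.

Lemma dhomog_comp d f (t : 3.-tuple T) :
  (forall i, tnth t i \is 1.-homog) -> f \is d.-homog -> f \mPo t \is d.-homog.
Proof.
move=> ht /dhomogP h; rewrite comp_mpolyE big_seq; apply: rpred_sum => m /h <-.
apply: rpredZ; suff : \prod_(i < 3) tnth t i ^+ m i \is (\sum_(i < 3) m i)%N.-homog.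
  by rewrite -mdegE.
elim/big_rec2: _ => [|i x y _ hy]; first exact: dhomog1.
by apply: dhomogM hy; have := dhomogMn (m i) (ht i); rewrite mul1n.
Qed.

Lemma restr_dhomog d f : f \is d.-homog -> restr f \is d.-homog.
Proof.
move=> hf; rewrite restr_comp; apply: dhomog_comp hf; apply: forall_ord3.
- exact: var_dhomog.
- by rewrite (tnth_nth 0) /= mul_mpolyC rpredZ // var_dhomog.
- exact: var_dhomog.
Qed.

(** The determinant -delta is a nonsquare, so w vanishes at these points. *)
Definition plane_pts : {set 'M[K]_2} := [set P in orb (- delta) | P 0 1 == delta * P 1 0].

Lemma plane_ptsP P : reflect
  (exists x z, P = mx2 x (delta * z) z (- x) /\ x ^+ 2 + delta * z ^+ 2 = delta)
  (P \in plane_pts).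
Proof.
rewrite inE; apply: (iffP andP) => [[/orbP[/traceless_mx2 [x [y [z ->]]]]]|[x [z [-> h]]]].
  rewrite mx2_det !mxE /= => dP /eqP ey; exists x, z; rewrite ey; split=> //.
  by apply: oppr_inj; rewrite -dP ey; ring.
split; last by rewrite !mxE /=.
apply/orbP; rewrite mx2_tr subrr mx2_det; split=> //.
by transitivity (- (x ^+ 2 + delta * z ^+ 2)); [ring|rewrite h].
Qed.

Lemma plane_tr P : P \in plane_pts -> \tr P = 0.
Proof. by rewrite inE => /andP[/orbP[]]. Qed.
Lemma plane_det P : P \in plane_pts -> \det P = - delta.
Proof. by rewrite inE => /andP[/orbP[]]. Qed.
Lemma oppd0 : - delta != 0. Proof. by rewrite oppr_eq0 delta0. Qed.
Lemma plane_neq0 P : P \in plane_pts -> P != 0.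
Proof. by rewrite inE => /andP[/(orb_neq0 oppd0)]. Qed.
Lemma plane_mem P :
  (P \in plane_pts) = (P \in orb (- delta)) && (P 0 1 == delta * P 1 0).
Proof. by rewrite in_set. Qed.
Lemma planeN P : P \in plane_pts -> - P \in plane_pts.
Proof. by rewrite !plane_mem orb_opp !mxE mulrN eqr_opp. Qed.
Lemma P0_plane : P0 \in plane_pts.
Proof.
by apply/plane_ptsP; exists 0, 1; rewrite /P0 oppr0 mulr1; split=> //; ring.
Qed.

(* The conic x^2 + delta z^2 = delta, projected from its point (0, 1). *)
Lemma card_plane_pts : (q.+1 <= #|plane_pts|)%N.
Proof.
pose F t := let D := t ^+ 2 + delta in
  mx2 (- (2%:R * delta * t) / D) (delta * ((t ^+ 2 - delta) / D)) ((t ^+ 2 - delta) / D)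
      (- (- (2%:R * delta * t) / D)).
have injF : injective F.
  move=> t t' /mx2_inj[e1 _ e2 _].
  have D0 := hd t; have D'0 := hd t'.
  have h2 : 2%:R * delta != 0 by rewrite mulf_neq0 ?two0 ?delta0.
  have e3 : (t ^+ 2 + delta)^-1 = (t' ^+ 2 + delta)^-1.
    apply: (mulfI h2).
    have E (y : K) : y ^+ 2 + delta != 0 ->
        2%:R * delta / (y ^+ 2 + delta) = 1 - (y ^+ 2 - delta) / (y ^+ 2 + delta).
      by move=> y0; field.
    by rewrite !E // e2.
  move: e1; rewrite e3 => /(mulIf _); rewrite invr_eq0 => /(_ D'0) /oppr_inj.
  by move/(mulfI h2).
have nP0 : P0 \notin [set F t | t : K].
  apply/imsetP => -[t _ /mx2_inj[_ _ e _]].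
  have : 2%:R * delta = 0.
    have D0 := hd t; have : 1 * (t ^+ 2 + delta) = t ^+ 2 - delta by rewrite e divfK.
    move=> h; transitivity (1 * (t ^+ 2 + delta) - (t ^+ 2 - delta)); first by ring.
    by rewrite h subrr.
  by move/eqP; rewrite mulf_eq0 (negPf two0) (negPf delta0).
have : P0 |: [set F t | t : K] \subset plane_pts.
  apply/subsetP => P; rewrite in_setU1 => /orP[/eqP ->|/imsetP[t _ ->]].
    exact: P0_plane.
  apply/plane_ptsP; exists (- (2%:R * delta * t) / (t ^+ 2 + delta)).
  exists ((t ^+ 2 - delta) / (t ^+ 2 + delta)); split=> //.
  by have D0 := hd t; field.
by move/subset_leq_card; rewrite cardsU1 nP0 card_imset // Kq.
Qed.

(** This makes the degree of [W_] at least that of w, so that divisibility of [restr w_] by [W_]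
    becomes proportionality. *)
Lemma card_half_plane : (q.+1 <= #|halfset plane_pts|.*2)%N.
Proof.
rewrite -(card_halfset two0) ?card_plane_pts // => P hP.
by split; [exact: plane_neq0|exact: planeN].
Qed.

(* The form vanishing at P on the plane. *)
Definition lam P : 'M[K]_2 := mx2 (- P 1 0) (2%:R * P 0 0) 0 (P 1 0).

Lemma lam_tr P : \tr (lam P) = 0. Proof. by rewrite mx2_tr addNr. Qed.

Lemma lam_neq0 P : P \in plane_pts -> lam P != 0.
Proof.
move=> hP; have P0' := plane_neq0 hP; apply: contraNneq P0' => e.
have /plane_ptsP[x [z [eP _]]] := hP; move: e; rewrite eP /lam !mxE /= => e.
have : lam P = mx2 0 0 0 0 by rewrite /lam eP !mxE /= e [LHS]mx2E !mxE.
rewrite /lam eP !mxE /= => /mx2_inj[_ /eqP]; rewrite mulf_eq0 (negPf two0) => /eqP x0 _ z0.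
by apply/eqP; rewrite x0 z0 mulr0 oppr0 [LHS]mx2E [RHS]mx2E !mxE.
Qed.

Lemma restr_lam P : restr (trf (lam P)) = trf (lam P).
Proof. by rewrite restr_trf /lam !mxE /= scale0r subr0. Qed.

Lemma lam_prime P : P \in plane_pts -> prime_elt (trf (lam P)).
Proof. by move=> hP; apply: trf_prime => //; [exact: lam_tr|exact: lam_neq0]. Qed.

Lemma restr_lam_divides d f P : P \in plane_pts -> f \is d.-homog ->
  f.@[pt P] = 0 -> divides (trf (lam P)) (restr f).
Proof.
move=> hP hf fP; have [D tD hD] := dual_point two0 (lam_tr P) (lam_neq0 hP).
apply/(elim_divides _ tD hD).
have /plane_ptsP[x [z [eP _]]] := hP.
(* The coordinate on the line through P: the projection along D replaces (a, c) by (x mu, z mu). *)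
pose mu : T := (2%:R * D 1 0)%:MP * a - (2%:R * D 0 0)%:MP * c.
have hD' : 1 = 2%:R * (x * D 1 0 - z * D 0 0).
  apply/esym; rewrite -[RHS]hD; have [x' [y' [z' ->]]] := traceless_mx2 tD.
  by rewrite eP /lam !mxE /= mx2M mx2_tr; ring.
have hD'' : 1 = 2%:R%:MP * (x%:MP * (D 1 0)%:MP - z%:MP * (D 0 0)%:MP) :> T.
  by rewrite -!rmorphM -rmorphB -rmorphM -hD' rmorph1.
have e1 : elim_form (lam P) D a = x%:MP * mu.
  transitivity (1 * a - (D 0 0)%:MP * trf (lam P)); first by rewrite mul1r elimE.
  by rewrite hD'' eP /mu /trf /lam !mxE /=; ring.
have e2 : elim_form (lam P) D c = z%:MP * mu.
  transitivity (1 * c - (D 1 0)%:MP * trf (lam P)); first by rewrite mul1r elimE.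
  by rewrite hD'' eP /mu /trf /lam !mxE /=; ring.
have -> : elim_form (lam P) D (restr f) = f \mPo [tuple x%:MP * mu; (delta * z)%:MP * mu; z%:MP * mu].
  apply: (@mpoly3_morph_eq _ _ (elim_form (lam P) D \o elim_form N0 (mx2 0 1 0 0))
     (comp_mpoly [tuple x%:MP * mu; (delta * z)%:MP * mu; z%:MP * mu])).
  - by move=> k /=; rewrite !elimC comp_mpolyC.
  - by rewrite /= -/(restr a) restrE e1 comp_a.
  - by rewrite /= -/(restr b) restrE rmorphM /= elimC e2 comp_b rmorphM mulrA.
  - by rewrite /= -/(restr c) restrE e2 comp_c.
rewrite (dhomog_line _ _ _ _ hf).
have -> : f.@[tnth [tuple x; delta * z; z]] = f.@[pt P].
  apply: meval_eq; rewrite /pt eP; apply: forall_ord3; by rewrite !(tnth_nth 0) /= !mxE.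
by rewrite fP rmorph0 mul0r.
Qed.

Definition plane_stab s := exists2 r, r != 0 &
  (\det s = r ^+ 2 \/ \det s = - r ^+ 2) /\
  (s *m N0 *m invmx s = N0 \/ s *m N0 *m invmx s = - N0).

(** Invariance is asked only modulo the equation of the plane. After division by w on the plane, the
    quotient need not be an invariant in T, but it keeps this weaker property, which is all that the
    induction uses. *)
Definition plane_inv g := forall s, plane_stab s -> divides (trf N0) (conj_act s g - g).

Lemma plane_stab_unit s : plane_stab s -> s \in unitmx.
Proof.
by case=> r r0 [[] ds _]; rewrite unitmxE ds ?unitrN unitfE expf_neq0.
Qed.

Lemma plane_inv_H d f : ~~ odd d -> f \is d.-homog -> H_inv f -> plane_inv f.
Proof.
move=> od hf Hf s [r r0 [ds _]]; rewrite (H_inv_conj od hf Hf r0 ds) subrr.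
exact: divides0.
Qed.

Lemma plane_stab_divides s f : plane_stab s ->
  divides (trf N0) f -> divides (trf N0) (conj_act s f).
Proof.
move=> hs [k ->]; have su := plane_stab_unit hs; rewrite rmorphM /= conj_act_trf //.
case: hs => r _ [_ [] ->]; first by exists (conj_act s k).
by rewrite trfN mulrN; apply/dividesN; exists (conj_act s k).
Qed.

Lemma meval_plane f P : P \in plane_pts -> divides (trf N0) f -> f.@[pt P] = 0.
Proof.
move=> hP [k ->]; rewrite mevalM (meval_trf _ (plane_tr hP)).
have /plane_ptsP[x [z [-> _]]] := hP.
by rewrite mx2M mx2_tr (_ : _ + _ = 0) ?mulr0 //; ring.
Qed.

Lemma meval_N0 P : P \in plane_pts -> \tr (N0 *m P) = 0.
Proof.
move=> /plane_ptsP[x [z [-> _]]].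
by rewrite mx2M mx2_tr; ring.
Qed.

Lemma conj_of_comm s (N N' : 'M[K]_2) : s \in unitmx -> s *m N = N' *m s ->
  s *m N *m invmx s = N'.
Proof. by move=> su ->; rewrite mulmxK. Qed.

(* The half-turn about P0 + P and its product with P0 both carry P0 to P, and one of
   their determinants is a square because det P0 is not. *)
Lemma plane_transitive d g P : ~~ odd d -> g \is d.-homog -> plane_inv g ->
  P \in plane_pts -> g.@[pt P] = g.@[pt P0].
Proof.
move=> od hg gi hP.
(* Here P0 + P is zero and defines no half-turn; evenness of the degree replaces it. *)
have [eP|neP] := eqVneq P (- P0).
  by rewrite eP -(meval_iota _ (plane_tr P0_plane)) (even_iota od hg).
suff [s hs e1] : exists2 s, plane_stab s & invmx s *m P *m s = P0.
  have := meval_plane hP (gi s hs).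
  rewrite mevalB (meval_conj_act _ (plane_stab_unit hs) (plane_tr hP)) e1.
  by move/eqP; rewrite subr_eq0 => /eqP.
have /plane_ptsP[x [z [eP h]]] := hP.
have P0u : P0 \in unitmx.
  by rewrite unitmxE (plane_det P0_plane) unitfE oppd0.
pose s := P0 + P.
have sE : s = mx2 x (delta * (1 + z)) (1 + z) (- x).
  by rewrite /s eP mx2D; congr mx2; ring.
have ds : \det s = - (x ^+ 2 + delta * (1 + z) ^+ 2).
  by rewrite sE mx2_det; ring.
(* [s] is a nonzero point of the plane, on which det is anisotropic. *)
have ds0 : \det s != 0.
  rewrite ds oppr_eq0; have [z0|z0] := eqVneq (1 + z) 0.
    rewrite z0 expr0n mulr0 addr0 expf_neq0 //; apply: contraNneq neP => x0.
    have ez : z = -1 by rewrite -[z]add0r -(addNr 1) -addrA z0 addr0.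
    by rewrite eP x0 ez /P0 mx2N; apply/eqP; congr mx2; ring.
  apply: contra_neq (hd (x / (1 + z))) => e'.
  have -> : (x / (1 + z)) ^+ 2 + delta = (x ^+ 2 + delta * (1 + z) ^+ 2) / (1 + z) ^+ 2.
    by field.
  by rewrite e' mul0r.
have su : s \in unitmx by rewrite unitmxE unitfE.
have sP : P *m s = s *m P0.
  rewrite sE eP !mx2M; congr mx2; try by ring.
    by transitivity (x ^+ 2 + delta * z ^+ 2 + delta * z); [ring|rewrite h; ring].
  by transitivity (x ^+ 2 + delta * z ^+ 2 + delta * z); [ring|rewrite h; ring].
have sN : s *m N0 = - N0 *m s.
  by rewrite sE /N0 mx2N !mx2M; congr mx2; ring.
have PN : P0 *m N0 = - N0 *m P0.
  by rewrite /N0 /P0 mx2N !mx2M; congr mx2; ring.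
have [/is_squareP[r er]|ns] := boolP (is_square (\det s)).
  exists s; last by rewrite -mulmxA sP mulKmx.
  exists r; first by apply: contraNneq ds0 => r0; rewrite er r0 expr0n.
  by split; [left|right; apply: conj_of_comm].
have /is_squareP[r er] := square_mul_nonsquares two0 oddK ns nonsquare_opp_delta.
have s'u : s *m P0 \in unitmx by rewrite unitmx_mul su.
exists (s *m P0); last first.
  by rewrite -mulmxA (mulmxA P) sP mulKmx.
exists r.
  by apply: contraNneq (mulf_neq0 ds0 oppd0) => r0; rewrite er r0 expr0n.
split; first by left; rewrite det_mulmx (plane_det P0_plane).
left; apply: conj_of_comm => //.
by rewrite -mulmxA PN mulNmx mulmxN mulmxA sN !mulNmx opprK mulmxA.
Qed.

(* For P = - (\det N)^-1 N one has tr (N P) = 2: the right-hand side is the reflection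
   fixing the plane tr (N M) = 0. *)
Lemma iota_conj_refl N f : \tr N = 0 -> \det N != 0 ->
  iota_neg (conj_act N f) = elim_form N (- (\det N)^-1 *: N) f.
Proof.
move=> tN dN; have Nu : N \in unitmx by rewrite unitmxE unitfE.
have tN' : \tr (- (\det N)^-1 *: N) = 0 by rewrite linearZ /= tN mulr0.
apply: (@trf_morph_eq _ (@iota_neg K \o conj_act N) (elim_form N (- (\det N)^-1 *: N)))
  => [k|N'] /=; first by rewrite conj_actC iotaC elimC.
rewrite conj_act_trf // iota_trf elim_trf // -trfZ -trfN -trfN -trfD.
have [x [y [z eN]]] := traceless_mx2 tN.
have d0 : x * - x - y * z != 0 by move: dN; rewrite eN mx2_det.
pose l := - (x * - x - y * z)^-1.
have eN' : - (\det N)^-1 *: N = mx2 (l * x) (l * y) (l * z) (l * - x).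
  by rewrite eN mx2_det [LHS]mx2E !mxE.
have iN : invmx N = mx2 (l * x) (l * y) (l * z) (l * - x).
  by rewrite eN invmx2 // !mx2Z; congr mx2; rewrite /l; ring.
rewrite eN' iN [N']mx2E; move: (N' 0 0) (N' 0 1) (N' 1 0) (N' 1 1) => x' y' z' t'.
rewrite eN !mx2M mx2_tr.
rewrite [X in _ = trf X]mx2E !mxE /= /trf !mxE /= /l.
by congr (mpolyC 3 _ * _ + mpolyC 3 _ * _ + mpolyC 3 _ * _); field.
Qed.

(** The reflection [rho] attached to R = N0 P preserves the plane, and its mirror meets it in the
    line through P. On the plane g = k [lam], where g is fixed by [rho] and [lam] changes sign; so k
    changes sign too and vanishes on the mirror, which gives the second factor. *)
Lemma restr_lam_sq d g P : ~~ odd d -> g \is d.-homog -> plane_inv g ->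
  P \in plane_pts -> g.@[pt P] = 0 -> divides (trf (lam P) ^+ 2) (restr g).
Proof.
move=> od hg gi hP gP; have [k ek] := restr_lam_divides hP hg gP.
have [l0 _ _] := lam_prime hP.
have ek' : restr k = k.
  apply: (mulIf l0); rewrite -[X in _ * X]restr_lam -rmorphM /= -ek.
  exact: restr_idem.
have /plane_ptsP[x [z [eP h]]] := hP.
pose R := N0 *m P.
have RE : R = mx2 (- delta * z) (delta * x) x (delta * z).
  by rewrite /R eP /N0 !mx2M; congr mx2; ring.
have dR : \det R = - delta ^+ 2.
  rewrite det_mulmx (plane_det hP); have /orbP[_ ->] := N0_orb; by ring.
have dR0 : \det R != 0 by rewrite dR oppr_eq0 expf_neq0 ?delta0.
have tR : \tr R = 0 by apply: meval_N0.
have Ru : R \in unitmx by rewrite unitmxE unitfE.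
have hR : plane_stab R.
  exists delta; first exact: delta0.
  split; first by right.
  right; apply: conj_of_comm => //; rewrite RE /N0 mx2N !mx2M; congr mx2; ring.
have restrR : restr (trf R) = delta%:MP * trf (lam P).
  rewrite restr_trf -trfZ; congr trf.
  by rewrite RE /lam eP /N0 !mxE /= mx2Z !mx2Z mx2N mx2D; congr mx2; ring.
pose rho := elim_form R (- (\det R)^-1 *: R).
have rhoE f : rho f = iota_neg (conj_act R f) by rewrite iota_conj_refl.
have rhoN : rho (trf N0) = trf N0.
  rewrite rhoE conj_act_trf // iota_trf.
  have -> : R *m N0 *m invmx R = - N0.
    by apply: conj_of_comm => //; rewrite RE /N0 mx2N !mx2M; congr mx2; ring.
  by rewrite trfN opprK.
have rhoR : rho (trf R) = - trf R by rewrite rhoE conj_act_trf // mulmxK // iota_trf.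
have rho_ideal f : divides (trf N0) f -> divides (trf N0) (rho f).
  by case=> l ->; exists (rho l); rewrite -{2}rhoN -rmorphM.
have rhog : divides (trf N0) (rho g - g).
  by rewrite rhoE (iota_conj g Ru) (even_iota od hg); apply: gi.
have gkR : divides (trf N0) (delta%:MP * g - k * trf R).
  apply/restr_divides; rewrite /restr rmorphB !rmorphM /= elimC -!/(restr _).
  by rewrite ek' ek restrR; ring.
have : divides (trf N0) (rho k + k).
  have [_ _ pN] := trf_prime two0 tr_N0 N0_neq0.
  have : divides (trf N0) (trf R * (rho k + k)).
    have h1 : divides (trf N0) (delta%:MP * rho g + rho k * trf R).
      have := rho_ideal _ gkR; congr divides.
      rewrite {1}/rho rmorphB !rmorphM /= elimC -[elim_form _ _ (trf R)]/(rho (trf R)) rhoR.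
      by rewrite mulrN opprK.
    have := dividesB (dividesB h1 gkR) (divides_mull delta%:MP rhog).
    by congr divides; ring.
  case/pN => // /restr_divides /eqP; rewrite restrR mulf_eq0 (negPf l0) orbF.
  by rewrite mpolyC_eq0 (negPf delta0).
move=> /restr_divides; rewrite /restr rmorphD /= -!/(restr _) ek' => hk.
have [j ej] := elim_congr R (- (\det R)^-1 *: R) k.
have e2 : 2%:R * k = restr j * (delta%:MP * trf (lam P)).
  rewrite -restrR -(rmorphM (restr)) /= -ej rmorphB /= ek'.
  move/eqP: hk; rewrite addr_eq0 => /eqP hk.
  by rewrite [restr _]hk opprK mulr_natl mulr2n.
exists ((2%:R^-1)%:MP * restr j * delta%:MP).
have h2 : (2%:R^-1)%:MP * 2%:R = 1 :> T.
  by rewrite -(rmorph_nat (@mpolyC 3 K)) -rmorphM mulVf ?two0 // rmorph1.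
by rewrite ek -[k]mul1r -h2 -(mulrA _ 2%:R) e2 expr2 !mulrA.
Qed.

Lemma lam_inj P P' : P \in halfset plane_pts -> P' \in halfset plane_pts ->
  divides (trf (lam P)) (trf (lam P')) -> P = P'.
Proof.
move=> Ph P'h; have hP := half_sub Ph; have hP' := half_sub P'h.
case/(trf_divides_trf two0 (lam_tr P) (lam_tr P') (lam_neq0 hP)) => k.
have /plane_ptsP[x [z [eP h]]] := hP; have /plane_ptsP[x' [z' [eP' h']]] := hP'.
rewrite eP eP' /lam !mxE /= mx2Z => /mx2_inj[_ ex _ ez].
have ex' : x' = k * x by apply: (mulfI two0); rewrite ex; ring.
have : k ^+ 2 * delta = 1 * delta.
  transitivity (k ^+ 2 * (x ^+ 2 + delta * z ^+ 2)); first by rewrite h.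
  transitivity (x' ^+ 2 + delta * z' ^+ 2); last by rewrite h' mul1r.
  by rewrite ex' ez; ring.
move/(mulIf delta0)/eqP; rewrite -[1](expr1n _ 2) eqf_sqr.
case/orP => /eqP ek; first by rewrite ex' ez ek !mul1r.
move: P'h; have -> : P' = - P.
  by rewrite eP eP' ex' ez ek mx2N; congr mx2; ring.
by rewrite half_opp ?plane_neq0 ?planeN // Ph.
Qed.

Definition W_ : T := \prod_(P in halfset plane_pts) trf (lam P) ^+ 2.

Lemma W_divides d g : ~~ odd d -> g \is d.-homog -> plane_inv g ->
  g.@[pt P0] = 0 -> divides W_ (restr g).
Proof.
move=> od hg gi gP; rewrite /W_ -big_enum.
apply: prod_prime_divides => [|P|P P'|P]; rewrite ?enum_uniq ?mem_enum //.
- by move=> /half_sub; apply: lam_prime.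
- exact: lam_inj.
- move=> /half_sub hP; apply: (restr_lam_sq od hg gi hP).
  by rewrite (plane_transitive od hg gi hP).
Qed.

Lemma W_dhomog : W_ \is (#|halfset plane_pts|.*2).-homog.
Proof.
rewrite -muln2 /W_ prodrXl; apply: dhomogMn.
by apply: dhomog_prod_set => P _; apply: trf_dhomog.
Qed.

Lemma even_w : ~~ odd q.+1. Proof. by rewrite /= oddq. Qed.

Lemma w_P0 : w_.@[pt P0] = 0.
Proof.
rewrite (meval_w (plane_tr P0_plane)) (plane_det P0_plane) exprSr -[in q./2]Kq.
by rewrite (nonsquare_euler two0 oddK nonsquare_opp_delta); ring.
Qed.

(** The plane has a point of determinant 1, by [conic_point], and w equals 4 there. *)
Lemma restr_w_neq0 : restr w_ != 0.
Proof.
have [x [z h]] := conic_point two0 oddK (-1) delta0.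
pose P : 'M[K]_2 := mx2 x (delta * z) z (- x).
have tP : \tr P = 0 by rewrite mx2_tr subrr.
have dP : \det P = 1 by rewrite -[1]opprK -h mx2_det; ring.
apply/eqP => /restr_divides [k ek].
have : w_.@[pt P] = 0.
  rewrite ek mevalM (meval_trf _ tP) mx2M mx2_tr.
  by rewrite (_ : _ + _ = 0) ?mulr0 //; ring.
rewrite (meval_w tP) dP expr1n -mulr2n -natrM => /eqP.
by rewrite natrM mulf_eq0 (negPf two0).
Qed.

Lemma restr_wE : exists2 r, r != 0 & restr w_ = r%:MP * W_.
Proof.
apply: (dhomog_divides_const (restr_dhomog w_dhomog) W_dhomog card_half_plane restr_w_neq0).
exact: (W_divides even_w w_dhomog (plane_inv_H even_w w_dhomog H_inv_w) w_P0).
Qed.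

Lemma dhomog_weighted_comp n (wts : 'I_n -> nat) (t : n.-tuple T) d (Q : {mpoly K[n]}) :
  (forall i, tnth t i \is (wts i).-homog) -> Q \is d.-homog for (weighted_mdeg wts) ->
  Q \mPo t \is d.-homog.
Proof.
move=> ht /dhomogP h; rewrite comp_mpolyE big_seq; apply: rpred_sum => m /h <-.
apply: rpredZ.
suff : \prod_(i < n) tnth t i ^+ m i \is (\sum_(i < n) m i * wts i)%N.-homog by [].
elim/big_rec2: _ => [|i x y _ hy]; first exact: dhomog1.
by apply: dhomogM hy; rewrite mulnC; apply: dhomogMn.
Qed.

Definition wt : 'I_3 -> nat := tnth [tuple 2%N; q.+1; (q * q./2)%N].
(** T is reused as the polynomial ring whose variables a, b, c stand for u, w, S0, with the weights
    [wt]. *)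
Definition ev_A (Q : T) : T := Q \mPo [tuple u_; w_; S0].

Lemma ev_A_zmod : zmod_morphism ev_A.
Proof. by move=> f g; rewrite /ev_A rmorphB. Qed.
Lemma ev_A_monoid : monoid_morphism ev_A.
Proof. by split=> [|f g]; rewrite /ev_A ?rmorph1 ?rmorphM. Qed.
HB.instance Definition _ := GRing.isZmodMorphism.Build T T ev_A ev_A_zmod.
HB.instance Definition _ := GRing.isMonoidMorphism.Build T T ev_A ev_A_monoid.

Lemma ev_AC k : ev_A k%:MP = k%:MP. Proof. exact: comp_mpolyC. Qed.
Lemma ev_Aa : ev_A a = u_. Proof. exact: comp_a. Qed.
Lemma ev_Ab : ev_A b = w_. Proof. exact: comp_b. Qed.
Lemma ev_Ac : ev_A c = S0. Proof. exact: comp_c. Qed.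

Lemma S0_dhomog : S0 \is (q * q./2)%N.-homog.
Proof. by rewrite -card_half_delta; apply: half_prod_dhomog. Qed.

Lemma ev_A_dhomog d (Q : T) : Q \is d.-homog for (weighted_mdeg wt) -> ev_A Q \is d.-homog.
Proof.
apply: dhomog_weighted_comp; apply: forall_ord3; rewrite !(tnth_nth 0) /wt ?(tnth_nth 0%N) /=.
- exact: u_dhomog.
- exact: w_dhomog.
- exact: S0_dhomog.
Qed.

Lemma H_inv_S0 : H_inv S0.
Proof. by split; [apply: G_inv_half_prod; apply: delta0|exact: tau_S0]. Qed.

Lemma H_inv_ev_A (Q : T) : H_inv (ev_A Q).
Proof.
elim/mpolyind: Q => [|k m Q _ _ IH].
  by rewrite rmorph0 -(rmorph0 (@mpolyC 3 K)); apply: H_invC.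
rewrite rmorphD; apply: H_invD IH; rewrite -mul_mpolyC rmorphM /= ev_AC.
apply: H_invM; first exact: H_invC.
rewrite mpolyXE_id rmorph_prod; elim/big_ind: _ => [|x y|i _].
- by rewrite -(rmorph1 (@mpolyC 3 K)); apply: H_invC.
- exact: H_invM.
rewrite rmorphXn; apply: H_invX; move: i; apply: forall_ord3.
- by have := ev_Aa => /= ->; apply: H_inv_u.
- by have := ev_Ab => /= ->; apply: H_inv_w.
- by have := ev_Ac => /= ->; apply: H_inv_S0.
Qed.

Lemma wt_var (i : 'I_3) : ('X_i : T) \is (wt i).-homog for (weighted_mdeg wt).
Proof.
rewrite dhomogX; suff : weighted_mdeg wt U_(i)%MM = wt i by move=> /= ->.
rewrite /weighted_mdeg (bigD1 i) //= mnm1E eqxx mul1n big1 ?addn0 // => j ne.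
by rewrite mnm1E eq_sym (negPf ne).
Qed.

Lemma wt_C k : (k%:MP : T) \is 0.-homog for (weighted_mdeg wt).
Proof. by rewrite -[k%:MP]mulr1 mul_mpolyC rpredZ // dhomog1. Qed.

Lemma meval_u_P0 : u_.@[pt P0] = - delta.
Proof. by rewrite (meval_u (plane_tr P0_plane)) (plane_det P0_plane). Qed.

Lemma plane_inv_quotient f g : plane_inv (restr f) -> plane_inv f -> restr f != 0 ->
  plane_inv (restr f * g) -> plane_inv g.
Proof.
move=> _ fi f0 fgi s hs; have [_ _ pN] := trf_prime two0 tr_N0 N0_neq0.
have h1 : divides (trf N0) (conj_act s (restr f) - restr f).
  have := dividesD (fi s hs) (dividesB (restr_congr f)
    (plane_stab_divides hs (restr_congr f))).
  by rewrite rmorphB; congr divides; ring.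
have : divides (trf N0) (restr f * (conj_act s g - g)).
  have := dividesB (fgi s hs) (divides_mulr (conj_act s g) h1).
  by rewrite rmorphM; congr divides; ring.
case/pN => // /restr_divides; rewrite restr_idem => e0; by rewrite e0 eqxx in f0.
Qed.

Lemma plane_inv_congr f g : divides (trf N0) (f - g) -> plane_inv f -> plane_inv g.
Proof.
move=> h fi s hs.
have := dividesB (dividesD (fi s hs) h) (plane_stab_divides hs h).
by rewrite rmorphB; congr divides; ring.
Qed.

Lemma plane_invB f g : plane_inv f -> plane_inv g -> plane_inv (f - g).
Proof.
move=> fi gi s hs; have := dividesB (fi s hs) (gi s hs).
by rewrite rmorphB; congr divides; ring.
Qed.

Lemma plane_lemma d g : ~~ odd d -> g \is d.-homog -> plane_inv g ->
  exists2 Q : T, Q \is d.-homog for (weighted_mdeg wt) & divides (trf N0) (g - ev_A Q).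
Proof.
elim/ltn_ind: d g => d IH g od hg gi.
have dE : d = (2 * d./2)%N by rewrite mul2n -[LHS]odd_double_half (negPf od).
(* u takes the value -delta at P0, so subtracting k0 u^(d/2) makes g vanish there. *)
pose k0 := g.@[pt P0] / (- delta) ^+ d./2.
pose Q0 : T := k0%:MP * a ^+ d./2.
have hQ0 : Q0 \is d.-homog for (weighted_mdeg wt).
  rewrite -[d]add0n; apply: dhomogM; first exact: wt_C.
  by rewrite {2}dE; apply: dhomogMn; have := wt_var 0; rewrite /wt (tnth_nth 0%N).
pose g1 := g - ev_A Q0.
have hg1 : g1 \is d.-homog by apply: rpredB => //; apply: ev_A_dhomog.
have g1i : plane_inv g1.
  apply: (plane_invB gi); apply: (plane_inv_H od); first exact: ev_A_dhomog.
  exact: H_inv_ev_A.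
have g1P : g1.@[pt P0] = 0.
  rewrite mevalB /Q0 rmorphM rmorphXn /= ev_AC ev_Aa mevalM mevalC rmorphXn /=.
  by rewrite meval_u_P0 /k0 divfK ?subrr // expf_neq0 ?oppd0.
have [r0|r0] := eqVneq (restr g1) 0.
  by exists Q0; [exact: hQ0|apply/restr_divides].
have [j ej] := W_divides od hg1 g1i g1P.
have [r rn0 er] := restr_wE.
pose k : T := j * (r^-1)%:MP.
have ek : restr g1 = restr w_ * k.
  have h1 : r%:MP * (r^-1)%:MP = 1 :> T by rewrite -rmorphM mulfV // rmorph1.
  by rewrite er ej /k -[LHS]mulr1 -h1; move: (r^-1)%:MP => r'; ring.
have [qd hk] := dhomog_quotient (restr_dhomog hg1) (restr_dhomog w_dhomog) ek r0.
have wi : plane_inv w_ := plane_inv_H even_w w_dhomog H_inv_w.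
have ki : plane_inv k.
  apply: (plane_inv_quotient _ wi restr_w_neq0).
    exact: plane_inv_congr (restr_congr _) wi.
  by rewrite -ek; apply: plane_inv_congr (restr_congr _) g1i.
have od' : ~~ odd (d - q.+1) by rewrite oddB // (negPf od) /= oddq.
have [|Q1 hQ1 eQ1] := IH (d - q.+1)%N _ k od' hk ki.
  by rewrite ltn_subrL /=; apply: leq_trans qd.
exists (Q0 + b * Q1).
  apply: rpredD => //; rewrite -(subnKC qd); apply: dhomogM hQ1.
  by have := wt_var 1; rewrite /wt (tnth_nth 0%N).
have -> : g - ev_A (Q0 + b * Q1) = (g1 - restr g1) - (w_ - restr w_) * k + w_ * (k - ev_A Q1).
  by rewrite ek rmorphD rmorphM /= ev_Ab /g1; ring.
apply: dividesD; last exact: divides_mull.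
by apply: dividesB; [|apply: divides_mulr]; apply: restr_congr.
Qed.

(** If delta is a square, conjugation by N0 fixes f, and the reflection in the plane, which is minus
    it, sends f to -f; so f vanishes on the plane. If delta is not a square, then -1 is one, [tau]
    acts on f as the sign change of all variables, and f = -f. *)
Lemma odd_restr d f : odd d -> f \is d.-homog -> H_inv f -> divides (trf N0) f.
Proof.
move=> od hf [fG ft].
have half_div g : divides (trf N0) (2%:R * g) -> divides (trf N0) g.
  move=> h; have -> : g = (2%:R^-1)%:MP * (2%:R * g).
    by rewrite mulrA -(rmorph_nat (@mpolyC 3 K)) -rmorphM mulVf ?two0 // rmorph1 mul1r.
  exact: divides_mull.
have iof : iota_neg f = - f by rewrite (dhomog_iota hf) -signr_odd od expr1 mulN1r.
have scal r s : r != 0 -> \det s = r ^+ 2 -> conj_act s f = f.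
  move=> r0 ds; have su : s \in unitmx by rewrite unitmxE ds unitfE expf_neq0.
  have r1 : r^-1 != 0 by rewrite invr_eq0.
  by rewrite -(conj_act_scale f r1 su); apply: fG; rewrite det_mx2Z ds exprVn mulVf // expf_neq0.
have [/is_squareP[r er]|ns] := boolP (is_square delta).
  have r0 : r != 0 by apply: contraNneq delta0 => r0; rewrite er r0 expr0n.
  have h1 : conj_act N0 f = f by apply: (scal r) => //; rewrite -er; have /orbP[] := N0_orb.
  have dN : \det N0 != 0 by have /orbP[_ ->] := N0_orb; apply: delta0.
  have := elim_congr N0 (- (\det N0)^-1 *: N0) f.
  rewrite -(iota_conj_refl f tr_N0 dN) h1 iof opprK => h.
  by apply: half_div; rewrite mulr_natl mulr2n.
have /is_squareP[r er] : is_square (-1 : K).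
  have := square_mul_nonsquares two0 oddK ns nonsquare_opp_delta.
  rewrite mulrN -expr2 => /is_squareP[r er]; apply/is_squareP; exists (r / delta).
  by rewrite expr_div_n -er; field; apply: delta0.
have r0 : r != 0.
  by apply: contraTneq (oner_neq0 K) => r0; rewrite negbK -oppr_eq0 er r0 expr0n.
have h1 : conj_act (refl1 K) f = f by apply: (scal r) => //; rewrite det_refl1.
have : f = - f by rewrite -iof -{2}h1 -tau_iota ft.
move/eqP; rewrite -subr_eq0 opprK -mulr2n -mulr_natl => /eqP e0.
by apply: half_div; rewrite e0; apply: divides0.
Qed.

Lemma G_inv_orb_divides k N f m : k != 0 -> N \in orb k -> G_inv f ->
  divides (trf N ^+ m) f -> divides (half_prod k ^+ m) f.
Proof.
move=> k0 /orbP[tN dN] fG [j ej]; apply: (half_prod_divides two0 k0) => N' /half_sub/orbP[tN' dN'].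
have [s ds es] := SL2_transitive two0 oddK k0 tN dN tN' dN'.
exists (conj_act s j); rewrite -{1}(fG s ds) ej rmorphM rmorphXn /=.
by rewrite (conj_act_trf N (det1_unit ds)) es.
Qed.

Lemma S0_divides f : G_inv f -> divides (trf N0) f -> divides S0 f.
Proof.
move=> fG h; rewrite -[S0]expr1; apply: (G_inv_orb_divides delta0 N0_orb fG).
by rewrite expr1.
Qed.

(** * The invariants of the reflection group generated by G and tau *)

Lemma H_inv_ev d f : f \is d.-homog -> H_inv f ->
  exists2 Q : T, Q \is d.-homog for (weighted_mdeg wt) & f = ev_A Q.
Proof.
elim/ltn_ind: d f => d IH f hf Hf.
have [Q1 hQ1 h1] : exists2 Q : T, Q \is d.-homog for (weighted_mdeg wt) &
    divides (trf N0) (f - ev_A Q).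
  have [od|od] := boolP (odd d); last by apply: plane_lemma => //; apply: (plane_inv_H od hf).
  exists 0; first exact: dhomog0.
  by rewrite rmorph0 subr0; apply: (odd_restr od hf).
pose f1 := f - ev_A Q1.
have Hf1 : H_inv f1 by apply: H_invB => //; apply: H_inv_ev_A.
have hf1 : f1 \is d.-homog by apply: rpredB => //; apply: ev_A_dhomog.
have [k ek] := S0_divides Hf1.1 h1.
have [f10|f10] := eqVneq f1 0.
  by exists Q1 => //; apply/eqP; rewrite -subr_eq0 -/f1 f10.
rewrite mulrC in ek; have [sd hk] := dhomog_quotient hf1 S0_dhomog ek f10.
have S00 : S0 != 0 by apply: half_prod_neq0; rewrite ?two0 ?delta0.
have Hk : H_inv k by apply: (H_inv_div S00 H_inv_S0); rewrite -ek.
have q0 : (0 < q * q./2)%N by have := q_gt1; have := q_half; case: (q./2) => [->//|m _ q1]; rewrite muln_gt0 ltnW.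
have [|Q2 hQ2 eQ2] := IH (d - q * q./2)%N _ k hk Hk.
  by rewrite ltn_subrL q0 (leq_trans q0).
exists (Q1 + c * Q2); last by rewrite rmorphD rmorphM /= ev_Ac -eQ2 -ek /f1; ring.
apply: rpredD => //; rewrite -(subnKC sd); apply: dhomogM hQ2.
by have := wt_var 2%:R; rewrite /wt (tnth_nth 0%N).
Qed.

(** * The Jacobian and the anti-invariants *)

Lemma mderiv_comp n (f : {mpoly K[n]}) (t : n.-tuple T) (j : 'I_3) :
  (f \mPo t)^`M(j) = \sum_(i < n) (f^`M(i) \mPo t) * (tnth t i)^`M(j).
Proof.
have prodP (g k : {mpoly K[n]}) :
    (g \mPo t)^`M(j) = \sum_(i < n) (g^`M(i) \mPo t) * (tnth t i)^`M(j) ->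
    (k \mPo t)^`M(j) = \sum_(i < n) (k^`M(i) \mPo t) * (tnth t i)^`M(j) ->
    ((g * k) \mPo t)^`M(j) = \sum_(i < n) ((g * k)^`M(i) \mPo t) * (tnth t i)^`M(j).
  move=> eg ek; rewrite rmorphM mderivM eg ek mulr_suml mulr_sumr -big_split /=.
  by apply: eq_bigr => i _; rewrite mderivM rmorphD !rmorphM /=; ring.
have constP k : (k%:MP \mPo t)^`M(j) =
    \sum_(i < n) (k%:MP^`M(i) \mPo t) * (tnth t i)^`M(j).
  by rewrite comp_mpolyC mderivC big1 // => i _; rewrite mderivC comp_mpoly0 mul0r.
elim/mpolyind: f => [|k m f _ _ IH].
  by rewrite -(rmorph0 (@mpolyC n K)); apply: constP.
rewrite rmorphD mderivD IH -mul_mpolyC prodP => [||].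
- by rewrite -big_split /=; apply: eq_bigr => i _; rewrite mderivD rmorphD mulrDl.
- exact: constP.
rewrite mpolyXE_id; elim/big_ind: _ => [|x y|i _].
- by rewrite -(rmorph1 (@mpolyC n K)); apply: constP.
- exact: prodP.
elim: (m i) => [|l IHl]; first by rewrite expr0 -(rmorph1 (@mpolyC n K)); apply: constP.
rewrite exprS; apply: prodP => //.
rewrite (bigD1 i) //= big1 => [|i' ne]; rewrite mderivX mnm1E.
  rewrite eqxx scale1r (_ : (U_(i) - U_(i) = 0)%MM) ?mpolyX0 ?comp_mpoly1 ?mul1r ?addr0.
    by rewrite comp_mpolyXU (tnth_nth 0).
  by apply/mnmP => i'; rewrite mnmBE mnm0E subnn.
by rewrite eq_sym (negPf ne) scale0r comp_mpoly0 mul0r.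
Qed.

Lemma mderiv_var (i j : 'I_3) : ('X_i : T)^`M(j) = (i == j)%:R.
Proof.
rewrite mderivX mnm1E; case: eqP => [->|_]; last by rewrite scale0r.
rewrite scale1r (_ : (U_(j) - U_(j) = 0)%MM) ?mpolyX0 //.
by apply/mnmP => i'; rewrite mnmBE mnm0E subnn.
Qed.

Lemma mderiv_lin x y z : let f := x%:MP * a + y%:MP * b + z%:MP * c in
  [/\ f^`M(0) = x%:MP, f^`M(1) = y%:MP & f^`M(2%:R) = z%:MP].
Proof.
by split; rewrite !mderivD !mderiv_mulC !mderiv_var /= ?mulr1 ?mulr0 ?addr0 ?add0r.
Qed.

Lemma jacobianE (f1 f2 f3 : T) : jacobian f1 f2 f3 =
  f1^`M(0) * (f2^`M(1) * f3^`M(2%:R) - f2^`M(2%:R) * f3^`M(1)) -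
  f1^`M(1) * (f2^`M(0) * f3^`M(2%:R) - f2^`M(2%:R) * f3^`M(0)) +
  f1^`M(2%:R) * (f2^`M(0) * f3^`M(1) - f2^`M(1) * f3^`M(0)).
Proof.
by rewrite /jacobian det3 !mxE !(tnth_nth 0).
Qed.

Definition h0 : T := jacobian u_ v_ S0.

Lemma natqT : q%:R = 0 :> T.
Proof.
apply/eqP; rewrite -(dvdn_pcharf pcharT); have := q_gt1.
by rewrite qE; case: expo => // n _; rewrite expnS dvdn_mulr.
Qed.

Lemma mderiv_exp (f : T) n (i : 'I_3) : (f ^+ n)^`M(i) = n%:R * f ^+ n.-1 * f^`M(i).
Proof.
elim: n => [|[|n] IH]; first by rewrite expr0 -(rmorph1 (@mpolyC 3 K)) mderivC !mul0r.
  by rewrite expr1 expr0 !mul1r.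
by rewrite exprS mderivM IH /= -[n.+2]addn1 natrD exprS; ring.
Qed.

Lemma mderiv_frob (f : T) (i : 'I_3) : (f ^+ q)^`M(i) = 0.
Proof. by rewrite mderiv_exp natqT !mul0r. Qed.

Lemma mderiv_u : [/\ u_^`M(0) = - (2%:R * a), u_^`M(1) = - c & u_^`M(2%:R) = - b].
Proof.
by split; rewrite /u_ /det_form mderivB mderivN mderiv_exp mderivM !mderiv_var /=; ring.
Qed.

Lemma mderiv_v : [/\ v_^`M(0) = - (2%:R * a ^+ q), v_^`M(1) = - c ^+ q & v_^`M(2%:R) = - b ^+ q].
Proof.
by split; rewrite v_E !mderivB mderivN -(rmorph_nat (@mpolyC 3 K)) mderiv_mulC
   !mderivM !mderiv_frob !mderiv_var /= rmorph_nat; ring.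
Qed.

Lemma h0E : h0 = - (2%:R * a) * (b ^+ q * S0^`M(1) - c ^+ q * S0^`M(2%:R)) +
  c * (b ^+ q * S0^`M(0) - 2%:R * a ^+ q * S0^`M(2%:R)) -
  b * (c ^+ q * S0^`M(0) - 2%:R * a ^+ q * S0^`M(1)).
Proof.
rewrite /h0 jacobianE; have [-> -> ->] := mderiv_u; have [-> -> ->] := mderiv_v.
by ring.
Qed.

Lemma big_ord3 (F : 'I_3 -> T) : \sum_(i < 3) F i = F 0 + F 1 + F 2%:R.
Proof.
rewrite !big_ord_recl big_ord0 addr0 addrA.
by congr (_ + F _ + F _); apply: val_inj.
Qed.

Lemma S0_chain s (j : 'I_3) : \det s = 1 ->
  S0^`M(j) = conj_act s S0^`M(0) * (conj_act s a)^`M(j) +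
   conj_act s S0^`M(1) * (conj_act s b)^`M(j) +
   conj_act s S0^`M(2%:R) * (conj_act s c)^`M(j).
Proof.
move=> ds; rewrite -{1}(H_inv_S0.1 _ ds) conj_act_def mderiv_comp big_ord3.
rewrite -!conj_act_def !(tnth_nth 0) /=.
have -> : conj_act s a = conj_mx s 0 0 by rewrite conj_act_def comp_a.
have -> : conj_act s b = conj_mx s 0 1 by rewrite conj_act_def comp_b.
by have -> : conj_act s c = conj_mx s 1 0 by rewrite conj_act_def comp_c.
Qed.

(** Differentiating the invariance of S0 gives a unitriangular linear system for the transformed
    partial derivatives, which is solved here. *)
Lemma S0_upper t : [/\ conj_act (upper t) S0^`M(1) = S0^`M(1),
  conj_act (upper t) S0^`M(0) = S0^`M(0) - (2%:R * t)%:MP * S0^`M(1) &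
  conj_act (upper t) S0^`M(2%:R) = S0^`M(2%:R) + t%:MP * S0^`M(0) - (t ^+ 2)%:MP * S0^`M(1)].
Proof.
have E j := S0_chain j (det_upper t).
have := E 0; have := E 1; have := E 2%:R.
rewrite upper_a upper_b upper_c.
have [] := mderiv_lin 1 0 (- t); rewrite rmorph1 rmorph0 rmorphN !mul0r mul1r addr0 mulNr.
move=> -> -> ->.
have [] := mderiv_lin (2%:R * t) 1 (- t ^+ 2); rewrite rmorph1 rmorphN mul1r mulNr.
move=> -> -> ->.
rewrite !mderiv_var /=.
move: (conj_act _ S0^`M(0)) (conj_act _ S0^`M(1)) (conj_act _ S0^`M(2%:R)) => x y z.
move: (S0^`M(0)) (S0^`M(1)) (S0^`M(2%:R)) => x' y' z' e2 e1 e0.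
have {e1} e1 : y' = y by rewrite e1; ring.
have {e0} e0 : x' = x + (2%:R * t)%:MP * y by rewrite e0; ring.
have {e2} e2 : z' = z - t%:MP * x - (t ^+ 2)%:MP * y by rewrite e2; ring.
by rewrite e0 e1 e2; split; [|ring|ring].
Qed.

Lemma S0_lower t : [/\ conj_act (lower t) S0^`M(2%:R) = S0^`M(2%:R),
  conj_act (lower t) S0^`M(0) = S0^`M(0) + (2%:R * t)%:MP * S0^`M(2%:R) &
  conj_act (lower t) S0^`M(1) = S0^`M(1) - t%:MP * S0^`M(0) - (t ^+ 2)%:MP * S0^`M(2%:R)].
Proof.
have E j := S0_chain j (det_lower t).
have := E 0; have := E 1; have := E 2%:R.
rewrite lower_a lower_b lower_c.
have [] := mderiv_lin 1 t 0; rewrite rmorph1 rmorph0 !mul0r mul1r addr0.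
move=> -> -> ->.
have [] := mderiv_lin (- (2%:R * t)) (- t ^+ 2) 1; rewrite rmorph1 !rmorphN mul1r !mulNr.
move=> -> -> ->.
rewrite !mderiv_var /=.
move: (conj_act _ S0^`M(0)) (conj_act _ S0^`M(1)) (conj_act _ S0^`M(2%:R)) => x y z.
move: (S0^`M(0)) (S0^`M(1)) (S0^`M(2%:R)) => x' y' z' e2 e1 e0.
have {e2} e2 : z' = z by rewrite e2; ring.
have {e0} e0 : x' = x - (2%:R * t)%:MP * z by rewrite e0; ring.
have {e1} e1 : y' = y + t%:MP * x - (t ^+ 2)%:MP * z by rewrite e1; ring.
by rewrite e0 e1 e2; split; [|ring|ring].
Qed.

Lemma h0_morph (phi : {rmorphism T -> T}) : phi h0 =
  - (2%:R * phi a) * (phi b ^+ q * phi S0^`M(1) - phi c ^+ q * phi S0^`M(2%:R)) +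
  phi c * (phi b ^+ q * phi S0^`M(0) - 2%:R * phi a ^+ q * phi S0^`M(2%:R)) -
  phi b * (phi c ^+ q * phi S0^`M(0) - 2%:R * phi a ^+ q * phi S0^`M(1)).
Proof.
by rewrite h0E !(rmorphB phi, rmorphD phi, rmorphN phi, rmorphM phi, rmorphXn phi, rmorph1 phi).
Qed.

Lemma G_inv_h0 : G_inv h0.
Proof.
apply: G_inv_gen => t; rewrite (h0_morph (conj_act _)) /=.
  have [-> -> ->] := S0_upper t; rewrite upper_a upper_b upper_c h0E.
  rewrite !(frobD, frobN) !exprMn !frobC; ring.
have [-> -> ->] := S0_lower t; rewrite lower_a lower_b lower_c h0E.
rewrite !(frobD, frobN) !exprMn frobN !frobC; ring.
Qed.

Lemma tau_h0 : tau h0 = - h0.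
Proof.
have E j : S0^`M(j) = tau S0^`M(0) * (- a)^`M(j) + tau S0^`M(1) * b^`M(j) +
    tau S0^`M(2%:R) * c^`M(j).
  rewrite -{1}tau_S0 tau_def mderiv_comp big_ord3 -!tau_def.
  by rewrite !(tnth_nth 0).
have := E 0; have := E 1; have := E 2%:R.
rewrite !mderivN !mderiv_var /= oppr0 !mulr0 !mulr1 !addr0 !add0r => e2 e1 e0.
rewrite (h0_morph (@tau K)) /= -e2 -e1 !tauE frobN h0E.
have -> : tau S0^`M(0) = - S0^`M(0) by rewrite [in RHS]e0 mulrN1 opprK.
ring.
Qed.

Lemma dhomog_mderiv d (f : T) i : f \is d.-homog -> f^`M(i) \is d.-1.-homog.
Proof.
move=> /dhomogP hf; apply/dhomogP => m; rewrite mcoeff_msupp mcoeff_mderiv => h.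
have /hf : (m + U_(i))%MM \in msupp f.
  by rewrite mcoeff_msupp; apply: contraNneq h => ->; rewrite mul0rn.
by move=> /= <-; rewrite mdegD mdeg1 addn1.
Qed.

Lemma h0_dhomog : h0 \is (q * (q./2).+1).-homog.
Proof.
have q0 : (0 < q * q./2)%N.
  by have := q_gt1; have := q_half; case: (q./2) => [->//|m _ q1]; rewrite muln_gt0 ltnW.
have -> : (q * (q./2).+1 = 1 + (q + (q * q./2).-1))%N.
  by rewrite mulnS [RHS]addnCA add1n prednK.
have hs i : S0^`M(i) \is (q * q./2).-1.-homog by apply: dhomog_mderiv S0_dhomog.
have hx i j : ('X_i : T) ^+ q * S0^`M(j) \is (q + (q * q./2).-1).-homog.
  by apply: dhomogM (hs j); apply: var_exp_dhomog.
rewrite h0E; apply: rpredB; [apply: rpredD|].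
- apply: dhomogM; first by rewrite rpredN mulr_natl rpredMn // var_dhomog.
  by apply: rpredB; apply: hx.
- apply: dhomogM; first exact: var_dhomog.
  by apply: rpredB; [apply: hx|rewrite -mulrA mulr_natl rpredMn // hx].
- apply: dhomogM; first exact: var_dhomog.
  by apply: rpredB; [apply: hx|rewrite -mulrA mulr_natl rpredMn // hx].
Qed.

Lemma S0_factor : exists2 k, S0 = k * trf N0 & ~ divides (trf N0) k.
Proof.
have [N Nh eN] : exists2 N, N \in halforb delta & N = N0 \/ N = - N0.
  have [h|h] := boolP (N0 \in halforb delta); first by exists N0 => //; left.
  by exists (- N0); [rewrite (halforb_opp two0 delta0 N0_orb)|right].
have NP := trf_prime two0 tr_N0 N0_neq0.
pose k : T := \prod_(N' in halforb delta | N' != N) trf N'.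
have nk : ~ divides (trf N0) k.
  rewrite /k -big_enum_cond -big_filter -(big_map _ xpredT id) => /(prime_divides_prod NP).
  case=> x /mapP[N']; rewrite mem_filter mem_enum => /andP[ne N'h] -> h.
  have /orbP[tN' dN'] := half_sub N'h; have /orbP[tN dN] := N0_orb.
  have [l el] := trf_divides_trf two0 tN tN' N0_neq0 h.
  move: dN'; rewrite el det_mx2Z dN -[RHS]mul1r => /(mulIf delta0) /eqP.
  have Noh := half_sub Nh.
  rewrite -[1](expr1n _ 2) eqf_sqr => /orP[] /eqP el1; move: ne N'h; rewrite el el1.
    rewrite scale1r; case: eN => eN; first by rewrite eN eqxx.
    by move=> _; rewrite -[N0]opprK -eN (halforb_opp two0 delta0 Noh) Nh.
  rewrite scaleN1r; case: eN => eN; last by rewrite eN eqxx.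
  by move=> _; rewrite -eN (halforb_opp two0 delta0 Noh) Nh.
have e : S0 = k * trf N by rewrite /S0 /half_prod (bigD1 N) //= mulrC.
case: eN e => -> e; first by exists k.
exists (- k); first by rewrite e trfN mulrN mulNr.
by move=> /dividesN; rewrite opprK.
Qed.

Lemma frob_neq : a ^+ q * c - a * c ^+ q != 0 :> T.
Proof.
have a0 : a != 0 :> T by rewrite -msize_poly_eq0 msizeX mdeg1.
have c0 : c != 0 :> T by rewrite -msize_poly_eq0 msizeX mdeg1.
have := q_gt1; case: q => [|[|n]] // _; apply/eqP => h.
have h1 : a * c * (a ^+ n.+1 - c ^+ n.+1) = 0 by rewrite -h [in RHS]exprS [c ^+ n.+2]exprS; ring.
move/eqP: h1; rewrite mulf_eq0 mulf_eq0 (negPf a0) (negPf c0) subr_eq0 /= => /eqP h1.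
have := congr1 (comp_mpoly [tuple (0 : T); b; c]) h1.
rewrite !rmorphXn /= comp_a comp_c expr0n /= => /eqP; rewrite eq_sym expf_eq0.
by rewrite (negPf c0) andbF.
Qed.

(** In characteristic p, algebraic independence would not suffice. But [trf N0] is a simple factor
    of S0, so on the plane the gradient of S0 is k (0, 1, -delta) with k nonzero, and the Jacobian
    becomes 4 delta k (a^q c - a c^q). *)
Lemma h0_neq0 : h0 != 0.
Proof.
have [k ek nk] := S0_factor.
have ds i : restr S0^`M(i) = restr k * restr (trf N0)^`M(i).
  rewrite ek mderivM rmorphD !rmorphM /= (_ : restr (trf N0) = 0) ?mulr0 ?add0r //.
  by apply/restr_divides/divides_refl.
have tE : trf N0 = 0%:MP * a + 1%:MP * b + (- delta)%:MP * c.
  by rewrite /trf !mxE /= subr0.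
have [d0 d1 d2] := mderiv_lin 0 1 (- delta); rewrite -tE in d0 d1 d2.
have dd : (restr (trf N0)^`M(0) = 0) * (restr (trf N0)^`M(1) = 1) *
   (restr (trf N0)^`M(2%:R) = - delta%:MP).
  by rewrite d0 d1 d2 /restr !elimC rmorph0 rmorph1 rmorphN.
have e : restr h0 = restr k * (4%:R * delta)%:MP * (a ^+ q * c - a * c ^+ q).
  rewrite (h0_morph restr) /= !ds !dd !restrE exprMn frobC rmorphM /= rmorph_nat; ring.
apply/eqP => h00; move: e; rewrite h00 rmorph0 => /esym/eqP; rewrite !mulf_eq0.
rewrite (negPf frob_neq) orbF mpolyC_eq0 mulf_eq0 (negPf delta0) orbF.
rewrite (natrM _ 2 2) mulf_eq0 (negPf two0) /= orbF => /eqP /restr_divides.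
exact: nk.
Qed.

Lemma conj_act_dhomog s d f : s \in unitmx -> f \is d.-homog -> conj_act s f \is d.-homog.
Proof.
move=> su hf; rewrite conj_act_def; apply: dhomog_comp hf; apply: forall_ord3; rewrite (tnth_nth 0) /=.
- have -> : conj_mx s 0 0 = conj_act s a by rewrite conj_act_def comp_a.
  by rewrite trf_a conj_act_trf //; apply: trf_dhomog.
- have -> : conj_mx s 0 1 = conj_act s b by rewrite conj_act_def comp_b.
  by rewrite trf_b conj_act_trf //; apply: trf_dhomog.
- have -> : conj_mx s 1 0 = conj_act s c by rewrite conj_act_def comp_c.
  by rewrite trf_c conj_act_trf //; apply: trf_dhomog.
Qed.

Lemma tau_dhomog d f : f \is d.-homog -> tau f \is d.-homog.
Proof.
rewrite tau_def; apply: dhomog_comp; apply: forall_ord3; rewrite (tnth_nth 0) /=.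
- by rewrite rpredN; apply: var_dhomog.
- exact: var_dhomog.
- exact: var_dhomog.
Qed.

Lemma pihomog_morph (phi : {additive T -> T}) d f :
  (forall j g, g \is j.-homog -> phi g \is j.-homog) ->
  pihomog mdeg d (phi f) = phi (pihomog mdeg d f).
Proof.
move=> hphi; pose n := maxn d.+1 (msize f).
have ef := pihomog_partitionE (leq_maxr d.+1 (msize f)).
have dn : (d < n)%N by apply: leq_maxl.
rewrite {1}ef [in LHS]raddf_sum [LHS]raddf_sum (bigD1 (Ordinal dn)) //= big1 ?addr0 => [|j ne].
  exact: (pihomog_dE (hphi d _ (pihomogP mdeg d f))).
apply: (@pihomog_ne0 _ _ mdeg j d); last exact: (hphi j _ (pihomogP mdeg j f)).
by apply: contra_neq ne => e0; apply: val_inj.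
Qed.

Lemma G_inv_pihomog d f : G_inv f -> G_inv (pihomog mdeg d f).
Proof.
move=> fG s ds; have su := det1_unit ds.
have := pihomog_morph (phi := conj_act s) d f (fun j g => @conj_act_dhomog s j g su).
by rewrite /= (fG s ds).
Qed.

Lemma opp1_neq0 : -1 != 0 :> K. Proof. by rewrite oppr_eq0 oner_eq0. Qed.

Lemma half_div2 f g : divides f (2%:R * g) -> divides f g.
Proof.
move=> h; have -> : g = (2%:R^-1)%:MP * (2%:R * g).
  by rewrite mulrA -(rmorph_nat (@mpolyC 3 K)) -rmorphM mulVf ?two0 // rmorph1 mul1r.
exact: divides_mull.
Qed.

(** An anti-invariant vanishes on a = 0, where [tau] is the identity. Up to the factor 2, a is the
    form of [refl1], of determinant -1, and G carries it to the other factors. *)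
Lemma anti_half_prod f : G_inv f -> tau f = - f -> divides (half_prod (-1)) f.
Proof.
move=> fG ft; rewrite -[half_prod _]expr1.
have ro : refl1 K \in orb (-1) by apply/orbP; rewrite mx2_tr subrr det_refl1.
apply: (G_inv_orb_divides opp1_neq0 ro fG); rewrite expr1 trf_refl1.
have := tau_congr f; rewrite ft opprK -mulr2n -[f *+ 2]mulr_natl => h; have [k ->] := half_div2 h.
exists ((2%:R^-1)%:MP * k).
have h2 : (2%:R^-1)%:MP * 2%:R%:MP = 1 :> T by rewrite -rmorphM mulVf ?two0 // rmorph1.
by rewrite mulrACA h2 mul1r.
Qed.

Lemma h0_half_prod : exists2 r, r != 0 & h0 = r%:MP * half_prod (-1).
Proof.
apply: (dhomog_divides_const h0_dhomog (half_prod_dhomog _) _ h0_neq0).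
  by rewrite card_half_opp1.
exact: (anti_half_prod G_inv_h0 tau_h0).
Qed.

Lemma anti_inv_div f : G_inv f -> tau f = - f -> exists2 g, H_inv g & f = h0 * g.
Proof.
move=> fG ft; have [r r0 er] := h0_half_prod; have [k ek] := anti_half_prod fG ft.
have h1 : r%:MP * (r^-1)%:MP = 1 :> T by rewrite -rmorphM mulfV // rmorph1.
have e : f = h0 * (k * (r^-1)%:MP).
  by rewrite er mulrACA [_ * k]mulrC mulrACA h1 mulr1 mulrC ek mulrC.
exists (k * (r^-1)%:MP) => //; split=> [s ds|]; apply: (mulfI h0_neq0).
  by rewrite -{1}(G_inv_h0 ds) -rmorphM /= -e fG.
apply: oppr_inj; rewrite -mulNr -{1}tau_h0 -rmorphM /= -e ft; by rewrite e.
Qed.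

Definition dh := (q * (q./2).+1)%N.

(** * The ring of invariants as a free module over K[u, w, S0] *)

(** The two summands are the invariant and the anti-invariant part under [tau], 2 being invertible.
    The alternative Q = 0 takes care of d < dh, where the subtraction of naturals truncates. *)
Lemma G_inv_dec d f : f \is d.-homog -> G_inv f -> exists P Q : T,
  [/\ f = ev_A P + ev_A Q * h0, P \is d.-homog for (weighted_mdeg wt) &
      Q = 0 \/ (dh <= d)%N /\ Q \is (d - dh).-homog for (weighted_mdeg wt)].
Proof.
move=> hf fG; have half2 (g : T) : (2%:R^-1)%:MP * g + (2%:R^-1)%:MP * g = g.
  have e2 : 2%:R^-1 + 2%:R^-1 = 1 :> K by field; rewrite ?two0.
  by rewrite -mulrDl -rmorphD e2 rmorph1 mul1r.
pose f1 := (2%:R^-1)%:MP * (f + tau f); pose f2 := (2%:R^-1)%:MP * (f - tau f).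
have ef : f = f1 + f2 by rewrite /f1 /f2 !mulrDr mulrN addrACA subrr addr0 half2.
have tG := G_inv_tau fG.
have hf1 : f1 \is d.-homog.
  by rewrite /f1 mul_mpolyC rpredZ // rpredD // tau_dhomog.
have hf2 : f2 \is d.-homog.
  by rewrite /f2 mul_mpolyC rpredZ // rpredB // tau_dhomog.
have Hf1 : H_inv f1.
  split=> [s ds|]; first by rewrite rmorphM rmorphD /= conj_actC (fG s ds) (tG s ds).
  by rewrite rmorphM rmorphD /= tauC tauK addrC.
have [P hP eP] := H_inv_ev hf1 Hf1.
have [||g Hg eg] := @anti_inv_div f2.
- by move=> s ds; rewrite rmorphM rmorphB /= conj_actC (fG s ds) (tG s ds).
- by rewrite rmorphM rmorphB /= tauC tauK -mulrN opprB.
have [f20|f20] := eqVneq f2 0.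
  exists P, 0; split=> //; last by left.
  by rewrite rmorph0 mul0r addr0 -eP ef f20 addr0.
have [le hg] := dhomog_quotient hf2 h0_dhomog eg f20.
have [Q hQ eQ] := H_inv_ev hg Hg.
exists P, Q; split=> //; last by right.
by rewrite -eP -eQ mulrC -eg.
Qed.

Lemma G_inv_decomp f : G_inv f -> exists P Q : T, f = ev_A P + ev_A Q * h0.
Proof.
move=> fG; rewrite (pihomog_partitionE (leqnn (msize f))).
elim/big_ind: _ => [|f1 f2 [P1 [Q1 ->]] [P2 [Q2 ->]]|j _].
- by exists 0, 0; rewrite rmorph0 mul0r addr0.
- by exists (P1 + P2), (Q1 + Q2); rewrite !rmorphD /=; ring.
have [P [Q [-> _ _]]] := G_inv_dec (pihomogP mdeg j f) (G_inv_pihomog j fG).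
by exists P, Q.
Qed.

(** * Algebraic independence *)

Lemma mmap_muni n (x : 'I_n.+1 -> T) (Q : {mpoly K[n.+1]}) :
  mmap (@mpolyC 3 K) x Q =
  (map_poly (mmap (@mpolyC 3 K) (fun i => x (widen_ord (leqnSn n) i))) (muni Q)).[x ord_max].
Proof.
pose g : {poly {mpoly K[n]}} -> T := fun p =>
  (map_poly (mmap (@mpolyC 3 K) (fun i => x (widen_ord (leqnSn n) i))) p).[x ord_max].
have gD : zmod_morphism g by move=> p1 p2; rewrite /g rmorphB hornerD hornerN.
have gM : monoid_morphism g.
  by split=> [|p1 p2]; rewrite /g ?rmorph1 ?hornerC // rmorphM hornerM.
pose gA := GRing.isZmodMorphism.Build _ _ g gD.
pose gB := GRing.isMonoidMorphism.Build _ _ g gM.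
pose G : {rmorphism {poly {mpoly K[n]}} -> T} := HB.pack g gA gB.
apply: (@mpoly_lrmorph_eq _ _ _ (mmap (@mpolyC 3 K) x) (G \o @muni n K)) => [k|i] /=.
  by rewrite muniC mmapC /g map_polyC hornerC /= mmapC.
rewrite mmapX mmap1U; case: (unliftP ord_max i) => [j ->|->]; last first.
  by rewrite muniXmax /g map_polyX hornerX.
have -> : lift ord_max j = widen_ord (leqnSn n) j.
  by apply: val_inj => /=; rewrite /bump leqNgt ltn_ord.
by rewrite muniXwiden /g map_polyC hornerC /= mmapX mmap1U.
Qed.

Lemma mmap_morph n (x : 'I_n -> T) (theta : {rmorphism T -> T}) (Q : {mpoly K[n]}) :
  (forall k, theta k%:MP = k%:MP) ->
  theta (mmap (@mpolyC 3 K) x Q) = mmap (@mpolyC 3 K) (theta \o x) Q.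
Proof.
move=> hC.
apply: (@mpoly_lrmorph_eq _ _ _ (theta \o mmap (@mpolyC 3 K) x)
  (mmap (@mpolyC 3 K) (theta \o x))) => [k|i] /=; first by rewrite !mmapC hC.
by rewrite !mmapX !mmap1U.
Qed.

Definition alg_indep n (x : 'I_n -> T) :=
  forall Q : {mpoly K[n]}, mmap (@mpolyC 3 K) x Q = 0 -> Q = 0.

(** Applying theta to a relation isolates its constant coefficient in the last variable, which is
    therefore zero; the nonzero last element is then cancelled, and the argument repeats. *)
Lemma alg_indep_step n (x : 'I_n.+1 -> T) (theta : {rmorphism T -> T}) :
  (forall k, theta k%:MP = k%:MP) -> theta (x ord_max) = 0 -> x ord_max != 0 ->
  alg_indep (fun i => theta (x (widen_ord (leqnSn n) i))) -> alg_indep x.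
Proof.
move=> hC h0' x0 ind Q; rewrite mmap_muni => h.
suff : muni Q = 0 by move/(congr1 (@multi K n)); rewrite muniK rmorph0.
move: h; elim/poly_ind: (muni Q) => [//|R k IH].
rewrite rmorphD rmorphM /= map_polyX map_polyC hornerD hornerM hornerX hornerC /= => h.
have k0 : k = 0.
  apply: ind; rewrite -(mmap_morph (fun i => x (widen_ord (leqnSn n) i)) k hC).
  by have := congr1 theta h; rewrite rmorphD rmorphM /= h0' mulr0 add0r rmorph0.
move: h; rewrite k0 mmap0 addr0 => /eqP; rewrite mulf_eq0 (negPf x0) orbF => /eqP /IH ->.
by rewrite mul0r add0r.
Qed.

Lemma alg_indep0 (x : 'I_0 -> T) : alg_indep x.
Proof.
move=> Q; rewrite [Q]nvar0_mpolyC mmapC => /eqP.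
by rewrite mpolyC_eq0 => /eqP ->; rewrite rmorph0.
Qed.

Lemma ev_A_inj : injective ev_A.
Proof.
suff h : alg_indep (tnth [tuple u_; w_; S0]).
  by move=> P Q e; apply/eqP; rewrite -subr_eq0; apply/eqP/h; rewrite -[LHS]/(ev_A _) rmorphB /= e subrr.
(* Restriction to the line through P0 inside the plane: w vanishes on it, while u becomes -delta
   c^2. *)
pose line := comp_mpoly [tuple (0%:MP * c : T); delta%:MP * c; 1%:MP * c].
have lineC k : line k%:MP = k%:MP by rewrite /line comp_mpolyC.
have lineE d f : f \is d.-homog -> line f = (f.@[pt P0])%:MP * c ^+ d.
  move=> hf; rewrite /line (dhomog_line 0 delta 1 c hf); congr (_%:MP * _).
  by apply: meval_eq; apply: forall_ord3; rewrite /pt !(tnth_nth 0) /= !mxE.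
have c0 : c != 0 :> T by rewrite -msize_poly_eq0 msizeX mdeg1.
apply: (alg_indep_step (theta := restr)).
- by move=> k; rewrite /= /restr elimC.
- rewrite (tnth_nth 0) /=; apply/restr_divides.
  by have [k -> _] := S0_factor; exists k.
- by rewrite (tnth_nth 0) /=; apply: half_prod_neq0; rewrite ?two0 ?delta0.
have lw : line (restr w_) = 0.
  rewrite (lineE _ _ (restr_dhomog w_dhomog)).
  rewrite (_ : (restr w_).@[_] = 0) ?rmorph0 ?mul0r //.
  have := meval_plane P0_plane (restr_congr w_); rewrite mevalB w_P0 sub0r => /eqP.
  by rewrite oppr_eq0 => /eqP.
have lu : line (restr u_) = (- delta)%:MP * c ^+ 2.
  rewrite (lineE _ _ (restr_dhomog u_dhomog)); congr (_%:MP * _).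
  have := meval_plane P0_plane (restr_congr u_); rewrite mevalB meval_u_P0 => /eqP.
  by rewrite subr_eq0 => /eqP <-.
apply: (alg_indep_step (theta := line)); first exact: lineC.
- by rewrite (tnth_nth 0); apply: lw.
- by rewrite (tnth_nth 0); apply: restr_w_neq0.
have lu' : line (restr (tnth [tuple u_; w_; S0] 0)) = (- delta)%:MP * c ^+ 2.
  by rewrite (tnth_nth 0); apply: lu.
have e0 : widen_ord (leqnSn 2) (widen_ord (leqnSn 1) ord_max) = 0 :> 'I_3 by apply: val_inj.
apply: (alg_indep_step (theta := comp_mpoly [tuple a; b; 0])).
- by move=> k; apply: comp_mpolyC.
- transitivity (comp_mpoly [tuple a; b; 0] ((- delta)%:MP * c ^+ 2)).
    by rewrite e0; apply: congr1 lu'.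
  by rewrite rmorphM rmorphXn /= comp_c expr0n mulr0.
- apply/eqP => h; have h' : line (restr (tnth [tuple u_; w_; S0] 0)) = 0.
    by rewrite -e0; apply: h.
  move/eqP: h'; rewrite lu' mulf_eq0 mpolyC_eq0 (negPf oppd0) expf_eq0 /=.
  by rewrite (negPf c0).
exact: alg_indep0.
Qed.

(** [tau] fixes the first term and negates the second, so each vanishes separately. *)
Lemma ev_A_h0_inj (P Q : T) : ev_A P + ev_A Q * h0 = 0 -> P = 0 /\ Q = 0.
Proof.
move=> e; have := congr1 (@tau K) e.
rewrite rmorphD rmorphM rmorph0 /= tau_h0 (H_inv_ev_A P).2 (H_inv_ev_A Q).2 => e'.
have two0T : 2%:R != 0 :> T by rewrite -(rmorph_nat (@mpolyC 3 K)) mpolyC_eq0 two0.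
have eP : ev_A P = 0.
  apply: (mulfI two0T); rewrite mulr0.
  transitivity ((ev_A P + ev_A Q * h0) + (ev_A P + ev_A Q * - h0)); first by ring.
  by rewrite e e' addr0.
move: e; rewrite eP add0r => /eqP; rewrite mulf_eq0 (negPf h0_neq0) orbF => /eqP eQ.
by split; apply: ev_A_inj; rewrite ?eP ?eQ rmorph0.
Qed.

(** * Unique factorization in the ring of invariants *)

(** A canonical associate, the units being the nonzero constants. Associated conjugates of a prime
    become equal, so that [undup] keeps one factor for each. *)
Definition nrm f : T := (mleadc f)^-1 *: f.

Lemma mleadc_neq0 f : f != 0 -> mleadc f != 0.
Proof. by rewrite mleadc_eq0. Qed.

Lemma nrm_assoc f : f != 0 -> associated f (nrm f).
Proof.
move=> f0; exists (mleadc f)^-1%:MP; last by rewrite /nrm -mul_mpolyC.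
by rewrite rmorph_unit // unitfE invr_eq0 mleadc_neq0.
Qed.

Lemma unit_const f : f \is a GRing.unit -> exists2 k, k != 0 & f = k%:MP.
Proof.
by case/andP => /eqP e u; exists f@_0; rewrite // -unitfE.
Qed.

Lemma nrm_eq f g : f != 0 -> associated f g -> nrm f = nrm g.
Proof.
move=> f0 [x xu ->]; have [k k0 ->] := unit_const xu.
by rewrite /nrm mul_mpolyC mleadcZE scalerA invfM mulrAC mulVf ?mul1r //.
Qed.

Lemma nrm_id f : nrm (nrm f) = nrm f.
Proof.
have [->|f0] := eqVneq f 0; first by rewrite /nrm scaler0 scaler0.
by rewrite -(nrm_eq f0 (nrm_assoc f0)).
Qed.

Lemma conj_assoc s f g : associated f g -> associated (conj_act s f) (conj_act s g).
Proof.
by case=> x xu ->; exists (conj_act s x); rewrite ?rmorph_unit // rmorphM.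
Qed.

Lemma assoc_trans (D : idomainType) (x y z : D) :
  associated x y -> associated y z -> associated x z.
Proof.
by case=> k ku -> [l lu ->]; exists (l * k); rewrite ?unitrM ?lu // mulrA.
Qed.

Lemma conjK s f : \det s = 1 -> conj_act (invmx s) (conj_act s f) = f.
Proof.
move=> ds; have su := det1_unit ds.
have siu : invmx s \in unitmx by rewrite unitmx_inv.
by rewrite (conj_actM f siu su) mulVmx // conj_act1.
Qed.

Lemma det1_inv s : \det s = 1 -> \det (invmx s) = 1.
Proof. by move=> ds; rewrite det_inv ds invr1. Qed.

Lemma conj_eq0 s f : \det s = 1 -> (conj_act s f == 0) = (f == 0).
Proof.
move=> ds; apply/eqP/eqP => [h|->]; last exact: rmorph0.
by rewrite -(conjK f ds) h rmorph0.
Qed.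

Lemma conj_divides s f g : divides f g -> divides (conj_act s f) (conj_act s g).
Proof. by case=> k ->; exists (conj_act s k); rewrite rmorphM. Qed.

Lemma conj_prime s f : \det s = 1 -> prime_elt f -> prime_elt (conj_act s f).
Proof.
move=> ds [f0 fu fp]; have ds' := det1_inv ds; split.
- by rewrite conj_eq0.
- apply/negP => h.
  have : conj_act (invmx s) (conj_act s f) \is a GRing.unit.
    exact: (rmorph_unit (conj_act (invmx s)) h).
  by rewrite (conjK f ds); apply/negP.
move=> x y /(conj_divides (invmx s)); rewrite (conjK f ds) rmorphM /=.
have back z : conj_act s (conj_act (invmx s) z) = z.
  by rewrite -{2}(conjK z ds') invmxK.
by case/fp => /(conj_divides s); rewrite back; [left|right].
Qed.

Section OrbitProduct.
Variable pi : T.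
Hypothesis pi_prime : prime_elt pi.

Definition orbit_seq : seq T := undup [seq nrm (conj_act s pi) | s <- enum (SL2 K)].
Definition orbit_prod : T := \prod_(y <- orbit_seq) y.

Lemma orbit_seqP y : reflect (exists2 s, \det s = 1 & y = nrm (conj_act s pi)) (y \in orbit_seq).
Proof.
rewrite mem_undup; apply: (iffP mapP) => -[s].
  by rewrite mem_enum inE => /eqP ds ->; exists s.
by move=> ds ->; exists s; rewrite // mem_enum inE ds.
Qed.

Lemma conj_pi_neq0 s : \det s = 1 -> conj_act s pi != 0.
Proof. by move=> ds; rewrite conj_eq0 //; case: pi_prime. Qed.

Lemma orbit_prime y : y \in orbit_seq -> prime_elt y.
Proof.
case/orbit_seqP => s ds ->; apply: (associated_prime (nrm_assoc (conj_pi_neq0 ds))).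
exact: conj_prime.
Qed.

Lemma orbit_nrm y : y \in orbit_seq -> nrm y = y.
Proof. by case/orbit_seqP => s ds ->; rewrite nrm_id. Qed.

Lemma orbit_conj s y : \det s = 1 -> y \in orbit_seq -> nrm (conj_act s y) \in orbit_seq.
Proof.
move=> ds /orbit_seqP[s' ds' ->]; apply/orbit_seqP; exists (s *m s').
  by rewrite det_mulmx ds ds' mulr1.
rewrite -(conj_actM pi (det1_unit ds) (det1_unit ds')).
apply/esym/nrm_eq; first by rewrite (conj_eq0 _ ds) (conj_pi_neq0 ds').
exact/conj_assoc/nrm_assoc/conj_pi_neq0.
Qed.

Lemma orbit_divides_eq y z : y \in orbit_seq -> z \in orbit_seq -> divides y z -> y = z.
Proof.
move=> hy hz h; have yp := orbit_prime hy.
have yz := divides_prime_irreducible yp (prime_irreducible (orbit_prime hz)) h.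
by rewrite -(orbit_nrm hy) -(orbit_nrm hz); apply: nrm_eq yz; case: yp.
Qed.

(** The normalised conjugates are permuted; k collects the leading coefficients removed by
    normalisation. *)
Lemma conj_orbit_prod s : \det s = 1 ->
  exists2 k, k != 0 & conj_act s orbit_prod = k%:MP * orbit_prod.
Proof.
move=> ds; pose F y := nrm (conj_act s y).
have n0 y : y \in orbit_seq -> conj_act s y != 0.
  by move=> hy; rewrite conj_eq0 //; case: (orbit_prime hy).
have sub : {subset map F orbit_seq <= orbit_seq}.
  by move=> _ /mapP[y hy ->]; apply: orbit_conj.
have injF : {in orbit_seq &, injective F}.
  move=> y z hy hz e0; apply: orbit_divides_eq => //.
  have h1 := assoc_trans (nrm_assoc (n0 y hy)) (y := F y) (z := conj_act s z).
  have h2 : associated (F y) (conj_act s z).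
    by rewrite e0; apply: associated_sym; apply: nrm_assoc (n0 z hz).
  have := associated_divides (conj_assoc (invmx s) (h1 h2)).
  by rewrite !conjK.
have uF : uniq (map F orbit_seq) by rewrite map_inj_in_uniq ?undup_uniq.
have pF : perm_eq (map F orbit_seq) orbit_seq.
  apply: (uniq_perm uF (undup_uniq _)).
  by have [] := uniq_min_size uF sub; rewrite ?size_map.
pose k : K := \prod_(y <- orbit_seq) mleadc (conj_act s y).
exists k.
  rewrite /k big_seq; elim/big_ind: _ => [|x y x0 y0|y hy]; first exact: oner_neq0.
    exact: mulf_neq0.
  exact: mleadc_neq0 (n0 y hy).
have eF : orbit_prod = \prod_(y <- orbit_seq) F y.
  by rewrite /orbit_prod -(perm_big _ pF) big_map.
rewrite {2}eF /orbit_prod rmorph_prod /k rmorph_prod -big_split /=.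
apply: eq_big_seq => y hy; rewrite /F /nrm -mul_mpolyC mulrA -rmorphM mulfV ?rmorph1 ?mul1r //.
exact: mleadc_neq0 (n0 y hy).
Qed.

Lemma orbit_prod_eq0 : (orbit_prod == 0) = false.
Proof.
apply/negbTE; rewrite /orbit_prod big_seq.
elim/big_ind: _ => [|x y x0 y0|y /orbit_prime[]//]; first exact: oner_neq0.
exact: mulf_neq0.
Qed.

Lemma det1_exp s n : \det s = 1 -> \det (s ^+ n) = 1.
Proof.
move=> ds; elim: n => [|n IH]; first by rewrite expr0 det1.
by rewrite exprS -[s * _]/(s *m _) det_mulmx ds IH mulr1.
Qed.

Lemma conj_iter_const s k f n : \det s = 1 -> conj_act s f = k%:MP * f ->
  conj_act (s ^+ n) f = (k ^+ n)%:MP * f.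
Proof.
move=> ds h; elim: n => [|n IH]; first by rewrite !expr0 conj_act1 rmorph1 mul1r.
have dn := det1_exp n ds.
rewrite exprS -[s * _]/(s *m _) -(conj_actM f (det1_unit ds) (det1_unit dn)) IH rmorphM /=.
by rewrite conj_actC h exprS rmorphM /=; ring.
Qed.

Lemma upperX t n : upper t ^+ n = upper (t *+ n).
Proof.
elim: n => [|n IH].
  by rewrite expr0 mulr0n /upper -mx2_scalar.
by rewrite exprS IH -[_ * _]/(_ *m _) upperD mulrS.
Qed.

Lemma lowerX t n : lower t ^+ n = lower (t *+ n).
Proof.
elim: n => [|n IH].
  by rewrite expr0 mulr0n /lower -mx2_scalar.
by rewrite exprS IH -[_ * _]/(_ *m _) lowerD mulrS.
Qed.

(* A character of G is trivial on the elementary matrices, which have order p. *)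
Lemma orbit_prod_fixed s : \det s = 1 -> s ^+ p = 1%:M -> conj_act s orbit_prod = orbit_prod.
Proof.
move=> ds sp; have [k k0 ek] := conj_orbit_prod ds.
have := conj_iter_const p ds ek; rewrite sp conj_act1 => /eqP.
rewrite -{1}[orbit_prod]mul1r (inj_eq (mulIf (negbT orbit_prod_eq0))).
move=> /eqP/(congr1 (mcoeff 0%MM)); rewrite mcoeff1 mcoeffC eqxx mulr1 => kp.
have : (k - 1) ^+ p = 0.
  have pK : [pchar K].-nat p by rewrite (eq_pnat _ (pcharf_eq pcharK)) pnat_id.
  by rewrite exprDn_pchar // exprNn_pchar // expr1n -kp subrr.
by move/eqP; rewrite expf_eq0 subr_eq0 => /andP[_ /eqP k1]; rewrite ek k1 rmorph1 mul1r.
Qed.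

Lemma mulrp t : t *+ p = 0.
Proof. by rewrite -mulr_natr (pcharf0 pcharK) mulr0. Qed.

Lemma G_inv_orbit_prod : G_inv orbit_prod.
Proof.
apply: G_inv_gen => t; apply: orbit_prod_fixed; rewrite ?det_upper ?det_lower //.
  by rewrite upperX mulrp /upper -mx2_scalar.
by rewrite lowerX mulrp /lower -mx2_scalar.
Qed.

Lemma orbit_prod_divides f : G_inv f -> divides pi f -> divides orbit_prod f.
Proof.
move=> fG h; rewrite /orbit_prod (eq_bigr (fun y => y ^+ 1)) //.
apply: prod_prime_divides => [|y|y z|y]; rewrite ?undup_uniq //.
- exact: orbit_prime.
- exact: orbit_divides_eq.
case/orbit_seqP => s ds ->; rewrite expr1.
apply: (divides_trans (associated_divides (associated_sym (nrm_assoc (conj_pi_neq0 ds))))).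
by rewrite -(fG s ds); apply: conj_divides.
Qed.

Lemma pi_divides_orbit_prod : divides pi orbit_prod.
Proof.
have pi0 : pi != 0 by case: pi_prime.
have hy : nrm pi \in orbit_seq.
  by apply/orbit_seqP; exists 1%:M; rewrite ?det1 ?conj_act1.
apply: (divides_trans (associated_divides (nrm_assoc pi0))).
rewrite /orbit_prod (big_rem _ hy) /=; apply/divides_mulr/divides_refl.
Qed.

End OrbitProduct.

Definition mkR f (fG : G_inv f) : inv_ring K := InvRing (introT (invariantP f) fG).

Lemma mkR_val f (fG : G_inv f) : val (mkR fG) = f. Proof. by []. Qed.

Lemma inv_val0 : val (0 : inv_ring K) = 0. Proof. exact: rmorph0. Qed.
Lemma inv_val1 : val (1 : inv_ring K) = 1. Proof. exact: rmorph1. Qed.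
Lemma inv_valM (x y : inv_ring K) : val (x * y) = val x * val y.
Proof. exact: rmorphM. Qed.
Lemma inv_valD (x y : inv_ring K) : val (x + y) = val x + val y.
Proof. exact: rmorphD. Qed.
Lemma inv_valZ k (x : inv_ring K) : val (k *: x) = k *: val x.
Proof. by rewrite linearZ. Qed.
Lemma inv_valX (x : inv_ring K) n : val (x ^+ n) = val x ^+ n.
Proof. exact: rmorphXn. Qed.
Lemma inv_val_eq0 (x : inv_ring K) : (val x == 0) = (x == 0).
Proof. by rewrite -inv_val0 (inj_eq val_inj). Qed.

Lemma inv_G (x : inv_ring K) : G_inv (val x).
Proof. by apply/invariantP/(valP x). Qed.

Lemma G_inv_quotient f g : f != 0 -> G_inv f -> G_inv (g * f) -> G_inv g.
Proof.
move=> f0 fG gG s ds; apply: (mulIf f0).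
by rewrite -{1}(fG s ds) -rmorphM /= gG.
Qed.

Lemma divides_inv (x y : inv_ring K) : x != 0 -> divides (val x) (val y) -> divides x y.
Proof.
move=> x0 [k ek]; have x0' : val x != 0 by rewrite inv_val_eq0.
have kG : G_inv k by apply: (G_inv_quotient x0' (@inv_G x)); rewrite -ek; apply: inv_G.
by exists (mkR kG); apply: val_inj; rewrite inv_valM /= ek.
Qed.

(** An invariant divisible by the prime pi of T is divisible by all its conjugates, hence by the
    orbit product, and the quotient is invariant. Primality of pi thus passes to the orbit product;
    splitting it off lowers the degree. *)
Lemma factorial_inv_ring : factorial_domain (inv_ring K).
Proof.
move=> x; have [n] := ubnP (msize (val x)); elim: n x => // n IH x; rewrite ltnS => hn x0 xu.
have val0 (y : inv_ring K) : y != 0 -> val y != 0.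
  by rewrite inv_val_eq0.
have unitR (y : inv_ring K) : y != 0 -> val y \is a GRing.unit -> y \is a GRing.unit.
  move=> y0 yu; have [k ek] : divides y 1.
    by apply: divides_inv => //; exists (val y)^-1; rewrite mulVr // inv_val1.
  by apply/unitrP; exists k; rewrite -ek mulrC -ek.
have xu' : val x \isn't a GRing.unit by apply: contra xu; apply: unitR.
have [[|pi s] sp es] := factorial_mpoly (val0 x x0) xu'.
  by move: xu'; rewrite es big_nil unitr1.
have pP := sp pi (mem_head _ _); have [_ pu pp'] := pP.
pose y := mkR (G_inv_orbit_prod pP).
have y0 : y != 0 by rewrite -inv_val_eq0 /= (negbT (orbit_prod_eq0 pP)).
have px : divides pi (val x).
  by exists (\prod_(z <- s) z); rewrite es big_cons mulrC.
have [z ez] : divides y x.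
  by apply: divides_inv => //; apply: (orbit_prod_divides pP) px; apply: inv_G.
have nyu : orbit_prod pi \isn't a GRing.unit.
  by apply: contra pu; apply: divides_unit (pi_divides_orbit_prod pP).
have yP : prime_elt y.
  split=> //.
  move=> u1 u2 [k ek]; have /pp' : divides pi (val u1 * val u2).
    rewrite -inv_valM ek inv_valM; apply: divides_mull; exact: pi_divides_orbit_prod.
  case=> /(orbit_prod_divides pP (@inv_G _)) h; [left|right]; exact: divides_inv.
have z0 : z != 0 by apply: contraNneq x0 => z0; rewrite ez z0 mul0r.
have [zu|zu] := boolP (z \is a GRing.unit).
  exists [:: x]; last by rewrite big_seq1.
  move=> w; rewrite inE => /eqP ->; apply: associated_prime yP.
  by exists z.
have [|s' s'p es'] := IH z _ z0 zu.
  have := msizeM (val0 z z0) (val0 y y0).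
  rewrite -inv_valM -ez /= => es'.
  have : (1 < msize (orbit_prod pi))%N.
    rewrite ltnNge; apply: contra nyu => le; rewrite (msize1_polyC le).
    have : orbit_prod pi != 0 by rewrite (negbT (orbit_prod_eq0 pP)).
    rewrite {1}(msize1_polyC le) mpolyC_eq0 => k0.
    by rewrite rmorph_unit // unitfE.
  move: hn; rewrite es'; case: (msize (orbit_prod pi)) => [|[|j]] // hj _.
  by apply: leq_trans hj; rewrite !addnS /= ltnS leq_addr.
exists (y :: s'); last by rewrite big_cons -es' ez mulrC.
by move=> w; rewrite inE => /orP[/eqP->|/s'p].
Qed.

(** * Failure of F-regularity *)

Lemma euler_dhomog d f : f \is d.-homog ->
  \sum_(i < 3) 'X_i * f^`M(i) = d%:R * f.
Proof.
move=> /dhomogP h.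
have mono (m : 'X_{1..3}) (i : 'I_3) : 'X_i * ('X_[m] : T)^`M(i) = (m i)%:R *: 'X_[m].
  rewrite mderivX -scalerAr -mpolyXD; case e0: (m i) => [|j]; first by rewrite !scale0r.
  congr (_ *: 'X_[_]); apply/mnmP => l; rewrite mnmDE mnmBE mnm1E.
  by case: eqP => [<-|_]; rewrite ?subn0 // e0 add1n subn1.
rewrite {1 2}[f]mpolyE mulr_sumr.
under eq_bigr => i _ do rewrite raddf_sum mulr_sumr.
rewrite exchange_big /=; apply: eq_big_seq => m /h /= <-.
under eq_bigr => i _ do rewrite mderivZ -scalerAr mono.
rewrite -scaler_sumr -scaler_suml -natr_sum -mdegE scaler_nat -scalerAr.
by rewrite mulr_natl.
Qed.

Lemma var_prime (i : 'I_3) : prime_elt ('X_i : T).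
Proof.
have P N x : \tr N = 0 -> N != 0 -> x \is a GRing.unit -> trf N = x * 'X_i -> prime_elt ('X_i : T).
  move=> tN N0' xu e0; have := trf_prime two0 tN N0'; apply: associated_prime.
  by apply: associated_sym; exists x.
move: i P; apply: forall_ord3 => P.
- apply: (P (refl1 K) 2%:R%:MP); rewrite ?mx2_tr ?subrr ?trf_refl1 //.
    by apply/eqP => /matrixP/(_ 0 0); rewrite !mxE /= => /eqP; rewrite oner_eq0.
  by rewrite rmorph_unit // unitfE two0.
- apply: (P (mx2 0 0 1 0) 1); rewrite ?mx2_tr ?addr0 ?unitr1 ?mul1r // -?trf_b //.
  by apply/eqP => /matrixP/(_ 1 0); rewrite !mxE /= => /eqP; rewrite oner_eq0.
- apply: (P (mx2 0 1 0 0) 1); rewrite ?mx2_tr ?addr0 ?unitr1 ?mul1r // -?trf_c //.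
  by apply/eqP => /matrixP/(_ 0 1); rewrite !mxE /= => /eqP; rewrite oner_eq0.
Qed.

(** Exactness of the Koszul complex of a, b, c. Modulo a the relation reads b y + c z = 0, so c
    divides y there; lifting back and cancelling a gives x. *)
Lemma koszul (x y z : T) : a * x + b * y + c * z = 0 ->
  exists j m l : T, [/\ x = - b * j - c * m, y = a * j + c * l & z = a * m - b * l].
Proof.
move=> h; pose e0 : {rmorphism T -> T} := comp_mpoly [tuple (0 : T); b; c].
have e0a : e0 a = 0 by rewrite /e0 /= comp_a.
have e0b : e0 b = b by rewrite /e0 /= comp_b.
have e0c : e0 c = c by rewrite /e0 /= comp_c.
have e0P f : divides a (f - e0 f).
  rewrite -[X in X - _]comp_mpoly_id; apply: comp_mpoly_congr; first exact: divides_ideal.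
  apply: forall_ord3; rewrite (tnth_mktuple _ _) (tnth_nth 0) /= ?subrr ?subr0;
    try exact: divides0.
  exact: divides_refl.
have a0 : a != 0 :> T by have [] := var_prime 0.
have c0 : c != 0 :> T by have [] := var_prime 2%:R.
have b_neq0 : b != 0 :> T by have [] := var_prime 1.
have [cu cp] : c \isn't a GRing.unit /\ forall f g, divides c (f * g) -> divides c f \/ divides c g.
  by have [_ cu cp] := var_prime 2%:R.
have h' : b * e0 y + c * e0 z = 0.
  by have := congr1 e0 h; rewrite rmorph0 !rmorphD !rmorphM /= e0a e0b e0c mul0r add0r.
have [l el] : divides c (e0 y).
  have : divides c (b * e0 y).
    by exists (- e0 z); apply/eqP; rewrite -subr_eq0 mulNr opprK mulrC [_ * c]mulrC mulrC h'.
  case/cp => // -[j ej].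
  have := congr1 (comp_mpoly [tuple a; b; (0 : T)]) ej.
  rewrite rmorphM /= comp_b comp_c mulr0 => b0.
  by rewrite b0 eqxx in b_neq0.
have ez : e0 z = - b * l.
  by apply: (mulfI c0); apply/eqP; rewrite -subr_eq0 -h' el; apply/eqP; ring.
have [m1 em1] := e0P y; have [m2 em2] := e0P z.
have ey : y = a * m1 + c * l by rewrite -[y](subrK (e0 y)) em1 el; ring.
have ez' : z = a * m2 - b * l by rewrite -[z](subrK (e0 z)) em2 ez; ring.
exists m1, m2, l; split=> //.
apply: (mulfI a0); apply/eqP; rewrite -subr_eq0 -h ey ez'; apply/eqP; ring.
Qed.

(** The degree of S0 is a multiple of q, hence zero in K, and Euler's formula makes the gradient a
    syzygy of (a, b, c). The coefficients come from substituting its Koszul expression into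
    [h0E]. *)
Lemma h0_ideal : exists al be : T, h0 = al * u_ + be * v_.
Proof.
have : a * S0^`M(0) + b * S0^`M(1) + c * S0^`M(2%:R) = 0.
  by rewrite -(big_ord3 (fun i => 'X_i * S0^`M(i))) (euler_dhomog S0_dhomog) natrM natqT !mul0r.
case/koszul => j [m [l [e0 e1 e2]]].
exists (2%:R * b ^+ q * j - 2%:R * c ^+ q * m - 4%:R * a ^+ q * l), (- b * j + c * m + 2%:R * a * l).
by rewrite h0E e0 e1 e2 v_E /u_ /det_form; ring.
Qed.

(** * Dedekind's independence of characters and the transfer *)

Lemma multiplicative_independence (D : idomainType) (I : eqType) (chi : I -> D -> D)
    (s : seq I) (w : I -> D) :
  (forall i, chi i 1 = 1) -> (forall i, {morph chi i : x y / x * y}) -> uniq s ->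
  (forall i j, i \in s -> j \in s -> i != j -> exists x, chi i x != chi j x) ->
  (forall x, \sum_(i <- s) w i * chi i x = 0) -> forall i, i \in s -> w i = 0.
Proof.
move=> c1 cM; elim: s w => // i s IH w /= /andP[nis us] sep h.
have ws j : j \in s -> w j = 0.
  move=> js; have ij : i != j by apply: contraNneq nis => ->.
  have [|x0 nx0] := sep i j (mem_head _ _) _ ij; first by rewrite inE js orbT.
  (* The relation at x0 x minus [chi i x0] times the relation at x: the term of i cancels. *)
  have h' x : \sum_(l <- s) (w l * (chi l x0 - chi i x0)) * chi l x = 0.
    have := h (x0 * x); have := h x; rewrite !big_cons => hx hx0.
    have : w i * chi i (x0 * x) + \sum_(l <- s) w l * chi l (x0 * x) -
        chi i x0 * (w i * chi i x + \sum_(l <- s) w l * chi l x) = 0.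
      by rewrite hx0 hx mulr0 subr0.
    rewrite cM mulrDr opprD addrACA (mulrCA (chi i x0)) subrr add0r mulr_sumr -sumrB.
    move=> e0; rewrite -[RHS]e0; apply: eq_bigr => l _; rewrite cM; ring.
  have := IH (fun l => w l * (chi l x0 - chi i x0)) us _ h' j js.
  have sep' l l' : l \in s -> l' \in s -> l != l' -> exists x, chi l x != chi l' x.
    by move=> ls l's; apply: sep; rewrite inE ?ls ?l's orbT.
  move/(_ sep')/eqP; rewrite mulf_eq0 subr_eq0 [chi j x0 == _]eq_sym (negPf nx0) orbF.
  by move/eqP.
move=> j; rewrite inE => /orP[/eqP ->|/ws //].
have := h 1; rewrite big_cons c1 mulr1 big_seq big1 ?addr0 // => l ls.
by rewrite ws // mul0r.
Qed.

Definition trace f : T := \sum_(s in SL2 K) conj_act s f.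

Lemma SL2P s : (s \in SL2 K) = (\det s == 1). Proof. by rewrite inE. Qed.

Lemma G_inv_trace f : G_inv (trace f).
Proof.
move=> s ds; have su := det1_unit ds; rewrite /trace raddf_sum /=.
rewrite [RHS](reindex_inj (can_inj (mulKmx su))) /=; apply: eq_big => s'.
  by rewrite !SL2P det_mulmx ds mul1r.
by rewrite SL2P => /eqP ds'; rewrite (conj_actM f su (det1_unit ds')).
Qed.

Lemma trace_linear f g : G_inv g -> trace (f * g) = trace f * g.
Proof.
move=> gG; rewrite /trace mulr_suml; apply: eq_bigr => s; rewrite SL2P => /eqP ds.
by rewrite rmorphM /= (gG s ds).
Qed.

Lemma traceD f g : trace (f + g) = trace f + trace g.
Proof. by rewrite /trace -big_split; apply: eq_bigr => s _; rewrite rmorphD. Qed.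

Lemma SL2_neq0 s : s \in SL2 K -> s != 0.
Proof.
rewrite SL2P; apply: contraTneq => ->; rewrite -(scale0r (0 : 'M[K]_2)) det_mx2Z.
by rewrite expr0n mul0r eq_sym oner_eq0.
Qed.

Lemma SL2N s : s \in SL2 K -> - s \in SL2 K.
Proof. by rewrite !SL2P det_mx2N. Qed.

Lemma conj_act_opp s f : \det s = 1 -> conj_act (- s) f = conj_act s f.
Proof.
move=> ds; rewrite -scaleN1r; apply: conj_act_scale; last exact: det1_unit.
exact: opp1_neq0.
Qed.

(** s and -s act alike, so independence of characters is available only after passing to
    representatives modulo sign; the factor 2 is harmless. *)
Lemma trace_half f : trace f = 2%:R * \sum_(s in halfset (SL2 K)) conj_act s f.
Proof.
rewrite /trace (bigID (mem (halfset (SL2 K)))) /= mulr_natl mulr2n; congr (_ + _).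
  by apply: eq_bigl => s; rewrite !halfE andbA andbb.
rewrite (reindex_inj (@oppr_inj _)) /=; apply: eq_big => s.
  apply/andP/idP => [[h1]|h1].
    have hs : s \in SL2 K by rewrite -[s]opprK; apply: SL2N h1.
    by rewrite (half_opp two0 (SL2_neq0 hs) hs h1) negbK.
  have hs := half_sub h1; have h2 := SL2N hs.
  by rewrite (half_opp two0 (SL2_neq0 hs) hs h2) h2 h1.
by case/andP => /SL2N; rewrite opprK SL2P => /eqP ds _; apply: conj_act_opp.
Qed.

(** A matrix acting trivially commutes with all traceless matrices, so it is scalar, and determinant
    1 leaves only 1 and -1. *)
Lemma conj_act_separates s s' : s \in halfset (SL2 K) -> s' \in halfset (SL2 K) ->
  s != s' -> exists f, conj_act s f != conj_act s' f.
Proof.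
move=> hs hs' ne; have := half_sub hs; have := half_sub hs'.
rewrite !SL2P => /eqP ds' /eqP ds; have su := det1_unit ds; have su' := det1_unit ds'.
apply: NNPP => nex.
have same f : conj_act s f = conj_act s' f.
  by apply/eqP; apply: contraT => h; case: nex; exists f.
pose t := invmx s' *m s.
have tu : t \in unitmx by rewrite unitmx_mul unitmx_inv su'.
have dt : \det t = 1 by rewrite det_mulmx det_inv ds ds' invr1 mulr1.
have tid f : conj_act t f = f.
  by rewrite -(conj_actM f _ su) ?unitmx_inv // same; apply: conjK.
have comm N : \tr N = 0 -> t *m N = N *m t.
  move=> tN; have tN' : \tr (t *m N *m invmx t) = 0 by rewrite mxtrace_mulC mulmxA mulVmx // mul1mx.
  have : t *m N *m invmx t - N = 0.
    apply: (trf_inj0 two0); first by rewrite linearB /= tN tN' subrr.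
    by rewrite trfD trfN -conj_act_trf // tid subrr.
  by move/eqP; rewrite subr_eq0 => /eqP h; rewrite -[in RHS]h mulmxKV.
have eB := comm (mx2 0 1 0 0) (etrans (mx2_tr _ _ _ _) (addr0 _)).
have eC := comm (mx2 0 0 1 0) (etrans (mx2_tr _ _ _ _) (addr0 _)).
have [x et] : exists x : K, t = x%:M.
  exists (t 0 0); move: eB eC; rewrite [t]mx2E; move: (t 0 0) (t 0 1) (t 1 0) (t 1 1) => x y z w.
  rewrite !mx2M !mxE /= !mulr0 !mul0r !mulr1 !mul1r !addr0 !add0r mx2_scalar.
  by move=> /mx2_inj[e1 e2 _ _] /mx2_inj[e4 _ _ _]; rewrite -e1 -e2 e4.
have es : s = x *: s' by rewrite -mul_mx_scalar -et mulKVmx.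
move: ds; rewrite es det_mx2Z ds' mulr1 => /eqP; rewrite -[1](expr1n _ 2) eqf_sqr.
case/orP => /eqP ex; move: ne; rewrite es ex ?scale1r ?eqxx // => _.
move: hs; rewrite es ex scaleN1r.
by rewrite half_opp ?two0 ?SL2_neq0 ?SL2N ?(half_sub hs') // hs'.
Qed.

(** The transfer of 1 is the order of G, which is zero in K; a nonzero value is obtained from the
    independence of the automorphisms instead. *)
Lemma trace_neq0 : exists f, trace f != 0.
Proof.
apply: NNPP => nex.
have h f : \sum_(s <- enum (halfset (SL2 K))) 1 * conj_act s f = 0.
  have : trace f = 0 by apply/eqP; apply: contraT => h; case: nex; exists f.
  rewrite trace_half => /eqP; rewrite mulf_eq0 -(rmorph_nat (@mpolyC 3 K)) mpolyC_eq0.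
  rewrite (negPf two0) /= => /eqP e0; rewrite -[RHS]e0 -big_enum /=.
  by apply: eq_bigr => s _; rewrite mul1r.
have [s hs] : exists s, s \in halfset (SL2 K).
  have h1 : 1%:M \in SL2 K by rewrite SL2P det1.
  have [|h2] := boolP (1%:M \in halfset (SL2 K)); first by exists 1%:M.
  exists (- 1%:M); rewrite (half_opp two0 (SL2_neq0 h1) h1 (SL2N h1)); exact: h2.
suff : (1 : T) = 0 by move/eqP; rewrite oner_eq0.
apply: (@multiplicative_independence _ _ (@conj_act K) (enum (halfset (SL2 K))) (fun=> 1)
   _ _ _ _ h s); rewrite ?enum_uniq ?mem_enum //.
- by move=> i; rewrite rmorph1.
- by move=> i x y; rewrite rmorphM.
- by move=> i j; rewrite !mem_enum; apply: conj_act_separates.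
Qed.

(** The anti-invariant parts of al and be are multiples of h0. Taking the anti-invariant part of the
    equation and cancelling h0 leaves 2 = g1 u + g2 v, which is absurd at the origin. *)
Lemma h0_not_in_ideal (al be : T) : G_inv al -> G_inv be -> h0 != al * u_ + be * v_.
Proof.
move=> aG bG; apply/eqP => e0.
have anti f : G_inv f -> exists2 g, H_inv g & f - tau f = h0 * g.
  move=> fG; apply: anti_inv_div; last by rewrite rmorphB /= tauK opprB.
  by move=> s ds; rewrite rmorphB /= (fG s ds) (G_inv_tau fG ds).
have [g1 _ eg1] := anti al aG; have [g2 _ eg2] := anti be bG.
have : h0 * 2%:R = h0 * (g1 * u_ + g2 * v_).
  transitivity (h0 - tau h0); first by rewrite tau_h0; ring.
  transitivity ((al - tau al) * u_ + (be - tau be) * v_).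
    by rewrite e0 rmorphD !rmorphM /= tau_u tau_v; ring.
  by rewrite eg1 eg2; ring.
move/(mulfI h0_neq0)/(congr1 (meval (pt (0 : 'M[K]_2)))).
have t0 : \tr (0 : 'M[K]_2) = 0 by rewrite linear0.
have d0 : \det (0 : 'M[K]_2) = 0 by rewrite -(scale0r (0 : 'M[K]_2)) det_mx2Z expr0n mul0r.
rewrite rmorph_nat mevalD !mevalM (meval_u t0) (meval_v t0) d0 !mulr0 addr0 => /eqP.
by rewrite (negPf two0).
Qed.

Lemma not_F_regular : ~ F_regular p (inv_ring K).
Proof.
move=> Freg.
(* The ring is its own localization at 1, so [F_regular] says in particular that its own ideals are
   tightly closed. *)
have loc : @is_localization (inv_ring K) (inv_ring K) (fun x => x = 1) idfun.
  split=> [|w ->|s|r]; first by split=> // v w -> ->; rewrite mulr1.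
  - by exists 1; rewrite mulr1.
  - by exists s, 1; rewrite mulr1.
  - split=> [h|[w -> h]]; first by exists 1; rewrite // mul1r.
    by move: h; rewrite mul1r.
pose uR := mkR G_inv_u; pose vR := mkR G_inv_v; pose hR := mkR G_inv_h0.
pose I (x : inv_ring K) := exists al be, x = al * uR + be * vR.
have Iid : is_ideal I.
  split=> [|x y [x1 [x2 ->]] [y1 [y2 ->]]|r x [x1 [x2 ->]]].
  - by exists 0, 0; rewrite !mul0r addr0.
  - by exists (x1 + y1), (x2 + y2); rewrite !mulrDl addrACA.
  - by exists (r * x1), (r * x2); rewrite mulrDr !mulrA.
have nI : ~ I hR.
  move=> [al [be /(congr1 val)]]; rewrite inv_valD !inv_valM /= => e0.
  by have /eqP := h0_not_in_ideal (@inv_G al) (@inv_G be).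
apply: nI; apply: (Freg _ _ _ loc I Iid); have [m m0] := trace_neq0.
have [al [be ehu]] := h0_ideal.
exists (mkR (G_inv_trace m)).
  (* In a domain the zero ideal is prime, so a minimal prime is zero and any nonzero multiplier is
     admissible. *)
  move=> P [[Pid _ _] Pmin] Pc.
  suff : mkR (G_inv_trace m) = 0 by move/eqP; rewrite -inv_val_eq0 /= (negPf m0).
  apply: (Pmin (fun x => x = 0) _ _ _ Pc); last by move=> x ->; case: Pid.
  split; first by split=> [//|x y -> ->|r x ->]; rewrite ?addr0 ?mulr0.
    by move/eqP; rewrite oner_eq0.
  by move=> x y /eqP; rewrite mulf_eq0 => /orP[] /eqP; [left|right].
exists 0%N => n _; set Q := (p ^ n)%N.
pose R (i : 'I_2) : inv_ring K := if i == 0 then mkR (G_inv_trace (m * al ^+ Q))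
  else mkR (G_inv_trace (m * be ^+ Q)).
pose S (i : 'I_2) : inv_ring K := if i == 0 then uR ^+ Q else vR ^+ Q.
exists 2%N, R, S; split=> [i|].
  rewrite /S; case: ifP => _; [exists uR|exists vR] => //.
    by exists 1, 0; rewrite mul1r mul0r addr0.
  by exists 0, 1; rewrite mul1r mul0r add0r.
have -> : \sum_(i < 2) R i * S i = mkR (G_inv_trace (m * al ^+ Q)) * uR ^+ Q +
    mkR (G_inv_trace (m * be ^+ Q)) * vR ^+ Q.
  by rewrite !big_ord_recl big_ord0 addr0.
apply: val_inj; rewrite inv_valD !inv_valM !inv_valX !mkR_val.
have gX f : G_inv f -> G_inv (f ^+ Q) by move=> fG s ds; rewrite rmorphXn /= (fG s ds).
rewrite -!trace_linear; [|exact: gX G_inv_v|exact: gX G_inv_u|exact: gX G_inv_h0].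
rewrite -traceD ehu; congr trace.
have pQ : [pchar T].-nat Q by rewrite (eq_pnat _ (pcharf_eq pcharT)) pnatX pnat_id ?orbT.
by rewrite exprDn_pchar // !exprMn mulrDr !mulrA.
Qed.

(** * The algebra generated by the invariants *)

Lemma jacobian_scale r : jacobian u_ v_ (r%:MP * S0) = r%:MP * h0.
Proof.
rewrite /h0 !jacobianE !mul_mpolyC !mderivZ -!mul_mpolyC; move: (r%:MP) => x.
move: (S0^`M(0)) (S0^`M(1)) (S0^`M(2)) (u_^`M(0)) (u_^`M(1)) (u_^`M(2)) (v_^`M(0)) (v_^`M(1)) (v_^`M(2)).
by move=> *; ring.
Qed.

Lemma mmap_eq n (R : nzRingType) (f : K -> R) (x y : 'I_n -> R) (Q : {mpoly K[n]}) :
  x =1 y -> mmap f x Q = mmap f y Q.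
Proof.
by move=> e; apply: eq_bigr => m _; congr (_ * _); apply: mmap1_eq.
Qed.

Lemma G_inv_comp n (t : n.-tuple T) (Q : {mpoly K[n]}) :
  (forall i, G_inv (tnth t i)) -> G_inv (Q \mPo t).
Proof.
move=> ht s ds.
rewrite /comp_mpoly (mmap_morph (theta := conj_act s) (tnth t) Q (fun k => conj_actC s k)).
by apply: mmap_eq => i /=; apply: ht.
Qed.

Lemma in_subalgebra_invariant (s : T) : s ^+ 2 = f4_tilde delta -> forall f,
  f \in @invariant_pred K <-> in_subalgebra [tuple u_; v_; s; jacobian u_ v_ s] f.
Proof.
move=> /sqrt_f4_unique[r r0 ->] f; rewrite jacobian_scale.
have GC k : G_inv k%:MP by move=> g dg; rewrite conj_actC.
have rr : (r^-1)%:MP * r%:MP = 1 :> T by rewrite -rmorphM mulVf // rmorph1.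
split=> [/invariantP fG|[P ->]]; last first.
  apply/invariantP; apply: G_inv_comp => i.
  have GS : G_inv (r%:MP * S0).
    by move=> g dg; rewrite rmorphM /= (GC r g dg) (H_inv_S0.1 g dg).
  have Gh : G_inv (r%:MP * h0).
    by move=> g dg; rewrite rmorphM /= (GC r g dg) (G_inv_h0 dg).
  case: i => -[|[|[|[|//]]]] lt; rewrite (tnth_nth 0) /=.
  - exact: G_inv_u.
  - exact: G_inv_v.
  - exact: GS.
  - exact: Gh.
have [P [Q ->]] := G_inv_decomp fG.
pose X (i : nat) : {mpoly K[4]} := 'X_(inord i).
pose t := [tuple u_; v_; r%:MP * S0; r%:MP * h0].
(* Expresses u, w, S0 through the stated generators: w = v + 2 u^((q+1)/2), and S0 is the given
   square root divided by r. *)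
pose t' := [tuple X 0%N; X 1%N + 2%:R * X 0%N ^+ (q./2).+1; (r^-1)%:MP * X 2%N].
have tX (i : 'I_4) : X i \mPo t = nth 0 t i.
  by rewrite /X inord_val comp_mpolyXU.
have tC k : k%:MP \mPo t = k%:MP by apply: comp_mpolyC.
have eA (Z : T) : (Z \mPo t') \mPo t = ev_A Z.
  apply: (@mpoly_lrmorph_eq K _ _ (comp_mpoly t \o comp_mpoly t') ev_A) => [k|] /=.
    by rewrite !comp_mpolyC ev_AC.
  apply: forall_ord3; rewrite /= comp_mpolyXU /=.
  - by rewrite (tX 0); have := ev_Aa => /= ->.
  - rewrite rmorphD rmorphM rmorph_nat rmorphXn /= (tX 0) (tX 1).
    by have := ev_Ab => /= ->.
  rewrite rmorphM /= tC (tX 2) /= mulrA rr mul1r.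
  by have := ev_Ac => /= ->.
exists ((P \mPo t') + (Q \mPo t') * ((r^-1)%:MP * X 3%N)).
rewrite rmorphD !rmorphM /= !eA tC (tX 3) /=.
by rewrite [_ * (r%:MP * h0)]mulrA rr mul1r.
Qed.

(** * The hypersurface presentation *)

Definition uR : inv_ring K := mkR G_inv_u.
Definition wR : inv_ring K := mkR H_inv_w.1.
Definition sR : inv_ring K := mkR H_inv_S0.1.
Definition hR : inv_ring K := mkR G_inv_h0.

Lemma alg_eval_val n (x : 'I_n -> inv_ring K) (Q : {mpoly K[n]}) :
  val (alg_eval x Q) = mmap (@mpolyC 3 K) (val \o x) Q.
Proof.
pose vm : {rmorphism inv_ring K -> T} := val.
apply: (@mpoly_lrmorph_eq _ _ _ (vm \o mmap (in_alg (inv_ring K)) x)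
  (mmap (@mpolyC 3 K) (val \o x))) => [k|i] /=.
  rewrite !mmapC; have := inv_valZ k 1; rewrite inv_val1 -mul_mpolyC mulr1; apply.
by rewrite !mmapX !mmap1U.
Qed.

Definition xR : 'I_3 -> inv_ring K := tnth [tuple uR; wR; sR].
Definition yR : 'I_4 -> inv_ring K := tnth [tuple uR; wR; sR; hR].
Definition wt4 : 'I_4 -> nat := tnth [tuple 2%N; q.+1; (q * q./2)%N; dh].

Lemma xR_val Q : val (alg_eval xR Q) = ev_A Q.
Proof.
rewrite alg_eval_val; apply: mmap_eq; apply: forall_ord3 => /=; rewrite /xR !(tnth_nth 0) //.
Qed.

Lemma yR_val (Q : {mpoly K[4]}) : val (alg_eval yR Q) = (map_poly ev_A (muni Q)).[h0].
Proof.
rewrite alg_eval_val mmap_muni; have -> : (val \o yR) ord_max = h0 by [].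
have -> : map_poly (mmap (@mpolyC 3 K) (fun i => (val \o yR) (widen_ord (leqnSn 3) i))) (muni Q) =
    map_poly ev_A (muni Q); last by [].
apply: eq_map_poly => R.
rewrite -[RHS]/(mmap (@mpolyC 3 K) (tnth [tuple u_; w_; S0]) R).
apply: mmap_eq; apply: forall_ord3 => //=.
Qed.

Lemma alg_eval_xR (P Q : T) : alg_eval xR P = alg_eval xR Q -> P = Q.
Proof. by move=> e0; apply: ev_A_inj; rewrite -!xR_val e0. Qed.

Lemma h0_sq : exists2 F0 : T, F0 \is (dh * 2).-homog for (weighted_mdeg wt) &
  h0 ^+ 2 = ev_A F0.
Proof.
apply: H_inv_ev; first by apply: dhomogMn; apply: h0_dhomog.
split=> [s ds|]; first by rewrite rmorphXn /= (G_inv_h0 ds).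
by rewrite rmorphXn /= tau_h0 sqrrN.
Qed.

Lemma poly_mod_sq (F0 : T) (P : {poly T}) : exists (Z : {poly T}) (A B : T),
  P = Z * ('X^2 - F0%:P) + B%:P * 'X + A%:P.
Proof.
elim/poly_ind: P => [|P k [Z [A [B ->]]]].
  by exists 0, 0, 0; rewrite !mul0r !add0r.
exists (Z * 'X + B%:P), (k + B * F0), A.
rewrite rmorphD rmorphM /=.
by ring.
Qed.

Lemma muni_quadric n (F0 : {mpoly K[n]}) :
  muni ('X_ord_max ^+ 2 - mwiden F0) = 'X^2 - F0%:P.
Proof. by rewrite muniB muni_mwiden !expr2 muniM muniXmax. Qed.

Lemma mwiden_wt4 d (F0 : T) : F0 \is d.-homog for (weighted_mdeg wt) ->
  mwiden F0 \is d.-homog for (weighted_mdeg wt4).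
Proof.
move/dhomogP => h; rewrite {1}(mpolyE F0) big_seq rmorph_sum rpred_sum //= => m /h <-.
rewrite mwidenZ rpredZ // mwidenX dhomogX.
suff eW : weighted_mdeg wt4 (mnmwiden m) = weighted_mdeg wt m by apply/eqP.
rewrite /weighted_mdeg big_ord_recr /= mnmwiden_ordmax mul0n addn0.
apply: eq_bigr => i _; rewrite mnmwiden_widen; congr (_ * _)%N.
by move: i; apply: forall_ord3; rewrite /wt /wt4 !(tnth_nth 0%N).
Qed.

Lemma wt4_dhomog d (P : {mpoly K[4]}) : P \is d.-homog for (weighted_mdeg wt4) ->
  alg_eval yR P \in inv_grading d.
Proof.
move=> h; rewrite inE alg_eval_val.
have := @dhomog_weighted_comp 4 wt4 [tuple u_; w_; S0; h0] d P.
rewrite /comp_mpoly; set x := tnth _; rewrite (mmap_eq _ _ (y := x)); last first.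
  by case=> -[|[|[|[|//]]]] lt; rewrite /x /= /yR !(tnth_nth 0).
apply=> //; case=> -[|[|[|[|//]]]] lt; rewrite /x !(tnth_nth 0) /wt4 (tnth_nth 0%N) /=.
- exact: u_dhomog.
- exact: w_dhomog.
- exact: S0_dhomog.
- exact: h0_dhomog.
Qed.

Lemma q_half_gt0 : (0 < q./2)%N.
Proof. by move: q_gt1; rewrite q_half; case: (q./2). Qed.

(** The equation is h^2 = F0(u, w, S0). A relation is reduced modulo this monic quadratic in the
    last variable; its remainder A + B h is zero by [ev_A_h0_inj]. *)
Lemma inv_hypersurface : is_hypersurface (@inv_grading K).
Proof.
have [F0 hF0 eF0] := h0_sq.
pose phi0 : {mpoly K[4]} -> inv_ring K := mmap (in_alg (inv_ring K)) yR.
have phiD : zmod_morphism phi0 by move=> P Q; rewrite /phi0 rmorphB.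
have phiM : monoid_morphism phi0 by split=> [|P Q]; rewrite /phi0 ?rmorph1 ?rmorphM.
have phiZ : scalable phi0 by move=> k P; rewrite /phi0 mmapZ /= mulr_algl.
pose pA := GRing.isZmodMorphism.Build _ _ phi0 phiD.
pose pB := GRing.isMonoidMorphism.Build _ _ phi0 phiM.
pose pC := GRing.isScalable.Build K {mpoly K[4]} (inv_ring K) *:%R phi0 phiZ.
pose phi : {lrmorphism {mpoly K[4]} -> inv_ring K} := HB.pack phi0 pA pB pC.
pose F : {mpoly K[4]} := 'X_ord_max ^+ 2 - mwiden F0.
have muF : muni F = 'X^2 - F0%:P := muni_quadric F0.
have phiF : phi F = 0.
  apply: val_inj; rewrite inv_val0; have -> : phi F = alg_eval yR F by [].
  rewrite yR_val muF rmorphB /= map_polyXn map_polyC hornerD hornerN hornerC hornerXn.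
  by rewrite eF0 subrr.
exists 4, wt4, F, phi; split.
- by case=> -[|[|[|[|//]]]] lt; rewrite /wt4 (tnth_nth 0%N) /= ?muln_gt0 ?(ltnW q_gt1) ?q_half_gt0.
- exists (dh * 2)%N; apply: rpredB; last exact: mwiden_wt4.
  apply: dhomogMn; rewrite dhomogX.
  suff eW : weighted_mdeg wt4 U_(ord_max)%MM = dh by apply/eqP.
  rewrite /weighted_mdeg (bigD1 ord_max) //= mnm1E eqxx mul1n big1 ?addn0 //.
  by move=> j ne; rewrite mnm1E eq_sym (negPf ne).
- exact: wt4_dhomog.
- move=> r; have [P [Q e0]] := G_inv_decomp (@inv_G r).
  exists (mwiden P + mwiden Q * 'X_ord_max); apply: val_inj; rewrite e0.
  have -> : forall R, phi R = alg_eval yR R by [].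
  rewrite yR_val rmorphD rmorphM /= !muni_mwiden muniXmax rmorphD rmorphM /= !map_polyC map_polyX.
  by rewrite hornerD hornerM hornerX !hornerC.
move=> P; split=> [|[Q ->]]; last first.
  by apply: etrans (rmorphM phi Q F) _; apply: etrans (congr1 (fun z => phi Q * z) phiF) _; rewrite mulr0.
move/(congr1 val); rewrite inv_val0; have -> : phi P = alg_eval yR P by [].
rewrite yR_val; have [Z [A [B eP]]] := poly_mod_sq F0 (muni P).
rewrite eP !rmorphD !rmorphM /= rmorphB /= map_polyXn !map_polyC map_polyX !hornerE /=.
rewrite eF0 subrr mulr0 add0r addrC => /ev_A_h0_inj[A0 B0].
exists (multi Z); rewrite -[LHS]muniK eP A0 B0 !rmorph0 mul0r !addr0 rmorphM rmorphB rmorphXn /=.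
by rewrite multiX multiC.
Qed.

(** * The Hilbert series *)

(** Coefficients of the power series of H multiplied by D, in the form used by [has_hilbert_series].
    Truncating the series to a polynomial, as in [conv_coef], gives the algebraic rules. *)
Definition conv (H : nat -> int) (D : {poly int}) (n : nat) : int :=
  \sum_(i < n.+1) H (n - i)%N * D`_i.

Lemma conv_coef (H : nat -> int) D m n : (n <= m)%N ->
  conv H D n = ((\poly_(i < m.+1) H i) * D)`_n.
Proof.
move=> nm; rewrite coefMr; apply: eq_bigr => i _.
by rewrite coef_poly ltnS (leq_trans (leq_subr _ _) nm).
Qed.

Lemma eq_conv (H H' : nat -> int) D : H =1 H' -> conv H D =1 conv H' D.
Proof. by move=> e0 n; apply: eq_bigr => i _; rewrite e0. Qed.

Lemma convM (H : nat -> int) D E n : conv H (D * E) n = conv (conv H D) E n.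
Proof.
rewrite (conv_coef _ _ (leqnn n)) mulrA coefMr; apply: eq_bigr => i _.
by rewrite -conv_coef ?leq_subr.
Qed.

Lemma convD (H : nat -> int) D E n : conv H (D + E) n = conv H D n + conv H E n.
Proof. by rewrite /conv -big_split; apply: eq_bigr => i _; rewrite coefD mulrDr. Qed.

Lemma conv1 (H : nat -> int) n : conv H 1 n = H n.
Proof.
rewrite (conv_coef _ _ (leqnn n)) mulr1 coef_poly ltnSn //.
Qed.

Lemma convXn (H : nat -> int) d n : conv H 'X^d n = if (d <= n)%N then H (n - d)%N else 0.
Proof.
rewrite (conv_coef _ _ (leqnn n)) coefMXn ltnNge; case: leqP => //= dn.
by rewrite coef_poly ltnS leq_subr.
Qed.

Lemma conv_1subXn (H H' : nat -> int) d :
  (forall n, H n = H' n + if (d <= n)%N then H (n - d)%N else 0) ->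
  conv H (1 - 'X^d) =1 H'.
Proof.
move=> h n; rewrite /conv; under eq_bigr => i _ do rewrite coefB mulrBr.
rewrite sumrB -/(conv H 1 n) -/(conv H 'X^d n) conv1 convXn h.
by rewrite addrK.
Qed.

Lemma conv_delta (D : {poly int}) n : conv (fun n => (n == 0)%N%:Z) D n = D`_n.
Proof.
rewrite (conv_coef _ _ (leqnn n)) (_ : \poly_(i < _) _ = 1) ?mul1r //.
apply/polyP => i; rewrite coef_poly coef1; case: ltnP; by case: i.
Qed.

Lemma wt_gt0 i : (0 < wt i)%N.
Proof.
by move: i; apply: forall_ord3; rewrite /wt (tnth_nth 0%N) /= ?muln_gt0 ?(ltnW q_gt1) ?q_half_gt0.
Qed.

Definition mons (n : nat) : seq 'X_{1..3} := wmonomials wt 3 n.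
Definition mons_h (n : nat) : seq 'X_{1..3} := if (dh <= n)%N then mons (n - dh) else [::].

Lemma conv_mons n : conv (fun n => (size (mons n))%:Z)
  ((1 - 'X^2) * (1 - 'X^(q.+1)) * (1 - 'X^(q * q./2))) n = (n == 0)%N%:Z.
Proof.
have step (j : 'I_3) : conv (fun n => (size (wmonomials wt j.+1 n))%:Z) (1 - 'X^(wt j)) =1
    (fun n => (size (wmonomials wt j n))%:Z).
  apply: conv_1subXn => n'; rewrite (size_wmonomialsS wt_gt0) PoszD.
  by case: (_ <= _)%N.
rewrite mulrC convM.
have s2 := step (Ordinal (isT : (2 < 3)%N)); rewrite /wt (tnth_nth 0%N) /= in s2.
have s1 := step (Ordinal (isT : (1 < 3)%N)); rewrite /wt (tnth_nth 0%N) /= in s1.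
have s0 := step (Ordinal (isT : (0 < 3)%N)); rewrite /wt (tnth_nth 0%N) /= in s0.
rewrite (eq_conv _ s2) mulrC convM (eq_conv _ s1) s0.
by rewrite (size_wmonomials0 wt_gt0).
Qed.

Definition bas n (i : 'I_(size (mons n) + size (mons_h n))) : inv_ring K :=
  match split i with
  | inl j => alg_eval xR 'X_[nth 0%MM (mons n) j]
  | inr j => alg_eval xR 'X_[nth 0%MM (mons_h n) j] * hR
  end.

Lemma mons_indep n (s : seq 'X_{1..3}) (x : 'I_n -> K) : uniq s -> n = size s ->
  \sum_(i < n) x i *: ('X_[nth 0%MM s i] : T) = 0 -> forall i, x i = 0.
Proof.
move=> us ns e0 i; have := congr1 (mcoeff (nth 0%MM s i)) e0.
rewrite raddf_sum mcoeff0 (bigD1 i) //= mcoeffZ mcoeffX eqxx mulr1 big1 ?addr0 // => j ne.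
by rewrite mcoeffZ mcoeffX nth_uniq -?ns // (inj_eq val_inj) (negPf ne) mulr0.
Qed.

Lemma alg_eval_sum n (x : 'I_n -> K) (P : 'I_n -> T) :
  \sum_(i < n) x i *: alg_eval xR (P i) = alg_eval xR (\sum_(i < n) x i *: P i).
Proof.
apply: val_inj; rewrite xR_val rmorph_sum [RHS]rmorph_sum; apply: eq_bigr => i _.
by apply: etrans (inv_valZ _ _) _; rewrite xR_val -!mul_mpolyC rmorphM /= ev_AC.
Qed.

Lemma split_lshift m n (i : 'I_m) : split (lshift n i) = inl i.
Proof. exact: unsplitK (inl i). Qed.

Lemma split_rshift m n (i : 'I_n) : split (rshift m i) = inr i.
Proof. exact: unsplitK (inr i). Qed.

Lemma bas_comb n (x : 'I_(size (mons n) + size (mons_h n)) -> K) :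
  \sum_i x i *: bas i =
  alg_eval xR (\sum_(i < size (mons n)) x (lshift _ i) *: 'X_[nth 0%MM (mons n) i]) +
  alg_eval xR (\sum_(i < size (mons_h n)) x (rshift _ i) *: 'X_[nth 0%MM (mons_h n) i]) * hR.
Proof.
rewrite big_split_ord /=; congr (_ + _).
  rewrite -alg_eval_sum; apply: eq_bigr => i _.
  by rewrite /bas split_lshift.
rewrite -alg_eval_sum mulr_suml; apply: eq_bigr => i _; rewrite -scalerAl.
by rewrite /bas split_rshift.
Qed.

Lemma mons_h_uniq n : uniq (mons_h n).
Proof. by rewrite /mons_h; case: ifP => // _; apply: wmonomials_uniq. Qed.

Lemma mons_dhomog n i : (i < size (mons n))%N ->
  ('X_[nth 0%MM (mons n) i] : T) \is n.-homog for (weighted_mdeg wt).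
Proof.
move=> lt; rewrite dhomogX; apply/eqP; have := mem_nth 0%MM lt.
by case/(wmonomialsP wt_gt0).
Qed.

Lemma bas_basis n : is_basis_of (@inv_grading K n) (@bas n).
Proof.
split.
- move=> i; rewrite inE /bas; case: split => j; rewrite ?inv_valM xR_val.
    exact: (ev_A_dhomog (mons_dhomog (ltn_ord j))).
  case: j => j; rewrite /mons_h; case: ifP => // le lt.
  by have := dhomogM (ev_A_dhomog (mons_dhomog lt)) h0_dhomog; rewrite subnK.
- move=> x /eqP; rewrite bas_comb -inv_val_eq0 inv_valD inv_valM !xR_val => /eqP e0.
  have [e1 e2] := ev_A_h0_inj e0.
  have h1 := mons_indep (wmonomials_uniq wt 3 n) erefl e1.
  have h2 := mons_indep (mons_h_uniq n) erefl e2.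
  by move=> i; case: (split_ordP i) => j ->.
move=> r hr; have [P [Q [eP hP hQ]]] := G_inv_dec hr (@inv_G r).
have [y ey] : exists y : 'I_(size (mons_h n)) -> K,
    Q = \sum_i y i *: 'X_[nth 0%MM (mons_h n) i].
  case: hQ => [->|[le hQ]].
    by exists (fun=> 0); rewrite big1 // => i _; rewrite scale0r.
  rewrite /mons_h le; exists (fun i => Q@_(nth 0%MM (mons (n - dh)) i)).
  exact: (wmonomials_expand wt_gt0 hQ).
exists (fun i => match split i with
  inl j => P@_(nth 0%MM (mons n) j) | inr j => y j end).
rewrite bas_comb; apply: val_inj; rewrite inv_valD inv_valM !xR_val eP.
congr (ev_A _ + ev_A _ * _).
  rewrite {1}(wmonomials_expand wt_gt0 hP); apply: eq_bigr => i _.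
  by rewrite split_lshift.
rewrite ey; apply: eq_bigr => i _.
by rewrite split_rshift.
Qed.

Lemma bin_q : 'C(q, 2) = (q * q./2)%N.
Proof. by rewrite bin2odd ?oddq //; congr (_ * _)%N; rewrite {1}q_half /= doubleK. Qed.

Lemma bin_qS : 'C(q.+1, 2) = dh.
Proof. by rewrite binS bin1 bin_q /dh mulnS addnC. Qed.

Lemma inv_hilbert : has_hilbert_series (@inv_grading K)
    (1 + 'X^('C(q.+1, 2)))
    ((1 - 'X^2) * (1 - 'X^(q.+1)) * (1 - 'X^('C(q, 2)))).
Proof.
rewrite bin_q bin_qS; exists (fun n => (size (mons n) + size (mons_h n))%N); split.
  by move=> n; exists (@bas n); apply: bas_basis.
move=> n; rewrite -[LHS]/(conv (fun n => (size (mons n) + size (mons_h n))%N%:Z) _ n).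
set D := _ * _ * _.
rewrite (eq_conv (H' := conv (fun n => (size (mons n))%:Z) (1 + 'X^dh))); last first.
  move=> m; rewrite convD conv1 convXn PoszD /mons_h; by case: ifP.
rewrite -convM mulrC convM (eq_conv (H' := fun n => (n == 0)%N%:Z)) ?conv_delta //.
exact: conv_mons.
Qed.

(** * The a-invariant *)

Lemma ideal_gen0 (R : comNzRingType) (S : R -> Prop) : ideal_gen S 0.
Proof.
exists 0%N, (fun=> 0), (fun=> 0); split; first by case.
by rewrite big_ord0.
Qed.

Lemma ideal_gen_mul (R : comNzRingType) (S : R -> Prop) r y : S y -> ideal_gen S (r * y).
Proof.
by move=> Sy; exists 1%N, (fun=> r), (fun=> y); rewrite big_ord1.
Qed.

Lemma ideal_genD (R : comNzRingType) (S : R -> Prop) y z :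
  ideal_gen S y -> ideal_gen S z -> ideal_gen S (y + z).
Proof.
case=> n [r [s [hs ->]]] [m [r' [s' [hs' ->]]]]; exists (n + m)%N.
exists (fun i => match split i with inl j => r j | inr j => r' j end).
exists (fun i => match split i with inl j => s j | inr j => s' j end); split.
  by move=> i; case: split.
rewrite big_split_ord; congr (_ + _); apply: eq_bigr => i _.
  by rewrite split_lshift.
by rewrite split_rshift.
Qed.

Lemma alg_evalM n (x : 'I_n -> inv_ring K) (P Q : {mpoly K[n]}) :
  alg_eval x (P * Q) = alg_eval x P * alg_eval x Q.
Proof. exact: rmorphM. Qed.

Lemma alg_evalX n (x : 'I_n -> inv_ring K) i (t : nat) : alg_eval x ('X_i ^+ t) = x i ^+ t.
Proof. by rewrite /alg_eval rmorphXn /= mmapX mmap1U. Qed.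

Lemma alg_eval_prod n (x : 'I_n -> inv_ring K) :
  alg_eval x (\prod_(i < n) 'X_i) = \prod_(i < n) x i.
Proof.
by rewrite /alg_eval rmorph_prod /=; apply: eq_bigr => i _; rewrite mmapX mmap1U.
Qed.

Lemma alg_evalD n (x : 'I_n -> inv_ring K) (P Q : {mpoly K[n]}) :
  alg_eval x (P + Q) = alg_eval x P + alg_eval x Q.
Proof. exact: rmorphD. Qed.

Lemma alg_eval0 n (x : 'I_n -> inv_ring K) : alg_eval x 0 = 0.
Proof. exact: rmorph0. Qed.

Lemma inv_decomp_val (P Q : T) :
  val (alg_eval xR P + alg_eval xR Q * hR) = ev_A P + ev_A Q * h0.
Proof. by rewrite inv_valD inv_valM !xR_val. Qed.

Lemma inv_decomp (r : inv_ring K) : exists P Q : T, r = alg_eval xR P + alg_eval xR Q * hR.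
Proof.
have [P [Q e0]] := G_inv_decomp (@inv_G r); exists P, Q; apply: val_inj.
by rewrite inv_decomp_val.
Qed.

Lemma inv_decomp_inj (P Q P' Q' : T) :
  alg_eval xR P + alg_eval xR Q * hR = alg_eval xR P' + alg_eval xR Q' * hR ->
  P = P' /\ Q = Q'.
Proof.
move=> /(congr1 val) er.
have e0 := etrans (esym (inv_decomp_val P Q)) (etrans er (inv_decomp_val P' Q')).
have [eP eQ] : P - P' = 0 /\ Q - Q' = 0; last by split; apply: subr0_eq.
apply: ev_A_h0_inj; rewrite !rmorphB /= mulrBl addrACA -opprD; apply/eqP.
by rewrite subr_eq0; apply/eqP.
Qed.

Lemma xR_hsop : is_hsop (@inv_grading K) wt xR.
Proof.
split.
- move=> i; split; first exact: wt_gt0.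
  move: i; apply: forall_ord3.
  + exact: u_dhomog.
  + exact: w_dhomog.
  + exact: S0_dhomog.
- by move=> P e0; apply: alg_eval_xR; rewrite e0 alg_eval0.
exists 2%N, (tnth [tuple 1; hR]) => r; have [P [Q ->]] := inv_decomp r.
exists (tnth [tuple P; Q]); rewrite !big_ord_recl big_ord0 addr0 /= !(tnth_nth 0) /=.
by rewrite mulr1.
Qed.

(** In the basis 1, h over the polynomial ring of parameters, an element of (x_1^(k+1), x_2^(k+1),
    x_3^(k+1)) has its h-coefficient in the same monomial ideal, which does not contain (x_1 x_2
    x_3)^k. *)
Lemma cech_hR : ~ cech_class_eq0 xR hR 1.
Proof.
case=> k [n [r [s [hs]]]].
pose mk : 'X_{1..3} := [multinom k | i < 3].
suff : exists P Q : T, \sum_(i < n) r i * s i = alg_eval xR P + alg_eval xR Q * hR /\ Q@_mk = 0.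
  case=> P [Q [-> Q0]] e0.
  have [_ eQ] : 0 = P /\ (\prod_(i < 3) 'X_i) ^+ k = Q.
    apply: inv_decomp_inj; rewrite -e0 alg_eval0 add0r; congr (_ * _).
    by rewrite -alg_eval_prod /alg_eval rmorphXn.
  move: Q0; rewrite -eQ -prodrXl.
  have -> : \prod_(i < 3) ('X_i : T) ^+ k = 'X_[mk].
    by rewrite mpolyXE_id; apply: eq_bigr => i _; rewrite mnmE.
  by rewrite mcoeffX eqxx => /eqP; rewrite oner_eq0.
elim/big_ind: _ => [|y z [P [Q [-> Q0]]] [P' [Q' [-> Q0']]]|i _].
- by exists 0, 0; rewrite !alg_eval0 mul0r addr0 mcoeff0.
- exists (P + P'), (Q + Q'); rewrite !alg_evalD mcoeffD Q0 Q0' addr0; split=> //.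
  by rewrite mulrDl addrACA.
have [j ->] := hs i; have [P [Q ->]] := inv_decomp (r i).
exists (P * 'X_j ^+ (1 + k)), (Q * 'X_j ^+ (1 + k)); split.
  by rewrite !alg_evalM !alg_evalX mulrDl mulrAC.
apply/eqP; rewrite mcoeff_eq0; apply/negP.
rewrite mpolyXn (perm_mem (msuppMX _ _)) => /mapP[m _ em].
have := congr1 (fun m' : 'X_{1..3} => m' j) em.
rewrite /= mnmDE mulmnE mnm1E eqxx mul1n mnmE => e0.
by have := leq_addr (m j) (1 + k)%N; rewrite -e0 ltnn.
Qed.

(** For t positive, a monomial with all exponents below t has weight at most (t - 1) times the sum
    of the weights. The exponent t + 0 is the case k = 0 of [cech_class_eq0]. *)
Lemma wmonomial_ideal (t n : nat) (P : T) : P \is n.-homog for (weighted_mdeg wt) ->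
  (t * \sum_(i < 3) wt i < n + \sum_(i < 3) wt i)%N ->
  ideal_gen (fun y => exists i, y = xR i ^+ (t + 0)) (alg_eval xR P).
Proof.
move=> /dhomogP hP lt; rewrite (mpolyE P) big_seq; rewrite /alg_eval rmorph_sum /=.
elim/big_ind: _ => [|y z|m hm]; [exact: ideal_gen0|exact: ideal_genD|].
have [i le] : exists i : 'I_3, (t <= m i)%N.
  apply/existsP; apply: contraLR lt; rewrite negb_exists => /forallP h.
  rewrite -leqNgt -(hP m hm); case: t h => [|t] h; first by have := h 0.
  rewrite mulSn [leqLHS]addnC leq_add2l big_distrr; apply: leq_sum => i _ /=.
  by rewrite leq_mul2r -ltnS ltnNge h orbT.
have -> : P@_m *: 'X_[m] = (P@_m *: 'X_[m - (U_(i) *+ t)%MM]) * 'X_i ^+ t :> T.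
  rewrite -scalerAl mpolyXn -mpolyXD submK //; apply/mnm_lepP => j.
  by rewrite mulmnE mnm1E; case: eqP => [<-|]; rewrite ?mul1n ?mul0n.
rewrite -/(alg_eval xR _) alg_evalM alg_evalX.
by apply: ideal_gen_mul; exists i; rewrite addn0.
Qed.

Lemma sum_wt : (\sum_(i < 3) wt i = dh + 3)%N.
Proof.
rewrite !big_ord_recl big_ord0 /wt !(tnth_nth 0%N) /= /dh mulnS addn0.
by rewrite !(addSn, addnS, addn0, add0n).
Qed.

Lemma inv_a_invariant : has_a_invariant (@inv_grading K) (- 3%:Z).
Proof.
exists 3%N, wt, xR; split; first exact: xR_hsop.
  (* The class of h divided by the product of the parameters, of degree dh - (dh + 3). *)
  exists 1%N, dh, hR; split; [exact: h0_dhomog| |exact: cech_hR].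
  by rewrite mul1n sum_wt PoszD opprD addrA subrr add0r.
move=> n [t [m [r [hr <- nz]]]]; rewrite leNgt; apply/negP => lt; apply: nz.
exists 0%N; rewrite expr0 mul1r.
have {}lt : (t * \sum_(i < 3) wt i < m + 3)%N.
  move: lt; set s := (t * _)%N; rewrite -ltz_nat PoszD.
  by rewrite ltrBrDr addrC -ltrBrDr opprK.
have [P [Q [eP hP hQ]]] := G_inv_dec hr (@inv_G r).
have -> : r = alg_eval xR P + hR * alg_eval xR Q.
  by apply: val_inj; rewrite [hR * _]mulrC inv_decomp_val.
apply: ideal_genD.
  apply: (wmonomial_ideal hP); apply: leq_trans lt _.
  by rewrite leq_add2l sum_wt leq_addl.
case: hQ => [->|[le hQ]]; first by rewrite alg_eval0 mulr0; apply: ideal_gen0.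
(* The weight of Q is m - dh, and adding the sum of the weights gives exactly m + 3: here the bound
   is sharp. *)
have [] : ideal_gen (fun y => exists i, y = xR i ^+ (t + 0)) (alg_eval xR Q).
  apply: (wmonomial_ideal hQ); apply: leq_trans lt _.
  by rewrite sum_wt addnA subnK.
move=> N [x [s [hs ->]]]; rewrite mulr_sumr; elim/big_ind: _ => [|y z|i _].
- exact: ideal_gen0.
- exact: ideal_genD.
by rewrite mulrA; apply: ideal_gen_mul.
Qed.

End Main.

Theorem theorem8p3 (p e q : nat) (K : finFieldType) (delta : K) :
  prime p -> odd p -> (0 < e)%N -> q = (p ^ e)%N -> #|K| = q ->
  irreducible_poly ('X^2 + delta%:P : {poly K}) ->
  (exists s : {mpoly K[3]}, s ^+ 2 = f4_tilde delta) /\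
  (forall s : {mpoly K[3]}, s ^+ 2 = f4_tilde delta ->
     let h := jacobian (det_form K) (steenrod1_det K q) s in
     forall f : {mpoly K[3]},
       f \in @invariant_pred K <->
       in_subalgebra [tuple det_form K; steenrod1_det K q; s; h] f) /\
  is_hypersurface (@inv_grading K) /\
  has_hilbert_series (@inv_grading K)
    (1 + 'X^('C(q.+1, 2)))
    ((1 - 'X^2) * (1 - 'X^(q.+1)) * (1 - 'X^('C(q, 2)))) /\
  ~ F_regular p (inv_ring K) /\
  is_UFD (inv_ring K) /\
  has_a_invariant (@inv_grading K) (- 3%:Z).
Proof.
move=> pp po _ qE Kq hi.
(* A root x would make X - x a divisor of size 2 of an irreducible polynomial of size 3. *)
have hd (x : K) : x ^+ 2 + delta != 0.
  apply/negP => x0; case: hi => _ /(_ ('X - x%:P)).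
  rewrite size_XsubC dvdp_XsubCl rootE hornerD hornerXn hornerC => /(_ isT x0)/eqp_size.
  by rewrite size_XsubC size_polyDl ?size_polyXn // (leq_ltn_trans (size_polyC_leq1 _)).
split; first by apply: sqrt_f4; eassumption.
split; first by move=> s hs h f; apply: in_subalgebra_invariant; eassumption.
split; first by apply: inv_hypersurface; eassumption.
split; first by apply: inv_hilbert; eassumption.
split; first by apply: not_F_regular; eassumption.
split; last by apply: inv_a_invariant; eassumption.
by apply: factorial_UFD; apply: factorial_inv_ring; eassumption.
Qed.
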